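(* Let $\mu$ be a non-atomic self-similar measure on $\mathbb{R}$, and let $d\geq 2$. Let $U\subseteq\mathbb{R}$ be an open interval containing $\mathrm{supp}(\mu)$, and let $Q:U\to\mathbb{R}^d$ be either a non-trapped real analytic curve, or a $C^{d+1}$ non-degenerate curve. Let $\nu=Q\mu$ be the pushforward of $\mu$ via $Q$. Then for every $\varepsilon>0$ there exist $p>1$ and a constant $C$ (which may depend on $\varepsilon$, $d$, $Q$, $\mu$ and the maps generating $\mu$) such that for all $R>1$, $$\int_{B(R)}|\hat\nu(\xi)|^p\,d\xi\leq C R^{\varepsilon},$$ where $B(R)$ is the ball of radius $R$ around $0$ in $\mathbb{R}^d$.
   Context: A self-similar measure on $\mathbb{R}$ is a Borel probability measure $\mu$ such that $\mu=\sum_{i=1}^n \mathbf{p}_i\, f_i\mu$ for some strictly positive probability vector $\mathbf{p}=(\mathbf{p}_1,\dots,\mathbf{p}_n)$ and affine maps $f_i:\mathbb{R}\to\mathbb{R}$ with $|f_i'|\in(0,1)$, where $f_i\mu$ denotes the pushforward of $\mu$ by $f_i$. Let $U\subseteq\mathbb{R}$ be an open interval. A $C^{d+1}$ curve $Q:U\to\mathbb{R}^d$ is non-degenerate if $\det[Q^{(1)}(x)\,Q^{(2)}(x)\cdots Q^{(d)}(x)]\neq 0$ for all $x\in U$. A real analytic curve $Q:U\to\mathbb{R}^d$ is non-trapped if this determinant, as a function of $x$, has at most finitely many zeros in any compact interval (contained in $U$). The Fourier transform is $\hat\nu(\xi)=\int e^{2\pi i\langle \xi,x\rangle}\,d\nu(x)$.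 *)

(* Defs.v *)
From HB Require Import structures.
From mathcomp Require Import all_boot all_order all_algebra complex ring lra.
From mathcomp Require Import all_classical all_reals all_analysis.
From mathcomp Require Import measurable_realfun.

Set Implicit Arguments.
Unset Strict Implicit.
Unset Printing Implicit Defensive.

Import Order.TTheory GRing.Theory Num.Theory numFieldNormedType.Exports.

Local Open Scope classical_set_scope.
Local Open Scope ring_scope.
Local Open Scope complex_scope.

Section borel_rV.
Context {R : realType} {d : nat}.

Let borel : set (set 'rV[R]_d) := <<s (@open 'rV[R]_d) >>.

Let borel0 : borel set0. Proof. exact: sigma_algebra0. Qed.

Let borelC A : borel A -> borel (~` A). Proof. exact: sigma_algebraC. Qed.

Let borel_bigcup (F : (set 'rV[R]_d)^nat) :
  (forall i, borel (F i)) -> borel (\bigcup_i F i).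
Proof. exact: sigma_algebra_bigcup. Qed.

HB.instance Definition _ := @isMeasurable.Build default_measure_display
  'rV[R]_d borel borel0 borelC borel_bigcup.

End borel_rV.

Section lebesgue_measure_rV.
Context {R : realType}.
Local Open Scope ereal_scope.
Local Notation RT n := (n.-tuple (measurableTypeR R)).

Definition tuple_cons n (xt : measurableTypeR R * RT n) : RT n.+1 :=
  [tuple of xt.1 :: xt.2].

Definition row_of_tuple n (t : RT n) : 'rV[R]_n := \row_i tnth t i.

(* n-fold product of the one-dimensional Lebesgue measure; see [lebesgue_rV_box]. *)
Fixpoint lebesgue_tuple n : set (RT n) -> \bar R :=
  if n is n'.+1 then
    pushforward (@lebesgue_measure R \x @lebesgue_tuple n') (@tuple_cons n')
  else \d_([tuple] : RT 0).

Definition lebesgue_rV n : set 'rV[R]_n -> \bar R :=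
  pushforward (@lebesgue_tuple n) (@row_of_tuple n).

Lemma measurable_tuple_cons n : measurable_fun setT (@tuple_cons n).
Proof. exact: (measurable_cons measurable_fst measurable_snd). Qed.

Lemma measurable_row_of_tuple n : measurable_fun setT (@row_of_tuple n).
Proof.
pose box (qk : 'rV[rat]_n * nat) : set 'rV[R]_n :=
  [set v | forall i, ball (ratr (qk.1 0%R i) : R) qk.2.+1%:R^-1 (v 0%R i)].
apply: (@measurability _ _ _ _ setT (@row_of_tuple n) (@open 'rV[R]_n)) => //.
move=> _ [A oA <-]; rewrite setTI.
have -> : A = \bigcup_qk [set v | box qk `<=` A /\ box qk v].
  apply/seteqP; split => [v Av|v [qk _ /= [+ bv]]]; last exact.
  have /nbhs_ballP[e /= e0 eA] := open_nbhs_nbhs (conj oA Av).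
  have e20 : (0 < e / 2)%R by rewrite divr_gt0.
  have [k _ /(_ k (leqnn _)) /= ke] := near_infty_natSinv_lt (PosNum e20).
  have qP i : exists q : rat, ball (ratr q : R) k.+1%:R^-1 (v 0%R i).
    have /rat_in_itvoo[q] : (v 0 i - k.+1%:R^-1 < v 0 i + k.+1%:R^-1)%R.
      by rewrite ltrD2l gtrN// invr_gt0.
    by rewrite in_itv/= => vq; exists q; rewrite /ball/= ltr_distl.
  exists (\row_i projT1 (cid (qP i)), k) => //; split => /=.
    move=> w /= wb; apply: eA; split => // i j; rewrite (ord1 i).
    have := wb j; have := projT2 (cid (qP j)).
    rewrite mxE; set q := projT1 _; rewrite /ball/= => h1 h2.
    rewrite (_ : v 0 j - w 0 j = - (ratr q - v 0 j) + (ratr q - w 0 j))%R; last by ring.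
    by rewrite (le_lt_trans (ler_normD _ _))// normrN [ltRHS]splitr ltrD// (lt_trans _ ke).
  by move=> i; rewrite mxE; exact: (projT2 (cid (qP i))).
rewrite preimage_bigcup; apply: countable_bigcupT_measurable => // qk.
have [bA|bA] := pselect (box qk `<=` A); last first.
  by rewrite (_ : _ @^-1` _ = set0)//; apply/seteqP; split => // t [].
rewrite (_ : _ @^-1` _ = \bigcap_(i in [set: 'I_n])
    (fun t : RT n => tnth t i) @^-1` (ball (ratr (qk.1 0%R i) : R) qk.2.+1%:R^-1)).
  apply: fin_bigcap_measurable => // i _.
  rewrite -[X in measurable X]setTI; apply: measurable_tnth => //.
  exact: measurable_ball.
apply/seteqP; split=> [t [_ bt] i _|t bt]; first by have := bt i; rewrite mxE.
by split=> // i; rewrite mxE; exact: bt.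
Qed.

Lemma measurable_tuple_of_row n :
  measurable_fun setT (fun v : 'rV[R]_n => [tuple v 0%R i | i < n] : RT n).
Proof.
apply/measurable_fun_tnthP => i.
rewrite (_ : _ \o _ = (fun v : 'rV[R]_n => v 0%R i)); last first.
  by apply/funext => v /=; rewrite tnth_mktuple.
apply: (measurability _ (RGenOpens.measurableE R)).
move=> _ [_ [a [b ->] <-]]; rewrite setTI; apply: sub_sigma_algebra.
by apply: open_comp (interval_open _ _) => // v _; exact: coord_continuous.
Qed.

Lemma product_sigma_finite d1 d2 (T1 : measurableType d1)
    (T2 : measurableType d2) (m1 : {sigma_finite_measure set T1 -> \bar R})
    (m2 : {sigma_finite_measure set T2 -> \bar R}) :
  sigma_finite setT (m1 \x m2).
Proof.
have /sigma_finiteP[F [TF ndF Foo]] := sigma_finiteT m1.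
have /sigma_finiteP[G [TG ndG Goo]] := sigma_finiteT m2.
exists (fun n => F n `*` G n).
  rewrite -setXTT TF TG; apply/seteqP; split => [[x y] [[n _ Fn] [k _ Gk]]|].
    exists (maxn n k) => //; split.
      by move: Fn; exact/subsetPset/ndF/leq_maxl.
    by move: Gk; exact/subsetPset/ndG/leq_maxr.
  by move=> [x y] [n _ [Fn Gn]]; split; exists n.
move=> k; have [mF Fk] := Foo k; have [mG Gk] := Goo k.
by split; [exact: measurableX|rewrite product_measure1E// lte_mul_pinfty// ge0_fin_numE].
Qed.

Lemma pushforward_sigma_finite d1 d2 (T1 : measurableType d1)
    (T2 : measurableType d2) (m : {measure set T1 -> \bar R})
    (f : T1 -> T2) (g : T2 -> T1) :
  measurable_fun setT f -> measurable_fun setT g -> cancel f g ->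
  sigma_finite setT m ->
  exists m' : {sigma_finite_measure set T2 -> \bar R},
    m' = pushforward m f :> (set T2 -> \bar R).
Proof.
move=> mf mg fK [F TF Foo].
have [[mu cmu] /= muE] : exists mu : {measure set T2 -> \bar R},
    mu = pushforward m f :> (set T2 -> \bar R).
  by exists (measure_function_pushforward__canonical__measure_function_Measure m mf).
have sf : sigma_finite setT mu.
  exists (fun k => g @^-1` F k); first by rewrite -preimage_bigcup -TF.
  move=> k; have [mFk Fk] := Foo k; split.
    by rewrite -[X in measurable X]setTI; exact: mg.
  rewrite muE /pushforward -comp_preimage (_ : g \o f = id)//.
  by apply/funext => x /=; rewrite fK.
pose muS := @Measure_isSigmaFinite.Build _ _ _ (Measure.Pack cmu) sf.
by exists (HB.pack_for {sigma_finite_measure set T2 -> \bar R} mu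
  (Measure.Pack cmu) muS).
Qed.

Lemma lebesgue_tupleE n :
  exists m : {sigma_finite_measure set (RT n) -> \bar R},
    m = @lebesgue_tuple n :> (set (RT n) -> \bar R).
Proof.
elim: n => [|n [m mE]] /=; first by exists (\d_([tuple] : RT 0)).
rewrite -mE; apply: (@pushforward_sigma_finite _ _ _ _ _ _
  (fun t : RT n.+1 => (thead t, [tuple of behead t]))).
- exact: measurable_tuple_cons.
- apply: measurable_fun_pair; [exact: measurable_tnth|exact: measurable_behead].
- by move=> [x t]; apply: injective_projections => /=; [|exact: val_inj].
- exact: product_sigma_finite.
Qed.

Lemma lebesgue_rVE n :
  exists m : {sigma_finite_measure set 'rV[R]_n -> \bar R},
    m = @lebesgue_rV n :> (set 'rV[R]_n -> \bar R).
Proof.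
rewrite /lebesgue_rV; have [m <-] := lebesgue_tupleE n.
apply: (@pushforward_sigma_finite _ _ _ _ _ _
  (fun v : 'rV[R]_n => [tuple v 0%R i | i < n] : RT n)).
- exact: measurable_row_of_tuple.
- exact: measurable_tuple_of_row.
- by move=> t; apply: eq_from_tnth => i; rewrite tnth_mktuple mxE.
- exact: sigma_finiteT.
Qed.

Let lebesgue_rV0 n : @lebesgue_rV n set0 = 0.
Proof. by have [m <-] := lebesgue_rVE n; exact: measure0. Qed.

Let lebesgue_rV_ge0 n A : 0 <= @lebesgue_rV n A.
Proof. by have [m <-] := lebesgue_rVE n; exact: measure_ge0. Qed.

Let lebesgue_rV_sigma_additive n : semi_sigma_additive (@lebesgue_rV n).
Proof.
by have [m <-] := lebesgue_rVE n; exact: measure_semi_sigma_additive.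
Qed.

HB.instance Definition _ n := isMeasure.Build _ _ _ (@lebesgue_rV n)
  (@lebesgue_rV0 n) (@lebesgue_rV_ge0 n) (@lebesgue_rV_sigma_additive n).

Let lebesgue_rV_sigma_finite n : sigma_finite setT (@lebesgue_rV n).
Proof. by have [m <-] := lebesgue_rVE n; exact: sigma_finiteT. Qed.

HB.instance Definition _ n := Measure_isSigmaFinite.Build _ _ _
  (@lebesgue_rV n) (@lebesgue_rV_sigma_finite n).

Lemma lebesgue_tuple_box n (A : 'I_n -> set (measurableTypeR R)) :
  (forall i, measurable (A i)) ->
  @lebesgue_tuple n [set t | forall i, A i (tnth t i)] =
  \prod_(i < n) lebesgue_measure (A i).
Proof.
elim: n A => [|n IH] A mA /=.
  by rewrite big_ord0 diracE mem_set//= => -[].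
rewrite big_ord_recl -IH// /pushforward.
rewrite (_ : _ @^-1` _ =
  A ord0 `*` [set t | forall i, A (lift ord0 i) (tnth t i)]); last first.
  apply/seteqP; split => [[x t] /= At|[x t] /= [Ax At] i].
    split; first exact: (At ord0).
    by move=> i; have := At (lift ord0 i); rewrite tnthS.
  by case: (unliftP ord0 i) => [j|] ->; rewrite ?tnthS.
have [m mE] := lebesgue_tupleE n; rewrite -mE product_measure1E//.
rewrite (_ : [set t | _] = \bigcap_(i in [set: 'I_n])
    (fun t : RT n => tnth t i) @^-1` A (lift ord0 i)).
  apply: fin_bigcap_measurable => // i _.
  by rewrite -[X in measurable X]setTI; exact: measurable_tnth.
by apply/seteqP; split => t /= At i; [move=> _|]; exact: At.
Qed.

Lemma lebesgue_rV_box n (A : 'I_n -> set R) : (forall i, measurable (A i)) ->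
  lebesgue_rV [set v : 'rV[R]_n | forall i, A i (v 0%R i)] =
  \prod_(i < n) lebesgue_measure (A i).
Proof.
move=> mA; rewrite -lebesgue_tuple_box// /lebesgue_rV /pushforward.
congr (lebesgue_tuple _).
by apply/seteqP; split => t /= At i; have := At i; rewrite mxE.
Qed.

End lebesgue_measure_rV.
Arguments lebesgue_rV {R} n _.

Section self_similar.
Context {R : realType}.
Local Open Scope ereal_scope.

Definition measure_support (mu : set R -> \bar R) : set R :=
  [set x | forall V, open V -> V x -> 0 < mu V].

Definition non_atomic (mu : set R -> \bar R) := forall x, mu [set x] = 0.

Definition self_similar (mu : set R -> \bar R) :=
  exists (n : nat) (w a b : 'I_n -> R),
  [/\ forall i, (0 < w i)%R, (\sum_i w i = 1)%R,
      forall i, (0 < `|a i| < 1)%R &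
      forall A, measurable A ->
        mu A = \sum_i (w i)%:E * pushforward mu (fun x : R => a i * x + b i)%R A].

End self_similar.

Section curve.
Context {R : realType} {d : nat}.
Implicit Types (U : set R) (Q : R -> 'rV[R]_d).

(* Curves on an open [U] are total functions; their values outside of [U] are
   irrelevant. *)

Definition class_C (k : nat) U Q :=
  (forall j x, (j < k)%N -> U x -> derivable (derive1n j Q) x 1) /\
  (forall x, U x -> {for x, continuous (derive1n k Q)}).

Definition real_analytic U Q := forall a, U a ->
  exists c : nat -> 'rV[R]_d,
    \forall x \near a, series (fun n => (x - a) ^+ n *: c n) @ \oo --> Q x.

Definition curve_det Q (x : R) : R :=
  \det (\matrix_(i < d, j < d) derive1n j.+1 Q x 0 i).

Definition nondegenerate_curve U Q := forall x, U x -> curve_det Q x != 0.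

Definition non_trapped_curve U Q := forall a b : R, `[a, b] `<=` U ->
  finite_set [set x | x \in `[a, b] /\ curve_det Q x = 0].

(* [Q \_ U] is [Q] on [U] and constant elsewhere. *)
Definition curve_measure (mu : set R -> \bar R) U Q : set 'rV[R]_d -> \bar R :=
  pushforward mu (Q \_ U).

End curve.

Section fourier.
Context {R : realType} {d : nat}.
Implicit Types (nu : set 'rV[R]_d -> \bar R) (x xi : 'rV[R]_d).

Definition dotp xi x : R := \sum_i xi 0 i * x 0 i.

(* The norm of ['rV[R]_d] is the sup norm. *)
Definition euclidean_ball (r : R) : set 'rV[R]_d :=
  [set xi | Num.sqrt (dotp xi xi) < r].

(* nu is only a set function here: the pushforward by a map is a measure only
   when that map is measurable. The two parts come from e^(it) = cos t + i sin t. *)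
Definition fourier nu xi : R[i] :=
  fine (\int[nu]_x (cos (2 * pi * dotp xi x))%:E)%E +i*
  fine (\int[nu]_x (sin (2 * pi * dotp xi x))%:E)%E.

End fourier.

(* Main.v *)
Require Import Defs.
From mathcomp Require Import all_boot all_order all_algebra complex ring lra.
From mathcomp Require Import all_classical all_reals all_analysis.
From mathcomp Require Import measurable_realfun.

(** Call a frequency v with |v| <= r large if the Fourier transform of nu at v is
    at least r^(-delta). Let L be the exponent for which a 1-separated set of
    large frequencies has at most r^L elements.

    Cut mu along words whose contraction is a small negative power of r, so that
    Q is nearly affine on each piece: the transform of nu at v becomes an average
    over the words t of the transform of mu at slope_t(v), where slope_t(v) is
    the contraction of t times <v, Q'>. By an Erdos-Kahane type argument the
    transform of mu is large on few cells of the line. If v and w are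
    far apart, then slope_t(v) and slope_t(w) are rarely in the same cell, because
    <v - w, Q'> is rarely small: it has few small sublevel intervals by
    non-degeneracy, and each has small mass by a Frostman estimate. By
    Cauchy-Schwarz, an r^(5/6)-separated set of large frequencies therefore has
    at most r^kappa elements, for every kappa > 0.

    By positive-definiteness of the transform, the large frequencies in a ball of
    radius r^(5/6) are controlled by the differences, which are large in that
    smaller ball. So L can be replaced by 9 L / 10, and iterating makes it
    arbitrarily small. Covering the large frequencies by cubes bounds the
    integral over them, and for p large the other frequencies contribute O(1). *)

Set Implicit Arguments.
Unset Strict Implicit.
Unset Printing Implicit Defensive.

Import Order.TTheory GRing.Theory Num.Theory numFieldNormedType.Exports.

Local Open Scope classical_set_scope.
Local Open Scope ring_scope.

(** * Bounded measurable functions and their means *)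

Section bounded_measurable.
Context {R : realType}.
Implicit Types h g phi psi : R -> R.

(** The exponent 5/6 comes from two competing demands. Write the radius as x^6 and let the pieces
    have length x^-4. Linearising the curve costs x^6 * (x^-4)^2, which decays only for pieces
    shorter than x^-3. Two frequencies x^5 apart have slopes differing by about x^5 * x^-4, which
    must exceed the fixed cell size, so the separation has to beat x^4.

    The maps may have different ratios, so there is no common scale along which to multiply cosines.
    Instead, the two orders of composing two maps give equal ratios and weights but different
    translations; their interference produces a cosine. Sums of a high power of the transform over
    cells then grow, from one scale to the next, by an arbitrarily small power of the ratio of the
    scales.

    The separated count says nothing inside a ball of radius r^(5/6). There the differences v - w
    live at that smaller radius, so an exponent L returns as 5 L / 6 plus losses. The value 9/10
    leaves L / 15 for the number of balls, the threshold and the constants. *)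

Definition bmeas h := measurable_fun setT h /\ exists M : R, forall x, `|h x| <= M.

Lemma bmeas_cst c : bmeas (cst c).
Proof. by split=> //; exists `|c|. Qed.

Lemma bmeasD h g : bmeas h -> bmeas g -> bmeas (fun x => h x + g x).
Proof.
move=> [mh [M hM]] [mg [N gN]]; split; first exact: measurable_funD.
by exists (M + N) => x; rewrite (le_trans (ler_normD _ _))// lerD.
Qed.

Lemma bmeasM h g : bmeas h -> bmeas g -> bmeas (fun x => h x * g x).
Proof.
move=> [mh [M hM]] [mg [N gN]]; split; first exact: measurable_funM.
by exists (M * N) => x; rewrite normrM ler_pM.
Qed.

Lemma bmeasZ c h : bmeas h -> bmeas (fun x => c * h x).
Proof. by move=> ?; apply: bmeasM => //; exact: bmeas_cst. Qed.

Lemma bmeasN h : bmeas h -> bmeas (fun x => - h x).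
Proof.
by move=> /(bmeasZ (-1)); under [X in bmeas X -> _]eq_fun do rewrite mulN1r.
Qed.

Lemma bmeasB h g : bmeas h -> bmeas g -> bmeas (fun x => h x - g x).
Proof. by move=> ? ?; apply: bmeasD => //; exact: bmeasN. Qed.

Lemma bmeas_sum (I : Type) (s : seq I) (F : I -> R -> R) :
  (forall i, bmeas (F i)) -> bmeas (fun x => \sum_(i <- s) F i x).
Proof.
move=> bF; elim: s => [|i s IH].
  by under eq_fun do rewrite big_nil; exact: bmeas_cst.
by under eq_fun do rewrite big_cons; exact: bmeasD.
Qed.

Lemma bmeas_cos phi : measurable_fun setT phi -> bmeas (fun x => cos (phi x)).
Proof.
move=> mphi; split; last by exists 1 => x; rewrite ler_norml cos_geN1 cos_le1.
apply: (@measurableT_comp _ _ _ _ _ _ (@cos R)) => //.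
by apply: continuous_measurable_fun; exact: continuous_cos.
Qed.

Lemma bmeas_sin phi : measurable_fun setT phi -> bmeas (fun x => sin (phi x)).
Proof.
move=> mphi; split; last by exists 1 => x; rewrite ler_norml sin_geN1 sin_le1.
apply: (@measurableT_comp _ _ _ _ _ _ (@sin R)) => //.
by apply: continuous_measurable_fun; exact: continuous_sin.
Qed.

Lemma bmeas_indic (A : set R) : measurable A -> bmeas (\1_A).
Proof.
move=> mA; split; first exact: measurable_indic.
by exists 1 => x; rewrite indicE ger0_norm// lern1 leq_b1.
Qed.

Lemma bmeas_affine h a b : bmeas h -> bmeas (fun x => h (a * x + b)).
Proof.
move=> [mh [M hM]]; split; last by exists M.
apply: (@measurableT_comp _ _ _ _ _ _ h) => //.
by apply: measurable_funD => //; exact: measurable_funM.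
Qed.

End bounded_measurable.

Section expectation.
Context {R : realType} (mu : probability R R).
Implicit Types h g phi psi : R -> R.

Definition expect h : R := \int[mu]_x h x.

Lemma bmeas_integrable h : bmeas h -> mu.-integrable setT (EFin \o h).
Proof.
move=> [mh [M hM]].
apply: measurable_bounded_integrable => //.
  have mu1 : (mu setT < +oo)%E by rewrite probability_setT ltry.
  exact: mu1.
exists M; split; first by rewrite num_real.
by move=> y My x _ /=; rewrite (le_trans (hM x))// ltW.
Qed.

Lemma expect_cst c : expect (cst c) = c.
Proof.
have mu1 : c * fine (mu setT) = c by rewrite probability_setT mulr1.
by rewrite -[RHS]mu1; exact: Rintegral_cst.
Qed.

Lemma expectD h g : bmeas h -> bmeas g ->
  expect (fun x => h x + g x) = expect h + expect g.
Proof. by move=> bh bg; apply: RintegralD => //; exact: bmeas_integrable. Qed.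

Lemma expectZ c h : bmeas h -> expect (fun x => c * h x) = c * expect h.
Proof. by move=> bh; apply: RintegralZl => //; exact: bmeas_integrable. Qed.

Lemma expectB h g : bmeas h -> bmeas g ->
  expect (fun x => h x - g x) = expect h - expect g.
Proof. by move=> bh bg; apply: RintegralB => //; exact: bmeas_integrable. Qed.

Lemma expect_sum (I : Type) (s : seq I) (F : I -> R -> R) :
  (forall i, bmeas (F i)) ->
  expect (fun x => \sum_(i <- s) F i x) = \sum_(i <- s) expect (F i).
Proof.
move=> bF; elim: s => [|i s IH].
  rewrite big_nil; under [X in expect X]eq_fun do rewrite big_nil.
  exact: expect_cst.
rewrite big_cons -IH -expectD//; last exact: bmeas_sum.
by congr expect; apply/funext => x; rewrite big_cons.
Qed.

Lemma expect_le h g : bmeas h -> bmeas g -> (forall x, h x <= g x) ->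
  expect h <= expect g.
Proof.
by move=> bh bg hg; apply: le_Rintegral => //; exact: bmeas_integrable.
Qed.

Lemma expect_ge0 h : (forall x, 0 <= h x) -> 0 <= expect h.
Proof. by move=> h0; apply: Rintegral_ge0. Qed.

Lemma expect_indic (A : set R) : measurable A -> mu A = (expect (\1_A))%:E.
Proof.
move=> mA; rewrite /expect /Rintegral -[RHS]/((fine _)%:E).
rewrite integral_indic// setIT fineK//.
by rewrite fin_num_measure.
Qed.

Lemma expect_indic1 (A : set R) : measurable A -> expect (\1_A) <= 1.
Proof.
move=> mA; rewrite -[leRHS]expect_cst; apply: expect_le => [||x].
- exact: bmeas_indic.
- exact: bmeas_cst.
- by rewrite indicE lern1 leq_b1.
Qed.

(** A bounded [f] differs from [\1_A * f] by at most [M * (1 - \1_A)], which has mean zero. This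
    allows pointwise bounds known only on the hull of the support. *)
Lemma expect_le_on (A : set R) h g : measurable A -> expect (\1_A) = 1 ->
  bmeas h -> bmeas g -> (forall x, A x -> h x <= g x) -> expect h <= expect g.
Proof.
move=> mA A1 bh bg hg.
have bA := bmeas_indic mA.
have key f : bmeas f -> expect (fun x => \1_A x * f x) = expect f.
  move=> bf; case: (bf) => mf [M fM].
  apply/eqP; rewrite -subr_eq0 -normr_le0.
  have N1A : bmeas (fun x => 1 - \1_A x).
    by apply: bmeasB => //; exact: bmeas_cst.
  have M0 : expect (fun x => M * (1 - \1_A x)) = 0.
    rewrite expectZ// expectB ?A1 ?expect_cst ?subrr ?mulr0//.
    exact: bmeas_cst.
  rewrite -expectB//; last exact: bmeasM.
  rewrite ler_norml -M0; apply/andP; split; last first.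
    apply: expect_le => [||x].
    - by apply: bmeasB => //; exact: bmeasM.
    - exact: bmeasZ.
    - have := fM x; rewrite ler_norml => /andP[f1 f2].
      by rewrite indicE; case: (_ \in _) => /=; rewrite ?mul0r ?mul1r; lra.
  rewrite -mulN1r -expectZ; last exact: bmeasZ.
  apply: expect_le => [||x].
  - by apply: bmeasZ; exact: bmeasZ.
  - by apply: bmeasB => //; exact: bmeasM.
  - have := fM x; rewrite ler_norml => /andP[f1 f2].
    by rewrite indicE; case: (_ \in _) => /=; rewrite ?mul0r ?mul1r; lra.
rewrite -(key h)// -(key g)//; apply: expect_le => [||x]; try exact: bmeasM.
rewrite indicE; have [/set_mem Ax|_] := boolP (x \in A); rewrite ?mul1r ?mul0r//.
exact: hg.
Qed.

End expectation.

Section self_similar_expect.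
Context {R : realType} (mu : probability R R).

(** For nonnegative functions this is integration against a sum of scaled pushforwards; a bounded
    function becomes nonnegative after adding a constant, and the weights sum to 1. *)
Lemma self_similar_expect (n : nat) (w a b : 'I_n -> R) :
  (forall i, 0 < w i) -> \sum_i w i = 1 ->
  (forall A, measurable A -> mu A =
    \sum_i (w i)%:E * pushforward mu (fun x : R => a i * x + b i)%R A)%E ->
  forall h, bmeas h ->
  expect mu h = \sum_i w i * expect mu (fun x => h (a i * x + b i)).
Proof.
move=> w0 w1 muE.
have maff i : measurable_fun setT (fun x : R => a i * x + b i).
  by apply: measurable_funD => //; exact: measurable_funM.
case: n w a b w0 w1 muE maff => [|n] w a b w0 w1 muE maff.
  by move: w1; rewrite big_ord0 => /esym/eqP; rewrite oner_eq0.
pose pf i : {measure set R -> \bar R} :=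
  measure_function_pushforward__canonical__measure_function_Measure mu (maff i).
(* [msum] takes a sequence of measures indexed by [nat], so indices are brought back by [inord],
   which needs a nonempty ordinal type. *)
pose m_ (k : nat) : {measure set R -> \bar R} :=
  mscale (NngNum (ltW (w0 (inord k)))) (pf (inord k)).
have ge0E h : bmeas h -> (forall x, 0 <= h x) ->
    expect mu h = \sum_i w i * expect mu (fun x => h (a i * x + b i)).
  move=> bh h0.
  have mh : measurable_fun setT (EFin \o h).
    by apply: measurableT_comp => //; case: bh.
  have -> : expect mu h = fine (\int[msum m_ n.+1]_x (h x)%:E).
    congr fine; apply: eq_measure_integral => A mA _.
    transitivity (mu A) => //.
    rewrite muE// /msum/=; apply: eq_bigr => i _.
    by rewrite /mscale/= /pushforward /= !inord_val.
  rewrite ge0_integral_measure_sum//; last by move=> x _; rewrite lee_fin.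
  rewrite [X in fine X](eq_bigr (fun i : 'I_n.+1 =>
     (w i * expect mu (fun x => h (a i * x + b i)))%:E)) ?sumEFin//.
  move=> i _; rewrite ge0_integral_mscale//; last by move=> x _; rewrite lee_fin.
  rewrite ge0_integral_pushforward//; last by move=> x _; rewrite lee_fin.
  rewrite inord_val/= preimage_setT EFinM; congr (_ * _)%E.
  rewrite /expect /Rintegral fineK//.
  by apply: integrable_fin_num => //; apply: bmeas_integrable; exact: bmeas_affine.
move=> h bh; case: (bh) => mh [M hM].
have bM := bmeas_cst M.
have bhM : bmeas (fun x => h x + M) by apply: bmeasD.
have := ge0E _ bhM; rewrite expectD// expect_cst => H.
have {}H : expect mu h + M = \sum_i w i * expect mu (fun x => h (a i * x + b i) + M).
  by apply: H => x; have := hM x; rewrite ler_norml => /andP[]; lra.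
apply: (addIr M); rewrite H.
under eq_bigr => i _ do
  rewrite (expectD _ (bmeas_affine (a i) (b i) bh) bM) expect_cst mulrDr.
by rewrite big_split/= -mulr_suml w1 mul1r.
Qed.

End self_similar_expect.

(** * Moduli of oscillatory integrals *)

Section oscillation.
Context {R : realType} (mu : probability R R).
Implicit Types h g phi psi : R -> R.
Local Notation E := (expect mu).
Local Notation measR phi := (measurable_fun [set: R] phi).

(* The modulus of the integral of e^(i phi). *)
Definition osc phi : R :=
  Num.sqrt (E (fun x => cos (phi x)) ^+ 2 + E (fun x => sin (phi x)) ^+ 2).

Lemma osc_ge0 phi : 0 <= osc phi. Proof. exact: sqrtr_ge0. Qed.

Lemma expect_cosB phi t : measR phi ->
  E (fun x => cos (phi x - t)) =
  cos t * E (fun x => cos (phi x)) + sin t * E (fun x => sin (phi x)).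
Proof.
move=> mphi; have bc := bmeas_cos mphi; have bs := bmeas_sin mphi.
rewrite -!expectZ// -expectD//; try exact: bmeasZ.
by congr (E _); apply/funext => x; rewrite cosB mulrC [in X in _ + X]mulrC.
Qed.

(** Cauchy-Schwarz against the unit vector (cos t, sin t). With [osc_attained], the modulus is the
    maximum over t of a real mean, and this takes the place of complex arithmetic throughout. *)
Lemma expect_cos_le_osc phi t : measR phi -> E (fun x => cos (phi x - t)) <= osc phi.
Proof.
move=> mphi; rewrite expect_cosB// /osc.
set A := E _; set B := E _.
apply: (le_trans (ler_norm _)); rewrite -sqrtr_sqr ler_wsqrtr//.
have := cos2Dsin2 t; set c := cos t; set s := sin t => cs.
rewrite -subr_ge0.
have -> : A ^+ 2 + B ^+ 2 - (c * A + s * B) ^+ 2 = (s * A - c * B) ^+ 2.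
  by rewrite -[A ^+ 2 + B ^+ 2]mul1r -cs; ring.
exact: sqr_ge0.
Qed.

Lemma osc_attained phi : measR phi ->
  exists t, E (fun x => cos (phi x - t)) = osc phi.
Proof.
move=> mphi; suff [t [c s]] : exists t, osc phi * cos t = E (fun x => cos (phi x)) /\
    osc phi * sin t = E (fun x => sin (phi x)).
  by exists t; rewrite expect_cosB// -c -s -[RHS]mulr1 -(cos2Dsin2 t); ring.
rewrite /osc; set A := E _; set B := E _; set o := Num.sqrt _.
have o2 : o ^+ 2 = A ^+ 2 + B ^+ 2 by rewrite sqr_sqrtr// addr_ge0// sqr_ge0.
have A2 : 0 <= A ^+ 2 by exact: sqr_ge0.
have B2 : 0 <= B ^+ 2 by exact: sqr_ge0.
have [z0|z0] := eqVneq o 0.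
  move: o2; rewrite z0 expr0n/= => /esym/eqP; rewrite paddr_eq0// !sqrf_eq0.
  by move=> /andP[/eqP-> /eqP->]; exists 0; rewrite !mul0r.
have og : 0 < o by rewrite lt_def z0 sqrtr_ge0.
have Ao : -1 <= A / o <= 1.
  rewrite -ler_norml -(ler_pXn2r (n := 2))// ?nnegrE// -normrX expr1n.
  by rewrite ger0_norm ?sqr_ge0// expr_div_n o2 ler_pdivrMr -?o2 ?exprn_gt0// mul1r o2 lerDl.
have sE : o * Num.sqrt (1 - (A / o) ^+ 2) = `|B|.
  rewrite -{1}(gtr0_norm og) -sqrtr_sqr -sqrtrM ?sqr_ge0// mulrBr mulr1 expr_div_n.
  by rewrite mulrCA divff ?mulr1 ?sqrf_eq0// o2 addrC addKr sqrtr_sqr.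
(* [acos] only reaches angles in [0, pi]; the sign of the sine part decides between the angle and
   its opposite. *)
have [B0|B0] := leP 0 B.
  exists (acos (A / o)); rewrite acosK ?in_itv// sin_acos// sE ger0_norm//.
  by split=> //; rewrite mulrC divfK.
exists (- acos (A / o)); rewrite cosN sinN acosK ?in_itv// sin_acos// mulrN sE ltr0_norm//.
by rewrite opprK; split=> //; rewrite mulrC divfK.
Qed.

Lemma osc_le1 phi : measR phi -> osc phi <= 1.
Proof.
move=> mphi; have [t <-] := osc_attained mphi.
rewrite -[leRHS](expect_cst mu 1); apply: expect_le => [||x]; rewrite ?cos_le1//.
- by apply: bmeas_cos; apply: measurable_funB.
- exact: bmeas_cst.
Qed.

Lemma cos_lip (x y : R) : `|cos x - cos y| <= `|x - y|.
Proof.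
wlog xy : x y / x <= y.
  move=> H; have [|/ltW] := leP x y; first exact: H.
  by move=> /H; rewrite distrC [leRHS]distrC.
move: xy; rewrite le_eqVlt => /orP[/eqP->|xy]; first by rewrite !subrr.
have [|c _ sE] := @MVT R (@cos R) (fun z => - sin z) x y xy.
  by apply: continuous_subspaceT; exact: continuous_cos.
rewrite distrC sE normrM normrN [leRHS]distrC ler_piMl//.
by rewrite ler_norml sin_geN1 sin_le1.
Qed.

Lemma osc_le_near (A : set R) phi psi s : measurable A -> E (\1_A) = 1 ->
  measR phi -> measR psi -> (forall x, A x -> `|phi x - psi x| <= s) ->
  osc phi <= osc psi + s.
Proof.
move=> mA A1 mphi mpsi near; have [t <-] := osc_attained mphi.
have bpsi : bmeas (fun x => cos (psi x - t)).
  by apply: bmeas_cos; exact: measurable_funB.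
apply: (@le_trans _ _ (E (fun x => cos (psi x - t) + s))).
  apply: (expect_le_on mA A1) => [||x Ax].
  - by apply: bmeas_cos; exact: measurable_funB.
  - by apply: bmeasD => //; exact: bmeas_cst.
  - rewrite -lerBlDl; apply: le_trans (near x Ax).
    apply: (le_trans (ler_norm _)); apply: (le_trans (cos_lip _ _)).
    by rewrite opprB addrA subrK.
rewrite expectD//; last exact: bmeas_cst.
by rewrite expect_cst lerD2r expect_cos_le_osc.
Qed.

Lemma expect_sqr_le h : bmeas h -> E h ^+ 2 <= E (fun x => h x ^+ 2).
Proof.
move=> bh; set m := E h.
have bh2 : bmeas (fun x => h x ^+ 2).
  by under eq_fun do rewrite expr2; exact: bmeasM.
have : 0 <= E (fun x => (h x ^+ 2 - (2 * m) * h x) + m ^+ 2).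
  apply: expect_ge0 => x.
  by rewrite (_ : _ + _ = (h x - m) ^+ 2) ?sqr_ge0//; ring.
rewrite expectD ?expectB ?expect_cst ?expectZ//.
- by rewrite -/m => H; rewrite -subr_ge0; apply: (le_trans H); lra.
- exact: bmeasZ.
- by apply: bmeasB => //; exact: bmeasZ.
- exact: bmeas_cst.
Qed.

(* The matrix of the integrals of e^(i (phi_k - phi_l)) is positive semidefinite. *)
Lemma sum_osc_sqr_le (I : finType) (phi : I -> R -> R) :
  (forall i, measR (phi i)) ->
  (\sum_i osc (phi i)) ^+ 2 <= \sum_i \sum_j osc (fun x => phi i x - phi j x).
Proof.
move=> mphi.
pose t i := projT1 (cid (osc_attained (mphi i))).
have tE i : E (fun x => cos (phi i x - t i)) = osc (phi i).
  exact: projT2 (cid (osc_attained (mphi i))).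
have mB i : measR (fun x => phi i x - t i) by exact: measurable_funB.
have bc i : bmeas (fun x => cos (phi i x - t i)) by exact: bmeas_cos.
have bs i : bmeas (fun x => sin (phi i x - t i)) by exact: bmeas_sin.
under eq_bigr do rewrite -tE.
rewrite -expect_sum//; apply: (le_trans (expect_sqr_le _)); first exact: bmeas_sum.
have mD i j : measR (fun x => phi i x - phi j x) by exact: measurable_funB.
have bC i j : bmeas (fun x => cos (phi i x - phi j x - (t i - t j))).
  by apply: bmeas_cos; exact: measurable_funB.
apply: (@le_trans _ _ (E (fun x => \sum_i \sum_j
    cos (phi i x - phi j x - (t i - t j))))).
  have bS : bmeas (fun x => \sum_i cos (phi i x - t i)) by exact: bmeas_sum.
  apply: expect_le => [||x].
  - by under eq_fun do rewrite expr2; exact: bmeasM.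
  - by apply: bmeas_sum => i; exact: bmeas_sum.
  (* Adding the square of the sine sum to that of the cosine sum yields exactly the double sum of
     cosines of differences. *)
  - have -> : \sum_i \sum_j cos (phi i x - phi j x - (t i - t j)) =
      (\sum_i cos (phi i x - t i)) ^+ 2 + (\sum_i sin (phi i x - t i)) ^+ 2.
      rewrite !expr2 !mulr_suml -big_split/=; apply: eq_bigr => i _.
      rewrite !mulr_sumr -big_split/=; apply: eq_bigr => j _.
      by rewrite -cosB; congr cos; ring.
    by rewrite lerDl sqr_ge0.
rewrite expect_sum; last by move=> i; exact: bmeas_sum.
apply: ler_sum => i _; rewrite expect_sum//; apply: ler_sum => j _.
exact: expect_cos_le_osc.
Qed.

End oscillation.

(** * Expansions of the measure over words *)

Section representations.
Context {R : realType} (mu : probability R R).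
Implicit Types (h phi : R -> R) (L B : seq (R * R * R)).
Local Notation E := (expect mu).
Local Notation measR phi := (measurable_fun [set: R] phi).

(* (q, a, b) stands for the map x |-> a x + b with weight q. *)
Definition represents L :=
  [/\ forall t, t \in L -> 0 < t.1.1 /\ t.1.2 != 0, \sum_(t <- L) t.1.1 = 1 &
      forall h, bmeas h ->
        E h = \sum_(t <- L) t.1.1 * E (fun x => h (t.1.2 * x + t.2))].

Lemma represents_id : represents [:: (1, 1, 0)].
Proof.
split=> [t||h bh]; rewrite ?big_seq1//=.
  by rewrite inE => /eqP->/=; rewrite ltr01 oner_neq0.
by rewrite mul1r; congr (E _); apply/funext => x; rewrite mul1r addr0.
Qed.

(** [P] selects the words to subdivide: [predT] composes the two lists, while a threshold on the
    contraction gives a stopping time. *)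
Definition refine (P : pred (R * R * R)) B L := flatten [seq
  if P t then [seq (t.1.1 * u.1.1, t.1.2 * u.1.2, t.1.2 * u.2 + t.2) | u <- B]
  else [:: t] | t <- L].

Lemma represents_refine P B L :
  represents B -> represents L -> represents (refine P B L).
Proof.
move=> [B0 B1 BE] [L0 L1 LE]; split=> [t||h bh].
- move=> /flattenP[s /mapP[u uL ->]]; case: ifP => _.
    move=> /mapP[v vB ->]/=; have [? ?] := L0 _ uL; have [? ?] := B0 _ vB.
    by rewrite mulr_gt0// mulf_neq0.
  by rewrite inE => /eqP->; exact: L0.
- rewrite -L1 big_flatten big_map; apply: eq_bigr => t _; case: ifP => _.
    by rewrite big_map/= -mulr_sumr B1 mulr1.
  by rewrite big_seq1.
- rewrite LE// big_flatten big_map; apply: eq_bigr => t _; case: ifP => _.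
    rewrite big_map/= BE; last exact: bmeas_affine.
    rewrite mulr_sumr; apply: eq_bigr => u _; rewrite mulrA; congr (_ * E _).
    by apply/funext => x; congr h; ring.
  by rewrite big_seq1.
Qed.

Lemma measurable_affine (a b : R) : measR (fun x : R => a * x + b).
Proof. by apply: measurable_funD => //; exact: measurable_funM. Qed.

Lemma osc_le_represents L phi : represents L -> measR phi ->
  osc mu phi <= \sum_(t <- L) t.1.1 * osc mu (fun x => phi (t.1.2 * x + t.2)).
Proof.
move=> [L0 _ LE] mphi; have [t <-] := osc_attained mu mphi.
rewrite LE; last by apply: bmeas_cos; exact: measurable_funB.
rewrite big_seq [leRHS]big_seq; apply: ler_sum => u uL.
rewrite ler_wpM2l//; first by have [/ltW] := L0 _ uL.
apply: (@expect_cos_le_osc _ _ (fun x => phi (u.1.2 * x + u.2))).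
by apply: (@measurableT_comp _ _ _ _ _ _ phi) => //; exact: measurable_affine.
Qed.

Lemma represents_self_similar : self_similar mu ->
  exists B, represents B /\ forall t, t \in B -> `|t.1.2| < 1.
Proof.
move=> [n [w [a [b [w0 w1 a1 muE]]]]].
exists [seq (w i, a i, b i) | i <- index_enum 'I_n]; split; first split.
- by move=> t /mapP[i _ ->]/=; rewrite w0 -normr_gt0; have /andP[] := a1 i.
- by rewrite big_map.
- by move=> h bh; rewrite big_map/=; exact: self_similar_expect.
- by move=> t /mapP[i _ ->]/=; have /andP[] := a1 i.
Qed.

End representations.

Section list_bounds.
Context {R : realType} {T : eqType}.

Lemma seq_ubound (s : seq T) (f : T -> R) : exists M, forall t, t \in s -> f t <= M.
Proof.
elim: s => [|t s [M H]]; first by exists 0.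
exists (Num.max (f t) M) => u; rewrite inE => /orP[/eqP->|us].
  by rewrite le_max lexx.
by rewrite le_max H// orbT.
Qed.

Lemma seq_ubound_lt (s : seq T) (f : T -> R) c : 0 < c ->
  (forall t, t \in s -> f t < c) ->
  exists2 M, 0 < M < c & forall t, t \in s -> f t <= M.
Proof.
move=> c0; elim: s => [|t s IH] H.
  by exists (c / 2) => //; rewrite divr_gt0//= ltr_pdivrMr// ltr_pMr// ltr1n.
have [u us|M /andP[M0 M1] HM] := IH; first by apply: H; rewrite inE us orbT.
exists (Num.max (f t) M) => [|u].
  by rewrite lt_max M0 orbT gt_max M1 H// inE eqxx.
rewrite inE => /orP[/eqP->|us]; first by rewrite le_max lexx.
by rewrite le_max HM// orbT.
Qed.

Lemma seq_lbound_gt (s : seq T) (f : T -> R) :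
  (forall t, t \in s -> 0 < f t) ->
  exists2 m, 0 < m & forall t, t \in s -> m <= f t.
Proof.
elim: s => [|t s IH] H; first by exists 1.
have [u us|m m0 Hm] := IH; first by apply: H; rewrite inE us orbT.
exists (Num.min (f t) m) => [|u].
  by rewrite lt_min m0 H// inE eqxx.
rewrite inE => /orP[/eqP->|us]; first by rewrite ge_min lexx.
by rewrite ge_min Hm// orbT.
Qed.

End list_bounds.

Section powers.
Context {R : realType}.

Lemma exprn_small (a e : R) : 0 <= a < 1 -> 0 < e -> exists n, a ^+ n < e.
Proof.
move=> /andP[a0 a1] e0.
have an : `|a| < 1 by rewrite ger0_norm.
have /cvgrPdist_lt /(_ _ e0)[n _ /(_ n (leqnn _))] := cvg_expr an.
by rewrite sub0r normrN normrX ger0_norm// => H; exists n.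
Qed.

Lemma geometric_scale (a s : R) : 0 < a < 1 -> 0 < s <= 1 ->
  exists k, a ^+ k.+1 < s <= a ^+ k.
Proof.
move=> /andP[a0 a1] /andP[s0 s1].
have ex : exists n, a ^+ n < s by apply: exprn_small => //; rewrite ltW.
case: (ex_minnP ex) => -[|k] sk min.
  by move: sk; rewrite expr0 ltNge s1.
exists k; rewrite sk/= leNgt; apply/negP => /min; by rewrite ltnn.
Qed.

End powers.

(** * Support and convex hull *)

Section hull.
Context {R : realType} (mu : probability R R).
Local Notation E := (expect mu).
Implicit Types L B : seq (R * R * R).

Lemma null_bigcup (F : nat -> set R) : (forall i, measurable (F i)) ->
  (forall i, mu (F i) = 0)%E -> mu (\bigcup_i F i) = 0%E.
Proof.
move=> mF F0; have mU : measurable (\bigcup_i F i) by exact: bigcup_measurable.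
apply: (iffLR (@negligibleP _ _ _ mu _ mU)); apply: (@negligible_bigcup _ _ _ mu F).
move=> k; apply: (iffRL (@negligibleP _ _ _ mu _ (mF k))).
exact: F0.
Qed.

Lemma expect_le_set (A A' : set R) : measurable A -> measurable A' ->
  A `<=` A' -> E (\1_A) <= E (\1_A').
Proof.
move=> mA mA' AA'; apply: expect_le => [||x]; try exact: bmeas_indic.
rewrite !indicE ler_nat; have [/set_mem/AA'/mem_set->|] := boolP (x \in A) => //.
Qed.

Lemma expect_indic0 (A : set R) : measurable A -> (E (\1_A) == 0) = (mu A == 0%E).
Proof. by move=> mA; rewrite expect_indic// eqe. Qed.

Lemma tail_small (c e : R) : 0 < e ->
  exists N, E (\1_([set x | `|x - c| > N])) <= e.
Proof.
move=> e0; pose F (n : nat) := [set x : R | `|x - c| <= n%:R].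
have mF n : measurable (F n).
  rewrite (_ : F n = `[c - n%:R, c + n%:R]%classic) //.
  by apply/seteqP; split => x; rewrite /F/= in_itv/= ler_distl.
have FT : \bigcup_n F n = setT.
  apply/seteqP; split => // x _; exists (Num.truncn `|x - c|).+1 => //.
  by rewrite /F/= ltW// truncnS_gt.
have mU : measurable (\bigcup_n F n) by rewrite FT.
have nd : {homo F : n m / (n <= m)%N >-> (n <= m)%O}.
  by move=> n m nm; apply/subsetPset => x /= /le_trans; apply; rewrite ler_nat.
have : (EFin \o (fun n => E (\1_(F n)))) x @[x --> \oo] --> 1%:E.
  rewrite (_ : EFin \o _ = mu \o F); last first.
    by apply/funext => n /=; rewrite expect_indic.
  have <- : mu (\bigcup_n F n) = 1%E by rewrite FT probability_setT.
  exact: nondecreasing_cvg_mu.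
move=> /fine_cvgP[_] /cvgrPdist_lt /(_ _ e0)[n _ /(_ n (leqnn _))] /= H.
exists n%:R; rewrite (_ : [set x | _] = ~` F n); last first.
  by apply/seteqP; split => x /=; rewrite ltNge => /negP.
rewrite (_ : \1_(~` F n) = fun x => 1 - \1_(F n) x); last first.
  by apply/funext => x; rewrite !indicE in_setC; case: (_ \in _); rewrite ?subrr ?subr0.
rewrite expectB; [|exact: bmeas_cst|exact: bmeas_indic].
rewrite (expect_cst mu 1) ltW//; apply: le_lt_trans H; exact: ler_norm.
Qed.

Lemma measurable_tail (c N : R) : measurable [set x : R | `|x - c| > N].
Proof.
rewrite (_ : [set x | _] = ~` `[c - N, c + N]%classic).
  by apply: measurableC.
by apply/seteqP; split => x /=; rewrite in_itv/= -ler_distl ltNge => /negP.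
Qed.

Lemma represents_null_tail B c M : represents mu B ->
  (forall t, t \in B -> `|t.1.2| < 1) -> 0 <= M ->
  (forall t, t \in B -> `|t.1.2 * c + t.2 - c| <= (1 - `|t.1.2|) * M) ->
  forall s, 0 < s -> E (\1_([set x | `|x - c| > M + s])) = 0.
Proof.
move=> [B0 B1 BE] a1 M0 cM.
have [rho /andP[r0 r1] hrho] := seq_ubound_lt ltr01 a1.
pose m s := E (\1_([set x : R | `|x - c| > M + s])).
have step s : 0 <= s -> m s <= m (s / rho).
  move=> s0; rewrite {1}/m BE; last by apply: bmeas_indic; exact: measurable_tail.
  rewrite -[leRHS]mul1r -B1 mulr_suml big_seq [leRHS]big_seq; apply: ler_sum => t tB.
  have [q0 _] := B0 _ tB; rewrite (ler_wpM2l (ltW q0))//.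
  apply: expect_le => [||x].
  - apply: (@bmeas_affine R (\1_([set x : R | `|x - c| > M + s])) t.1.2 t.2).
    by apply: bmeas_indic; exact: measurable_tail.
  - by apply: bmeas_indic; exact: measurable_tail.
  rewrite !indicE ler_nat; case: (boolP (_ \in _)) => // /set_mem /= H.
  rewrite mem_set//=; have tc := cM _ tB; have ta := hrho _ tB.
  have /lt_le_trans/(_ (_ : _ <= M + `|t.1.2| * (`|x - c| - M))) := H.
  have -> : t.1.2 * x + t.2 - c = (t.1.2 * c + t.2 - c) + t.1.2 * (x - c) by ring.
  have nn := ler_normD (t.1.2 * c + t.2 - c) (t.1.2 * (x - c)).
  rewrite normrM in nn => /(_ _)/wrap[|sl]; first by apply: (le_trans nn); lra.
  have xM : 0 <= `|x - c| - M.
    rewrite leNgt; apply/negP => xM; have : `|t.1.2| * (`|x - c| - M) <= 0.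
      by rewrite mulr_ge0_le0// ltW.
    lra.
  have : `|t.1.2| * (`|x - c| - M) <= rho * (`|x - c| - M) by rewrite ler_wpM2r.
  move=> H2; rewrite -ltrBrDl ltr_pdivrMr//; lra.
have stepn n s : 0 <= s -> m s <= m (s / rho ^+ n).
  elim: n s => [|n IH] s s0; first by rewrite expr0 divr1.
  apply: (le_trans (IH _ s0)).
  have -> : s / rho ^+ n.+1 = s / rho ^+ n / rho by rewrite exprSr invfM mulrA.
  by rewrite step// divr_ge0// exprn_ge0// ltW.
move=> s s0; apply/eqP; rewrite eq_le expect_ge0 ?andbT; last first.
  by move=> x; rewrite indicE.
rewrite leNgt; apply/negP => ms0.
have [N HN] := tail_small c (divr_gt0 ms0 (ltr0n R 2)).
have [n hn] : exists n, rho ^+ n < s / (`|N| + 1).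
  by apply: exprn_small; [rewrite ltW//|rewrite divr_gt0// ltr_wpDl].
have := stepn n s (ltW s0); rewrite leNgt => /negP; apply.
apply: (@le_lt_trans _ _ (E (\1_([set x | `|x - c| > N])))).
  apply: expect_le_set; try exact: measurable_tail.
  move=> x /=; apply: le_lt_trans.
  have : `|N| + 1 <= s / rho ^+ n.
    rewrite ler_pdivlMr ?exprn_gt0// mulrC -ler_pdivlMr ?ltW// ltr_wpDl//.
  have := ler_norm N; lra.
apply: (le_lt_trans HN); by rewrite ltr_pdivrMr// ltr_pMr// (ltr1n R 2).
Qed.

Lemma expect_point0 (c : R) : non_atomic mu ->
  (forall s, 0 < s -> E (\1_([set x | `|x - c| > s])) = 0) -> False.
Proof.
move=> na H.
have m1 : mu [set c] = 1%E.
  have -> : [set c] = ~` \bigcup_n [set x : R | `|x - c| > n.+1%:R^-1].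
    apply/seteqP; split => x /=; first by move=> -> [n _ /=]; rewrite subrr normr0 ltNge invr_ge0 ler0n.
    apply: contra_notP => /eqP xc; have xc0 : 0 < `|x - c| by rewrite normr_gt0 subr_eq0.
    have [n _ /(_ n (leqnn _)) /= Hn] := near_infty_natSinv_lt (PosNum xc0).
    by exists n.
  rewrite probability_setC; last by apply: bigcup_measurable => n _; exact: measurable_tail.
  rewrite null_bigcup ?sube0// => n; first exact: measurable_tail.
  by apply/eqP; rewrite -expect_indic0 ?H//; exact: measurable_tail.
by have := na c; rewrite m1 => /eqP; rewrite onee_eq0.
Qed.

(** If all the maps fixed one point, all mass would sit there. This is how non-atomicity enters both
    the Frostman estimate and the decay on the line. *)
Lemma two_fixed_points B : represents mu B ->
  (forall t, t \in B -> `|t.1.2| < 1) -> non_atomic mu ->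
  exists t u, [/\ t \in B, u \in B & t.2 / (1 - t.1.2) != u.2 / (1 - u.1.2)].
Proof.
move=> rB a1 na; apply: contrapT => H.
have [t tB] : exists t, t \in B.
  case: rB => _ B1 _; case: B B1 {a1 H} => [|t B _]; last by exists t; rewrite mem_head.
  by rewrite big_nil => /esym/eqP; rewrite oner_eq0.
pose c := t.2 / (1 - t.1.2).
apply: (@expect_point0 c na) => s s0.
rewrite -[s in LHS]add0r; apply: (represents_null_tail rB) => // u uB.
have -> : u.1.2 * c + u.2 - c = 0; last by rewrite normr0 mulr0.
have uc : u.2 / (1 - u.1.2) = c.
  by apply/eqP; apply: contrapT => /negP neq; apply: H; exists u, t.
have u1 : 1 - u.1.2 != 0.
  by rewrite subr_eq0; apply/eqP => u1; have := a1 _ uB; rewrite -u1 normr1 ltxx.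
by rewrite -uc; field.
Qed.

Lemma bounded_mass B : represents mu B -> (forall t, t \in B -> `|t.1.2| < 1) ->
  exists2 M, 0 < M & E (\1_([set x | `|x| > M])) = 0.
Proof.
move=> rB a1.
have [M HM] := seq_ubound B (fun t => `|t.2| / (1 - `|t.1.2|)).
exists (`|M| + 1); first by rewrite ltr_wpDl.
rewrite (_ : [set x | _] = [set x | `|x - 0| > `|M| + 1]); last first.
  by apply/seteqP; split => x /=; rewrite subr0.
apply: (represents_null_tail rB a1) => // t tB.
rewrite mulr0 add0r subr0 mulrC -ler_pdivrMr ?subr_gt0 ?a1//.
by apply: (le_trans (HM _ tB)); exact: ler_norm.
Qed.

End hull.

Section convex_hull.
Context {R : realType} (mu : probability R R).
Local Notation E := (expect mu).
Implicit Types L B : seq (R * R * R).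

(** The convex hull of the support, described by minimality among closed intervals of full mass,
    since this is the form in which invariance under the maps is proved. *)
Definition is_hull (al be : R) := [/\ al < be, E (\1_(`[al, be])) = 1 &
  forall c d, E (\1_(`[c, d])) = 1 -> c <= al /\ be <= d].

Lemma expect_indic_setC1 (A : set R) : measurable A -> mu (~` A) = 0%E -> E (\1_A) = 1.
Proof.
move=> mA /eqP; rewrite -expect_indic0; last exact: measurableC.
rewrite (_ : \1_(~` A) = fun x => 1 - \1_A x); last first.
  by apply/funext => x; rewrite !indicE in_setC; case: (_ \in _); rewrite ?subrr ?subr0.
rewrite expectB; [|exact: bmeas_cst|exact: bmeas_indic].
by rewrite (expect_cst mu 1) subr_eq0 => /eqP.
Qed.

Lemma setC1_expect_indic (A : set R) : measurable A -> E (\1_A) = 1 -> mu (~` A) = 0%E.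
Proof.
move=> mA A1; apply/eqP; rewrite -expect_indic0; last exact: measurableC.
rewrite (_ : \1_(~` A) = fun x => 1 - \1_A x); last first.
  by apply/funext => x; rewrite !indicE in_setC; case: (_ \in _); rewrite ?subrr ?subr0.
rewrite expectB; [|exact: bmeas_cst|exact: bmeas_indic].
by rewrite (expect_cst mu 1) A1 subrr.
Qed.

Lemma le_null (A A' : set R) : measurable A -> measurable A' -> A `<=` A' ->
  mu A' = 0%E -> mu A = 0%E.
Proof.
move=> mA mA' AA' A0; apply/eqP; rewrite eq_le measure_ge0 andbT -A0.
by apply: le_measure => //; rewrite inE.
Qed.

Lemma null_setU (A A1 A2 : set R) : measurable A -> measurable A1 -> measurable A2 ->
  A `<=` A1 `|` A2 -> mu A1 = 0%E -> mu A2 = 0%E -> mu A = 0%E.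
Proof.
move=> mA m1 m2 AA H1 H2; apply: (le_null mA _ AA); first exact: measurableU.
apply/eqP; rewrite eq_le measure_ge0 andbT.
have : (mu (A1 `|` A2) <= mu A1 + mu A2)%E by exact: measureU2.
by rewrite H1 H2 adde0.
Qed.

(** The endpoints are the last points with no mass to their left, respectively right. That they lie
    in the support is recorded because it places the whole hull inside any interval containing the
    support. *)
Lemma exists_hull M : non_atomic mu -> 0 < M -> E (\1_([set x | `|x| > M])) = 0 ->
  exists al be, [/\ is_hull al be, measure_support mu al & measure_support mu be].
Proof.
move=> na M0 HM.
have mI (i : interval R) : measurable [set` i] by exact: measurable_itv.
have mM : measurable [set x : R | M < `|x|].
  by have := measurable_tail 0 M; under eq_set do rewrite subr0.
have M00 : mu [set x | `|x| > M] = 0%E by apply/eqP; rewrite -expect_indic0 ?HM.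
pose lo := [set x : R | mu `]-oo, x[%classic = 0%E].
pose hi := [set x : R | mu `]x, +oo[%classic = 0%E].
have loM : lo (- M).
  apply: (le_null (mI _) mM _ M00) => x /=.
  by rewrite in_itv/= => xM; rewrite lter_normr orbC ltrNr xM.
have hiM : hi M.
  apply: (le_null (mI _) mM _ M00) => x /=.
  by rewrite in_itv/= andbT => xM; rewrite lter_normr xM.
have full1 : mu [set: R] = 1%E by rewrite probability_setT.
have lohi x y : lo x -> hi y -> x <= y.
  move=> lx hy; rewrite leNgt; apply/negP => yx.
  have : (mu [set: R] <= mu `]-oo, x[%classic + mu `]y, +oo[%classic)%E.
    have -> : [set: R] = `]-oo, x[%classic `|` `]y, +oo[%classic.
      apply/seteqP; split => // z _ /=; rewrite !in_itv/= andbT.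
      by have [zx|xz] := ltP z x; [left|right; exact: lt_le_trans xz].
    exact: measureU2.
  by rewrite lx hy adde0 full1 leNgt lte01.
have lou : has_ubound lo by exists M => x lx; exact: lohi hiM.
have hil : has_lbound hi by exists (- M) => x lx; exact: lohi loM lx.
have hslo : has_sup lo by split; [exists (- M)|].
have hshi : has_inf hi by split; [exists M|].
pose al := sup lo; pose be := inf hi.
have lo_al : lo al.
  have -> : lo al = (mu (\bigcup_n `]-oo, al - n.+1%:R^-1[%classic) = 0%E).
    rewrite /lo/=; congr (mu _ = _); apply/seteqP; split => x /=.
      rewrite in_itv/= => xal; have xal0 : 0 < al - x by rewrite subr_gt0.
      have [n _ /(_ n (leqnn _)) /= Hn] := near_infty_natSinv_lt (PosNum xal0).
      by exists n => //=; rewrite in_itv/= ltrBrDr -ltrBrDl.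
    move=> [n _ /=]; rewrite !in_itv/= => /lt_trans; apply.
    by rewrite ltrBlDr ltrDl invr_gt0.
  apply: null_bigcup => // n.
  have [y ly yn] : exists2 y, lo y & al - n.+1%:R^-1 < y.
    by apply: sup_adherent => //; rewrite invr_gt0.
  by apply: (le_null _ _ _ ly) => // x /=; rewrite !in_itv/= => /lt_trans; apply.
have hi_be : hi be.
  have -> : hi be = (mu (\bigcup_n `]be + n.+1%:R^-1, +oo[%classic) = 0%E).
    rewrite /hi/=; congr (mu _ = _); apply/seteqP; split => x /=.
      rewrite in_itv/= andbT => xal; have xal0 : 0 < x - be by rewrite subr_gt0.
      have [n _ /(_ n (leqnn _)) /= Hn] := near_infty_natSinv_lt (PosNum xal0).
      by exists n => //=; rewrite in_itv/= andbT -ltrBrDl.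
    move=> [n _ /=]; rewrite !in_itv/= !andbT; apply: lt_trans.
    by rewrite ltrDl invr_gt0.
  apply: null_bigcup => // n.
  have [y ly yn] : exists2 y, hi y & y < be + n.+1%:R^-1.
    by apply: inf_adherent => //; rewrite invr_gt0.
  by apply: (le_null _ _ _ ly) => // x /=; rewrite !in_itv/= !andbT; exact: lt_trans.
have K1 : E (\1_(`[al, be])) = 1.
  apply: expect_indic_setC1 => //.
  apply/eqP; rewrite eq_le measure_ge0 andbT.
  apply: (@le_trans _ _ (mu `]-oo, al[%classic + mu `]be, +oo[%classic)%E).
    have -> : ~` `[al, be]%classic = `]-oo, al[%classic `|` `]be, +oo[%classic.
      apply/seteqP; split => z /=; rewrite !in_itv/= andbT.
        by move=> /negP; rewrite negb_and -!ltNge => /orP[]; [left|right].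
      by move=> H; apply/negP; rewrite negb_and -!ltNge; apply/orP.
    exact: measureU2.
  by rewrite lo_al hi_be adde0.
have albe : al < be.
  rewrite ltNge; apply/negP => beal; move: K1.
  have -> : E (\1_(`[al, be])) = 0; last by move=> /eqP; rewrite eq_sym oner_eq0.
  apply/eqP; rewrite expect_indic0//; apply/eqP.
  apply: (le_null _ _ _ (na al)) => // x /=; rewrite in_itv/= => /andP[ax xb].
  by apply/eqP; rewrite eq_le ax (le_trans xb).
have nbl x : al < x -> ~ lo x.
  by move=> alx lx; have := ub_le_sup lou lx; rewrite leNgt alx.
have nbh x : x < be -> ~ hi x.
  by move=> alx lx; have := ge_inf hil lx; rewrite leNgt alx.
exists al, be; split; first split=> // c d cd.
- split.
    apply: ub_le_sup => //; apply: (le_null _ _ _ (setC1_expect_indic _ cd)) => //.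
      exact: measurableC.
    by move=> x /=; rewrite !in_itv/= => xc; apply/negP; rewrite negb_and -ltNge xc.
  apply: ge_inf => //; apply: (le_null _ _ _ (setC1_expect_indic _ cd)) => //.
    exact: measurableC.
  by move=> x /=; rewrite !in_itv/= andbT => xc; apply/negP; rewrite negb_and -!ltNge xc orbT.
- move=> V oV Va; rewrite lt_def measure_ge0 andbT; apply/eqP => V0.
  have /nbhs_ballP[e /= e0 eV] := open_nbhs_nbhs (conj oV Va).
  apply: (@nbl (al + e)); first by rewrite ltrDl.
  apply: (null_setU _ _ _ _ lo_al V0) => //; first exact: open_measurable.
  move=> x /=; rewrite !in_itv/= => xe; have [xal|alx] := ltP x al; [by left|right].
  by apply: eV; rewrite /ball/= distrC ger0_norm ?subr_ge0// ltrBlDl.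
- move=> V oV Va; rewrite lt_def measure_ge0 andbT; apply/eqP => V0.
  have /nbhs_ballP[e /= e0 eV] := open_nbhs_nbhs (conj oV Va).
  apply: (@nbh (be - e)); first by rewrite ltrBlDr ltrDl.
  apply: (null_setU _ _ _ _ hi_be V0) => //; first exact: open_measurable.
  move=> x /=; rewrite !in_itv/= !andbT => xe; have [xal|alx] := ltP be x; [by left|right].
  by apply: eV; rewrite /ball/= ger0_norm ?subr_ge0//; lra.
Qed.

Lemma affine_preimage_itv (a b c d : R) : a != 0 ->
  exists c' d', (forall x, (x \in `[c', d']) = (a * x + b \in `[c, d])) /\
    d' - c' = (d - c) / `|a|.
Proof.
move=> a0; have [ag|al|az] := ltgtP 0 a; last by rewrite az eqxx in a0.
  exists ((c - b) / a), ((d - b) / a); split; last by rewrite gtr0_norm//; lra.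
  by move=> x; rewrite !in_itv/= ler_pdivrMr// ler_pdivlMr// lerBlDr lerBrDr ![x * a]mulrC.
exists ((d - b) / a), ((c - b) / a); split; last by rewrite ltr0_norm// invrN; lra.
move=> x; rewrite !in_itv/= ler_ndivrMr// ler_ndivlMr// lerBlDr lerBrDr ![x * a]mulrC.
by rewrite andbC.
Qed.

Lemma indic_affine (a b c d c' d' : R) :
  (forall x, (x \in `[c', d']) = (a * x + b \in `[c, d])) ->
  (fun x => \1_(`[c, d]) (a * x + b)) = \1_(`[c', d']) :> (R -> R).
Proof.
move=> H; apply/funext => x; rewrite !indicE; congr (_%:R); congr nat_of_bool.
by rewrite !mem_setE H.
Qed.

(** A mean with positive weights of numbers at most 1 equals 1 only if each does. So the preimage of
    the hull under every map has full mass, and by minimality it contains the hull. *)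
Lemma represents_hull L al be : represents mu L -> is_hull al be ->
  forall t, t \in L -> forall x, x \in `[al, be] -> t.1.2 * x + t.2 \in `[al, be].
Proof.
move=> [L0 L1 LE] [albe K1 Kmin] t tL x xK.
have [q0 a0] := L0 _ tL.
have mI (c d : R) : measurable `[c, d]%classic by exact: measurable_itv.
have [c' [d' [cdP _]]] := affine_preimage_itv t.2 al be a0.
suff H : E (\1_(`[c', d'])) = 1.
  have [c1 d1] := Kmin _ _ H; rewrite -cdP; move: xK; rewrite !in_itv/= => /andP[x1 x2].
  by rewrite (le_trans c1) ?(le_trans _ d1).
have := LE _ (bmeas_indic (mI al be)); rewrite K1 -{1}L1.
have le1 u : u \in L -> E (fun x => \1_(`[al, be]) (u.1.2 * x + u.2)) <= 1.
  move=> uL; have [_ ua0] := L0 _ uL.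
  have [c [d [cdu _]]] := affine_preimage_itv u.2 al be ua0.
  by rewrite (indic_affine cdu); exact: expect_indic1.
rewrite (big_rem t)//= [in RHS](big_rem t)//= (indic_affine cdP) => eqn.
apply/eqP; rewrite eq_le expect_indic1//=.
rewrite leNgt; apply/negP => lt1; move: eqn; apply/eqP; rewrite gt_eqF//.
apply: ltr_leD; first by rewrite gtr_pMr.
rewrite big_seq [leRHS]big_seq; apply: ler_sum => u /mem_rem uL.
by have [uq _] := L0 _ uL; rewrite (ler_piMr (ltW uq))// le1.
Qed.

End convex_hull.

(** * The Frostman estimate *)

Section frostman.
Context {R : realType} (mu : probability R R).
Local Notation E := (expect mu).
Implicit Types L B : seq (R * R * R).

Lemma mem_refine (P : pred (R * R * R)) B L t u : t \in L -> P t -> u \in B ->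
  (t.1.1 * u.1.1, t.1.2 * u.1.2, t.1.2 * u.2 + t.2) \in refine P B L.
Proof.
move=> tL Pt uB; apply/flattenP; eexists; first by apply/mapP; exists t.
by rewrite Pt; apply/mapP; exists u.
Qed.

(** Iterating keeps the fixed point [t.2 / (1 - t.1.2)]. Both powers must occur in a single
    representation, so that an interval missing one image loses that weight. *)
Lemma exists_iterate B t n : represents mu B -> t \in B -> t.1.2 != 1 ->
  forall u, u \in B -> u.1.2 != 1 -> exists L, [/\ represents mu L,
    (t.1.1 ^+ n, t.1.2 ^+ n, t.2 / (1 - t.1.2) * (1 - t.1.2 ^+ n)) \in L &
    (u.1.1 ^+ n, u.1.2 ^+ n, u.2 / (1 - u.1.2) * (1 - u.1.2 ^+ n)) \in L].
Proof.
move=> rB tB t1 u uB u1.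
elim: n => [|n [L [rL tL uL]]].
  exists [:: (1, 1, 0)]; split; first exact: represents_id.
    by rewrite !expr0 subrr mulr0 inE.
  by rewrite !expr0 subrr mulr0 inE.
have aux (s : R * R * R) : s.1.2 != 1 ->
    s.2 / (1 - s.1.2) * (1 - s.1.2 ^+ n.+1) =
    s.1.2 ^+ n * s.2 + s.2 / (1 - s.1.2) * (1 - s.1.2 ^+ n).
  by move=> s1; rewrite exprS; field; rewrite subr_eq0 eq_sym.
exists (refine predT B L); split; first exact: represents_refine.
  by have := mem_refine tL (erefl : predT _) tB; rewrite /= -exprSr -exprSr -aux.
by have := mem_refine uL (erefl : predT _) uB; rewrite /= -exprSr -exprSr -aux.
Qed.

Lemma affine_pow_bound (p a x M : R) n : `|x - p| <= M ->
  `|a ^+ n * x + p * (1 - a ^+ n) - p| <= `|a| ^+ n * M.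
Proof.
move=> xp; rewrite (_ : _ - p = a ^+ n * (x - p)); last by ring.
by rewrite normrM normrX ler_wpM2l// exprn_ge0.
Qed.

Lemma separated_words B al be : represents mu B ->
  (forall t, t \in B -> `|t.1.2| < 1) -> non_atomic mu ->
  exists L, represents mu L /\ exists u v, [/\ u \in L, v \in L &
  exists2 del, 0 < del & forall x y, x \in `[al, be] -> y \in `[al, be] ->
    del < `|(u.1.2 * x + u.2) - (v.1.2 * y + v.2)|].
Proof.
move=> rB a1 na; have [t [u [tB uB tu]]] := two_fixed_points rB a1 na.
have t1 : t.1.2 != 1.
  by apply/eqP => t1; have := a1 _ tB; rewrite t1 normr1 ltxx.
have u1 : u.1.2 != 1.
  by apply/eqP => u1; have := a1 _ uB; rewrite u1 normr1 ltxx.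
set p := t.2 / _ in tu; set q := u.2 / _ in tu.
pose M := `|al| + `|be| + `|p| + `|q| + 1.
have M0 : 0 < M by rewrite /M ltr_wpDl// !addr_ge0.
pose D := `|p - q|.
have D0 : 0 < D by rewrite normr_gt0 subr_eq0.
(* High iterates bring each image of the hull within [D / 4] of its fixed point, so the two images
   stay at least [D / 2] apart. *)
have e0 : 0 < D / (4 * M) by rewrite divr_gt0// mulr_gt0.
pose a := Num.max `|t.1.2| `|u.1.2|.
have a01 : 0 <= a < 1 by rewrite le_max normr_ge0/= gt_max !a1.
have [n hn] := exprn_small a01 e0.
have [L [rL tL uL]] := exists_iterate n rB tB t1 uB u1.
exists L; split => //; eexists; eexists; split; [exact: tL|exact: uL|].
exists (D / 4); first by rewrite divr_gt0.
have hM x r : x \in `[al, be] -> `|r| <= `|p| + `|q| -> `|x - r| <= M.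
  rewrite in_itv/= => /andP[x1 x2] hr; apply: (le_trans (ler_normB _ _)).
  have : `|x| <= `|al| + `|be|.
    rewrite ler_norml; have := ler_norm (- al); have := ler_norm be.
    rewrite normrN; have := normr_ge0 al; have := normr_ge0 be => *; apply/andP; split; lra.
  rewrite /M; lra.
have small (s : R * R * R) x r : `|s.1.2| <= a -> `|x - r| <= M ->
   `|s.1.2 ^+ n * x + r * (1 - s.1.2 ^+ n) - r| <= D / 4.
  move=> sa xr; apply: (le_trans (affine_pow_bound _ _ xr)).
  have : `|s.1.2| ^+ n <= D / (4 * M).
    apply: le_trans (ltW hn); rewrite lerXn2r// nnegrE//.
    by case/andP: a01.
  by rewrite -(ler_pM2r M0) => /le_trans; apply; rewrite invfM mulrA divfK// gt_eqF.
move=> x y xK yK /=.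
have hx : `|t.1.2 ^+ n * x + p * (1 - t.1.2 ^+ n) - p| <= D / 4.
  by apply: small; [rewrite le_max lexx|apply: hM => //; rewrite lerDl].
have hy : `|u.1.2 ^+ n * y + q * (1 - u.1.2 ^+ n) - q| <= D / 4.
  by apply: small; [rewrite le_max lexx orbT|apply: hM => //; rewrite lerDr].
rewrite -/p -/q; set X := _ * x + _ in hx *; set Y := _ * y + _ in hy *.
have : D <= `|X - Y| + `|X - p| + `|Y - q|.
  rewrite /D (_ : p - q = (X - Y) - (X - p) + (Y - q)); last by ring.
  by apply: (le_trans (ler_normD _ _)); rewrite lerD2r; exact: ler_normB.
lra.
Qed.

(** An interval of length at most [del] misses the image of the hull under [u] or under [v], so one
    of these words contributes nothing. Under the other words its preimages lengthen by at most
    [1 / a], and the induction gains the factor [1 - q0]. *)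
Lemma frostman_step L al be q0 a del u v : is_hull mu al be ->
  represents mu L -> (forall t, t \in L -> a <= `|t.1.2|) -> 0 < a < 1 ->
  u \in L -> v \in L -> q0 <= u.1.1 -> q0 <= v.1.1 -> 0 < q0 < 1 -> 0 < del ->
  (forall x y, x \in `[al, be] -> y \in `[al, be] ->
    del < `|(u.1.2 * x + u.2) - (v.1.2 * y + v.2)|) ->
  forall k c d, d - c <= del * a ^+ k -> E (\1_(`[c, d])) <= (1 - q0) ^+ k.
Proof.
move=> hull rL La /andP[a0 a1] uL vL uq vq /andP[q00 q01] del0 sep.
have q1 : 0 <= 1 - q0 by rewrite subr_ge0 ltW.
case: (rL) => L0 L1 LE.
have mI (c d : R) : measurable `[c, d]%classic by exact: measurable_itv.
elim=> [|k IH] c d dc; first by rewrite expr0; exact: expect_indic1.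
have key w : w \in L -> q0 <= w.1.1 ->
    (forall x, x \in `[al, be] -> w.1.2 * x + w.2 \notin `[c, d]) ->
    E (\1_(`[c, d])) <= (1 - q0) ^+ k.+1.
  move=> wL wq hw; rewrite LE; last exact: bmeas_indic.
  have E0 : E (fun x => \1_(`[c, d]) (w.1.2 * x + w.2)) <= 0.
    case: hull => _ K1 _; rewrite -[leRHS](expect_cst mu).
    apply: (expect_le_on (mI al be) K1).
    - apply: (@bmeas_affine R (\1_(`[c, d])) w.1.2 w.2); exact: bmeas_indic.
    - exact: bmeas_cst.
    - move=> x /= xK; rewrite indicE mem_setE.
      by rewrite (negbTE (hw _ xK)).
  have G t : t \in L -> E (fun x => \1_(`[c, d]) (t.1.2 * x + t.2)) <= (1 - q0) ^+ k.
    move=> tL; have [_ ta] := L0 _ tL.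
    have [c' [d' [cd dE]]] := affine_preimage_itv t.2 c d ta.
    rewrite (indic_affine cd); apply: IH; rewrite dE ler_pdivrMr ?normr_gt0//.
    apply: (le_trans dc); rewrite exprSr mulrA ler_wpM2l ?La//.
    by rewrite mulr_ge0 ?ltW// exprn_gt0.
  rewrite (big_rem w)//=.
  have -> : (1 - q0) ^+ k.+1 = - q0 * (1 - q0) ^+ k + (1 - q0) ^+ k.
    by rewrite exprS; ring.
  rewrite -[X in _ <= _ + X]mul1r -{2}L1 [in leRHS](big_rem w)//= mulrDl addrA.
  apply: lerD.
    apply: (@le_trans _ _ 0); first by rewrite mulr_ge0_le0// ltW// (lt_le_trans q00).
    by rewrite -mulrDl mulr_ge0 ?exprn_ge0// addrC subr_ge0.
  rewrite mulr_suml big_seq [leRHS]big_seq; apply: ler_sum => t /mem_rem tL.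
  by have [qt _] := L0 _ tL; rewrite (ler_wpM2l (ltW qt))// G.
have [[x [xK xI]]|H] := pselect (exists x, x \in `[al, be] /\ u.1.2 * x + u.2 \in `[c, d]).
  apply: (key v) => // y yK; apply/negP => yI; have := sep _ _ xK yK.
  apply/negP; rewrite -leNgt; apply: (@le_trans _ _ (d - c)).
    move: xI yI; rewrite !in_itv/= => /andP[? ?] /andP[? ?].
    by rewrite ler_norml; apply/andP; split; lra.
  apply: (le_trans dc); rewrite ger_pMr//.
  by rewrite exprn_ile1// ltW.
apply: (key u) => // x xK; apply/negP => xI; apply: H; by exists x.
Qed.

Lemma frostman B al be : is_hull mu al be -> represents mu B ->
  (forall t, t \in B -> `|t.1.2| < 1) -> non_atomic mu ->
  exists C c, [/\ 0 < C, 0 < c &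
    forall x s, 0 < s -> E (\1_(`[x - s, x + s])) <= C * s `^ c].
Proof.
move=> hull rB a1 na.
have [L [rL [u [v [uL vL [del del0 sep]]]]]] := separated_words al be rB a1 na.
case: (rL) => L0 L1 LE.
have [a' a'0 Ha'] : exists2 m, 0 < m & forall t, t \in L -> m <= `|t.1.2|.
  by apply: seq_lbound_gt => t /L0[_]; rewrite normr_gt0.
have [q' q'0 Hq'] : exists2 m, 0 < m & forall t, t \in L -> m <= t.1.1.
  by apply: seq_lbound_gt => t /L0[].
pose a := Num.min a' (1 / 2); pose q := Num.min q' (1 / 2).
have a01 : 0 < a < 1.
  by rewrite /a lt_min a'0 divr_gt0//= gt_min ltr_pdivrMr// mul1r ltr1n orbT.
have q01 : 0 < q < 1.
  by rewrite /q lt_min q'0 divr_gt0//= gt_min ltr_pdivrMr// mul1r ltr1n orbT.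
have /andP[a0 al1] := a01; have /andP[q0 q1] := q01.
have hst k c d : d - c <= del * a ^+ k -> E (\1_(`[c, d])) <= (1 - q) ^+ k.
  apply: (frostman_step hull rL _ a01 uL vL _ _ q01 del0 sep).
  - by move=> t /Ha'; apply: le_trans; rewrite ge_min lexx.
  - by apply: (le_trans _ (Hq' _ uL)); rewrite ge_min lexx.
  - by apply: (le_trans _ (Hq' _ vL)); rewrite ge_min lexx.
pose c := ln (1 - q) / ln a.
have lna : ln a < 0 by rewrite ln_lt0.
have lnq : ln (1 - q) < 0 by rewrite ln_lt0// subr_gt0 q1/= gtrBl.
have c0 : 0 < c by rewrite /c nmulr_rgt0// invr_lt0.
have aq : a `^ c = 1 - q.
  rewrite /powR gt_eqF// /c divfK ?lt_eqF// lnK// posrE subr_gt0//.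
(* The radius [s] means length [2 * s], to be compared with [del * a ^+ k]; the extra [a] pays for
   rounding to a power of [a]. *)
pose w := 2 / (del * a).
have w0 : 0 < w by rewrite divr_gt0// mulr_gt0.
exists (w `^ c), c; split=> //; first exact: powR_gt0.
move=> x s s0.
rewrite -powRM; [|exact: ltW|exact: ltW].
have [sd|ds] := leP (2 * s / del) 1; last first.
  apply: (le_trans (expect_indic1 _ _)) => //.
  have ws : 1 <= w * s.
    have -> : w * s = 2 * s / del / a by rewrite /w; field; rewrite !gt_eqF.
    by rewrite ler_pdivlMr// mul1r (le_trans (ltW al1))// ltW.
  by rewrite -(powRr0 (w * s)); apply: ler_powR => //; exact: ltW.
have s01 : 0 < 2 * s / del <= 1 by rewrite sd andbT divr_gt0// mulr_gt0.
have [k /andP[k1 k2]] := geometric_scale a01 s01.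
apply: (@le_trans _ _ ((1 - q) ^+ k)).
  apply: hst; move: k2; rewrite ler_pdivrMr// [a ^+ k * _]mulrC; lra.
rewrite -aq -powR_mulrn ?powR_ge0// -powRrM mulrC powRrM powR_mulrn; last exact: ltW.
apply: (ge0_ler_powR (ltW c0)); rewrite ?nnegrE ?(exprn_ge0 _ (ltW a0)) ?(mulr_ge0 (ltW w0) (ltW s0))//.
apply: ltW.
move: k1; rewrite exprSr -ltr_pdivlMr// => /lt_le_trans; apply.
by rewrite /w le_eqVlt; apply/orP; left; apply/eqP; field; rewrite !gt_eqF.
Qed.

End frostman.

(** * The transform on the line: interference of words *)

Section line_transform.
Context {R : realType} (mu : probability R R).
Local Notation E := (expect mu).
Local Notation measR phi := (measurable_fun [set: R] phi).
Implicit Types L B : seq (R * R * R).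

Definition ft (t : R) : R := osc mu (fun x => 2 * pi * t * x).

Lemma measurable_linear (c : R) : measR (fun x : R => c * x).
Proof. exact: measurable_funM. Qed.

Lemma ft_ge0 t : 0 <= ft t. Proof. exact: osc_ge0. Qed.

Lemma ft_le1 t : ft t <= 1.
Proof. by apply: osc_le1; exact: measurable_linear. Qed.

Lemma norm_expect_cos_le (phi : R -> R) t : measR phi ->
  `|E (fun x => cos (phi x - t))| <= osc mu phi.
Proof.
move=> mphi; rewrite ler_norml expect_cos_le_osc// andbT lerNl.
rewrite -mulN1r -expectZ; last by apply: bmeas_cos; exact: measurable_funB.
rewrite (_ : (fun x => _) = fun x => cos (phi x - (t - pi))); last first.
  by apply/funext => x; rewrite mulN1r -cosDpi; congr cos; ring.
exact: expect_cos_le_osc.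
Qed.

Lemma expect_cos_affine_le s a b t :
  E (fun x => cos (2 * pi * s * (a * x + b) - t)) <= ft (a * s).
Proof.
rewrite (_ : (fun x => _) = fun x => cos (2 * pi * (a * s) * x - (t - 2 * pi * s * b))).
  by apply: expect_cos_le_osc; exact: measurable_linear.
by apply/funext => x; congr cos; ring.
Qed.

(** Two maps with the same linear part differ by a translation, so sum-to-product turns their two
    waves into one wave times a cosine of the translation. *)
Lemma sum_expect_cos_affine_le s a b b' t :
  E (fun x => cos (2 * pi * s * (a * x + b) - t)) +
  E (fun x => cos (2 * pi * s * (a * x + b') - t)) <=
  2 * `|cos (pi * (b - b') * s)| * ft (a * s).
Proof.
have mA b0 : bmeas (fun x : R => cos (2 * pi * s * (a * x + b0) - t)).
  apply: bmeas_cos; apply: measurable_funB => //; apply: measurable_funM => //.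
  exact: measurable_affine.
rewrite -expectD//.
pose t' := t - pi * (b + b') * s.
rewrite (_ : (fun x => _) = fun x =>
    2 * cos (pi * (b - b') * s) * cos (2 * pi * (a * s) * x - t')); last first.
  apply/funext => x; pose u := 2 * pi * (a * s) * x - t'; pose v := pi * (b - b') * s.
  have -> : 2 * pi * s * (a * x + b) - t = u + v by rewrite /u /v /t'; ring.
  have -> : 2 * pi * s * (a * x + b') - t = u - v by rewrite /u /v /t'; ring.
  have prod (y z : R) : cos (y + z) + cos (y - z) = 2 * cos z * cos y.
    by rewrite cosD cosB; ring.
  by rewrite prod.
rewrite expectZ; last by apply: bmeas_cos; apply: measurable_funB => //; exact: measurable_linear.
apply: (le_trans (ler_norm _)); rewrite !normrM gtr0_norm//.
by apply: ler_wpM2l; [rewrite mulr_ge0|apply: norm_expect_cos_le; exact: measurable_linear].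
Qed.

(* (q, D, a) stands for the summand q |cos (pi D s)| ft (a s). *)
Definition damping L :=
  [/\ forall t, t \in L -> 0 < t.1.1 /\ t.2 != 0, \sum_(t <- L) t.1.1 = 1 &
      forall s, ft s <=
        \sum_(t <- L) t.1.1 * `|cos (pi * t.1.2 * s)| * ft (t.2 * s)].

(* The two compositions of a pair of maps with distinct fixed points have equal
   linear parts and weights, so their contributions to the transform interfere. *)
Lemma exists_damping B : represents mu B -> (forall t, t \in B -> `|t.1.2| < 1) ->
  non_atomic mu -> exists L, [/\ damping L,
    forall t, t \in L -> `|t.2| < 1 & exists t, t \in L /\ t.1.2 != 0].
Proof.
move=> rB a1 na; have [t [u [tB uB tu]]] := two_fixed_points rB a1 na.
pose L2 := refine predT B B.
have rL : represents mu L2 by exact: represents_refine.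
have L2a v : v \in L2 -> `|v.1.2| < 1.
  move=> /flattenP[s /mapP[x xB ->]] /mapP[y yB ->]/=.
  by rewrite normrM mulr_ilt1// a1.
pose w1 := (t.1.1 * u.1.1, t.1.2 * u.1.2, t.1.2 * u.2 + t.2).
pose w2 := (u.1.1 * t.1.1, u.1.2 * t.1.2, u.1.2 * t.2 + u.2).
have w1L : w1 \in L2 by exact: mem_refine.
have w2L : w2 \in L2 by exact: mem_refine.
pose D := w1.2 - w2.2.
have D0 : D != 0.
  have t1 : 1 - t.1.2 != 0.
    by rewrite subr_eq0; apply/eqP => t1; have := a1 _ tB; rewrite -t1 normr1 ltxx.
  have u1 : 1 - u.1.2 != 0.
    by rewrite subr_eq0; apply/eqP => u1; have := a1 _ uB; rewrite -u1 normr1 ltxx.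
  have -> : D = (1 - t.1.2) * (1 - u.1.2) * (t.2 / (1 - t.1.2) - u.2 / (1 - u.1.2)).
    by rewrite /D /w1 /w2/=; field; rewrite t1 u1.
  by rewrite !mulf_neq0// subr_eq0.
have w12 : w1 != w2.
  by apply/eqP => w12; move: D0; rewrite /D w12 subrr eqxx.
have w2L' : w2 \in rem w1 L2 by apply: rem_mem => //; rewrite eq_sym.
pose L' := rem w2 (rem w1 L2).
have L'L v : v \in L' -> v \in L2 by move=> /mem_rem/mem_rem.
case: (rL) => L0 L1 LE.
have split2 (G : R * R * R -> R) :
    \sum_(v <- L2) G v = G w1 + G w2 + \sum_(v <- L') G v.
  by rewrite (big_rem w1)//= (big_rem w2)//= addrA.
(* The interfering pair is merged into one term; [D = 0] marks the others, whose cosine is 1. *)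
exists ((2 * w1.1.1, D, w1.1.2) :: [seq (v.1.1, 0, v.1.2) | v <- L']); split.
- split.
  + move=> v; rewrite inE => /orP[/eqP->/=|/mapP[x /L'L xL ->]/=]; last exact: L0.
    have [? ?] := L0 _ w1L; split => //; by rewrite mulr_gt0.
  + rewrite big_cons big_map/= -[RHS]L1 split2/=; congr (_ + _).
    by ring.
  + move=> s; have [th ths] := osc_attained mu (measurable_linear (2 * pi * s)).
    rewrite {1}/ft -ths LE; last first.
      by apply: bmeas_cos; apply: measurable_funB => //; exact: measurable_linear.
    rewrite split2 big_cons big_map/=; apply: lerD; last first.
      rewrite big_seq [leRHS]big_seq; apply: ler_sum => v /L'L vL.
      have [q0 _] := L0 _ vL.
      rewrite mulr0 mul0r cos0 normr1 mulr1 (ler_wpM2l (ltW q0))//.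
      exact: expect_cos_affine_le.
    rewrite [u.1.1 * _]mulrC [u.1.2 * t.1.2]mulrC -mulrDr.
    have q0 : 0 <= t.1.1 * u.1.1 by have [/ltW] := L0 _ w1L.
    apply: (le_trans (ler_wpM2l q0 (sum_expect_cos_affine_le _ _ _ _ _))).
    by rewrite le_eqVlt; apply/orP; left; apply/eqP; rewrite /D/=; ring.
- move=> v; rewrite inE => /orP[/eqP->/=|/mapP[x /L'L xL ->]/=]; last exact: L2a.
  exact: (L2a _ w1L).
- by eexists; split; [exact: mem_head|].
Qed.

(** A damped term keeps its cosine and forgets the new one; an undamped term takes the cosine from
    [B], at the frequency rescaled by [t.2]. A term thus remains undamped only if both factors are,
    which makes [undamped] multiplicative. *)
Definition compose_damping B L := [seq
  (t.1.1 * u.1.1, if t.1.2 == 0 then u.1.2 * t.2 else t.1.2, t.2 * u.2)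
  | t <- L, u <- B].

Definition undamped L : R := \sum_(t <- L | t.1.2 == 0) t.1.1.

Lemma damping_compose B L : damping B -> damping L -> damping (compose_damping B L).
Proof.
move=> [B0 B1 BF] [L0 L1 LF]; split.
- move=> v /allpairsP[[t u]/= [tL uB ->]]/=.
  by have [? ?] := L0 _ tL; have [? ?] := B0 _ uB; rewrite mulr_gt0// mulf_neq0.
- rewrite /compose_damping big_allpairs_dep/= -[RHS]L1; apply: eq_bigr => t _ /=.
  by rewrite -mulr_sumr B1 mulr1.
- move=> s; apply: (le_trans (LF s)); rewrite /compose_damping big_allpairs_dep/=.
  rewrite big_seq [leRHS]big_seq; apply: ler_sum => t tL /=.
  have [q0 _] := L0 _ tL.
  apply: (@le_trans _ _ (\sum_(u <- B) t.1.1 * (`|cos (pi * t.1.2 * s)| *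
      (u.1.1 * `|cos (pi * u.1.2 * (t.2 * s))| * ft (u.2 * (t.2 * s)))))).
    rewrite -mulr_sumr -mulrA (ler_wpM2l (ltW q0))// -mulr_sumr ler_wpM2l//.
  rewrite big_seq [leRHS]big_seq; apply: ler_sum => u uB.
  have [r0 _] := B0 _ uB; rewrite -!mulrA (ler_wpM2l (ltW q0))// [t.2 * (u.2 * s)]mulrCA.
  have [->|_] := eqVneq.
    by rewrite mul0r mulr0 cos0 normr1 mul1r [u.1.2 * (t.2 * s)]mulrA.
  rewrite [leLHS]mulrCA (ler_wpM2l (ltW r0))// ler_wpM2l// ler_piMl ?ft_ge0//.
  by rewrite ler_norml cos_geN1 cos_le1.
Qed.

Lemma undamped_compose B L : damping L ->
  undamped (compose_damping B L) = undamped L * undamped B.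
Proof.
move=> [L0 _ _]; rewrite /undamped /compose_damping big_mkcond big_allpairs_dep/= [in RHS]big_mkcond mulr_suml.
rewrite big_seq [RHS]big_seq; apply: eq_bigr => t tL; have [_ t20] := L0 _ tL.
have [t0|t0] := eqVneq t.1.2 0; last first.
  by rewrite (negbTE t0) big1 ?mul0r.
rewrite [in RHS]big_mkcond mulr_sumr; apply: eq_bigr => u _.
by rewrite mulf_eq0 (negbTE t20) orbF; case: ifP; rewrite ?mulr0.
Qed.

(** The undamped weight decays exponentially in [n], while the logarithms of the contractions grow
    only linearly; [exists_scale] plays these against each other. *)
Lemma iterated_damping B : represents mu B -> (forall t, t \in B -> `|t.1.2| < 1) ->
  non_atomic mu -> exists th a1 a2, [/\ 0 <= th < 1, 0 < a1 < 1, 0 < a2 < 1 &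
  forall n, exists L, [/\ damping L, undamped L = th ^+ n &
    forall t, t \in L -> a1 ^+ n <= `|t.2| <= a2 ^+ n]].
Proof.
move=> rB aB na; have [L [dL La [t0 [t0L t00]]]] := exists_damping rB aB na.
case: (dL) => L0 L1 LF.
have [a2 /andP[a20 a21] Ha2] := seq_ubound_lt ltr01 La.
have [a1 a10 Ha1] : exists2 m, 0 < m & forall t, t \in L -> m <= `|t.2|.
  by apply: seq_lbound_gt => t /L0[_]; rewrite normr_gt0.
exists (undamped L), a1, a2; split; rewrite ?a10 ?a20 ?a21//=.
- rewrite /undamped big_seq_cond sumr_ge0/=; last by move=> t /andP[/L0[/ltW]].
  rewrite -L1 [ltRHS](bigID (fun t => t.1.2 == 0))/= big_seq_cond -!big_seq_cond ltrDl.
  rewrite (big_rem t0)//= t00 ltr_wpDr//; last by have [] := L0 _ t0L.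
  by rewrite big_seq_cond sumr_ge0// => t /andP[/mem_rem/L0[/ltW]].
- by apply: (le_lt_trans (Ha1 _ t0L)); exact: La.
elim=> [|n [L' [dL' uL' aL']]].
  exists [:: (1, 0, 1)]; split.
  - split=> [t||s]; rewrite ?big_seq1//=.
      by rewrite inE => /eqP->/=; rewrite ltr01 oner_neq0.
    by rewrite mulr0 mul0r cos0 normr1 !mul1r.
  - by rewrite /undamped big_mkcond big_seq1/= eqxx expr0.
  - by move=> t; rewrite inE => /eqP->/=; rewrite normr1 !expr0 lexx.
exists (compose_damping L L'); split; first exact: damping_compose.
  by rewrite undamped_compose// uL' exprSr.
move=> v /allpairsP[[t u]/= [tL uB ->]]/=; rewrite normrM !exprSr.
have /andP[h1 h2] := aL' _ tL.
by rewrite !ler_pM ?Ha1 ?Ha2 ?exprn_ge0//; exact: ltW.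
Qed.

End line_transform.

(** * Counting in fibres and power means *)

Lemma count_close (P : pred nat) (N K : nat) :
  (forall k k', P k -> P k' -> (k <= k')%N -> (k' - k <= N)%N) ->
  (count P (iota 0 K) <= N.+1)%N.
Proof.
move=> close; have [[k Pk]|nP] := pselect (exists k, P k); last first.
  rewrite (eq_count (a2 := pred0)) ?count_pred0// => k.
  by apply/negbTE/negP => Pk; apply: nP; exists k.
have exP : exists k, P k by exists k.
case: (ex_minnP exP) => k0 Pk0 min.
rewrite -size_filter -[leqRHS](size_iota k0).
apply: uniq_leq_size; first by rewrite filter_uniq// iota_uniq.
move=> i; rewrite mem_filter mem_iota => /andP[Pi _].
have ki := min _ Pi; have := close _ _ Pk0 Pi ki.
by rewrite mem_iota ki/= addnS ltnS leq_subLR.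
Qed.

Section counting.
Context {R : realType}.

Lemma natr_close (n k : nat) : `|n%:R - k%:R : R| < 1 -> n = k.
Proof.
rewrite ltr_norml => /andP[h1 h2].
have [nk|kn|//] := ltngtP n k.
  by move: nk; rewrite -(ler_nat R) -natr1 => H; exfalso; lra.
by move: kn; rewrite -(ler_nat R) -natr1 => H; exfalso; lra.
Qed.

Lemma sum_fiber_le (I J : eqType) (s : seq I) (r : seq J) (c : I -> R)
    (u : J -> R) (j : I -> J) (C : R) : uniq r ->
  (forall k, k \in s -> j k \in r) -> (forall i, 0 <= u i) ->
  (forall i, i \in r -> \sum_(k <- s | j k == i) c k <= C) ->
  \sum_(k <- s) c k * u (j k) <= C * \sum_(i <- r) u i.
Proof.
move=> ur js u0 cC; rewrite mulr_sumr.
have -> : \sum_(k <- s) c k * u (j k) =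
    \sum_(k <- s) \sum_(i <- r) (if j k == i then c k * u i else 0).
  rewrite big_seq [RHS]big_seq; apply: eq_bigr => k ks.
  rewrite -big_mkcond/= (eq_bigl (fun i => i == j k)); last by move=> i; rewrite eq_sym.
  by rewrite -big_filter filter_pred1_uniq ?js// big_seq1.
rewrite exchange_big/= big_seq [leRHS]big_seq; apply: ler_sum => i ir.
by rewrite -big_mkcond/= -mulr_suml ler_wpM2r// cC.
Qed.

Lemma expr_tangent (x m : R) n : 0 <= x -> 0 <= m ->
  m ^+ n.+1 + n.+1%:R * m ^+ n * (x - m) <= x ^+ n.+1.
Proof.
move=> x0 m0; elim: n => [|n IH]; first by rewrite !expr1 expr0; lra.
rewrite [leRHS]exprS; apply: le_trans (ler_wpM2l x0 IH).
rewrite -subr_ge0 (_ : _ - _ = n.+1%:R * m ^+ n * (x - m) ^+ 2).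
  by rewrite mulr_ge0 ?sqr_ge0// mulr_ge0// exprn_ge0.
by rewrite !exprS -[n.+2]addn1 natrD; ring.
Qed.

(** Jensen's inequality with unnormalised weights, from summing the tangent line of the power at the
    mean. *)
Lemma power_mean (I : eqType) (s : seq I) (w x : I -> R) n :
  0 < \sum_(i <- s) w i ->
  (forall i, i \in s -> 0 <= w i) -> (forall i, i \in s -> 0 <= x i) ->
  (\sum_(i <- s) w i * x i) ^+ n.+1 <=
  (\sum_(i <- s) w i) ^+ n * \sum_(i <- s) w i * x i ^+ n.+1.
Proof.
set X := \sum_(i <- s) w i * x i; set W := \sum_(i <- s) w i => Wp w0 x0.
have W0 := ltW Wp.
have X0 : 0 <= X.
  by rewrite /X big_seq sumr_ge0// => i si; rewrite mulr_ge0 ?x0 ?w0.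
pose m := X / W.
have m0 : 0 <= m by rewrite divr_ge0.
have XE : X = m * W by rewrite /m divfK// gt_eqF.
have -> : X ^+ n.+1 = W ^+ n * (W * m ^+ n.+1) by rewrite XE exprMn mulrA -exprSr mulrC.
rewrite ler_wpM2l ?exprn_ge0//.
have -> : W * m ^+ n.+1 = \sum_(i <- s) w i * (m ^+ n.+1 + n.+1%:R * m ^+ n * (x i - m)).
  rewrite [RHS](_ : _ = \sum_(i <- s) (w i * m ^+ n.+1 +
     (n.+1%:R * m ^+ n) * (w i * x i) - (n.+1%:R * m ^+ n * m) * w i)); last first.
    by apply: eq_bigr => i _; ring.
  rewrite sumrB big_split/= -mulr_suml -!mulr_sumr -/X -/W XE; ring.
rewrite big_seq [leRHS]big_seq; apply: ler_sum => i si.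
by rewrite (ler_wpM2l (w0 _ si))// expr_tangent// x0.
Qed.

End counting.

(** * Sparsity of the large values on the line *)

Section damping_recursion.
Context {R : realType} (mu : probability R R).
Local Notation ft := (ft mu).

Lemma truncn_fiber (a : R) (k k' : nat) : 0 < a -> (k <= k')%N ->
  Num.truncn (a * k%:R) = Num.truncn (a * k'%:R) -> a * (k' - k)%:R < 1.
Proof.
move=> a0 kk' tE.
have ak0 : 0 <= a * k%:R by rewrite mulr_ge0// ltW.
have ak'0 : 0 <= a * k'%:R by rewrite mulr_ge0// ltW.
have /andP[h1 h2] := truncn_itv ak0; have /andP[h3 h4] := truncn_itv ak'0.
move: h1 h2 h4; rewrite tE natrB// -natr1; lra.
Qed.

Lemma truncn_scale (a x : R) (k := Num.truncn x) (j := Num.truncn (a * k%:R)) :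
  0 < a <= 1 -> 0 <= x -> Num.truncn (a * x) = j \/ Num.truncn (a * x) = j.+1.
Proof.
move=> /andP[a0 a1] x0; have /andP[h1 h2] := truncn_itv x0; rewrite -/k in h1 h2.
have ak0 : 0 <= a * k%:R by rewrite mulr_ge0// ltW.
have /andP[h3 h4] := truncn_itv ak0; rewrite -/j in h3 h4.
have h5 : a * k%:R <= a * x by rewrite ler_wpM2l// ltW.
have h6 : a * x < a * k%:R + 1.
  move: h2; rewrite -natr1 => h2; apply: (@lt_le_trans _ _ (a * (k%:R + 1))).
    by rewrite ltr_pM2l.
  by rewrite mulrDr mulr1 lerD2l.
have [xj|jx] := ltP (a * x) j.+1%:R.
  by left; apply: truncn_def; rewrite xj (le_trans h3).
right; apply: truncn_def; rewrite jx/= -natr1; move: h4; lra.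
Qed.

(** One scale of the Erdos-Kahane recursion, on majorants [v] of the power [P.+1] of [ft] over cells
    of length [rho]. In the power mean, undamped terms get weight [z], at total cost [Zp], and
    return with a factor at most [m^-1]; damped terms get [m^-1] from their cosine, except on the
    cells where its argument is near an integer. *)
Lemma damping_step L (rho al m Zp z : R) P : damping mu L ->
  0 < rho -> 0 < al -> (forall t, t \in L -> al <= `|t.2| <= 1) ->
  (forall t, t \in L -> `|t.1.2| * rho * (4 + al^-1) < 1) ->
  al^-1 + 1 <= m -> 1 <= z -> m <= z ^+ P ->
  (\sum_(t <- L) t.1.1 * (if t.1.2 == 0 then z else 1)) ^+ P <= Zp ->
  (forall t, t \in L -> t.1.2 != 0 -> forall x : R, 0 <= x ->
    (forall n : nat, `|t.1.2| * rho <= `|x - n%:R|) ->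
    `|cos (pi * x)| ^+ P.+1 <= m^-1) ->
  forall v : nat -> R, (forall k, 0 <= v k) ->
    (forall s, ft s ^+ P.+1 <= v (Num.truncn (`|s| / rho))) ->
  exists v' : nat -> R, [/\ forall k, 0 <= v' k,
    forall s, ft s ^+ P.+1 <= v' (Num.truncn (`|s| / rho)) &
    forall K K' : nat, (forall t, t \in L -> forall k, (k < K)%N ->
        (Num.truncn (`|t.2| * k%:R) < K')%N) ->
      \sum_(k <- iota 0 K) v' k <= Zp * 12 * \sum_(k <- iota 0 K'.+1) v k].
Proof.
move=> [L0 L1 LF] rho0 al0 La Lrho alm z1 mz ZZp far v v0 hv.
have m0 : 0 < m by apply: lt_le_trans alm; rewrite ltr_wpDl// invr_ge0 ltW.
have z0 : 0 < z by apply: lt_le_trans z1.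
(* One [e] is the distance to an integer within which the cosine may be large, the other the
   variation of the argument across a cell. *)
pose near (e : R) (k : nat) := `[< exists n : nat, `|e * k%:R - n%:R| <= 2 * e >].
pose ka (t : R * R * R) k : R :=
  if (t.1.2 != 0) && near (`|t.1.2| * rho) k then 1 else m^-1.
have ka0 t k : 0 <= ka t k by rewrite /ka; case: ifP => // _; rewrite invr_ge0 ltW.
pose j (t : R * R * R) k := Num.truncn (`|t.2| * k%:R).
(* By [truncn_scale], contracting the frequencies of one cell reaches only the cells [j] and
   [j.+1]. *)
pose u k := v k + v k.+1.
have u0 k : 0 <= u k by rewrite addr_ge0.
pose w (t : R * R * R) := if t.1.2 == 0 then z else 1.
have w0 t : 0 < w t by rewrite /w; case: ifP.
have Zp0 : 0 <= Zp.
  apply: le_trans ZZp; rewrite exprn_ge0// big_seq sumr_ge0// => t /L0[q0 _].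
  exact: (mulr_ge0 (ltW q0) (ltW (w0 t))).
pose v' k := Zp * \sum_(t <- L) t.1.1 * (ka t k * u (j t k)).
exists v'; split.
- move=> k; rewrite mulr_ge0// big_seq sumr_ge0// => t /L0[q0 _].
  by rewrite mulr_ge0 ?(ltW q0)// mulr_ge0.
- move=> s; set k := Num.truncn _.
  pose g (t : R * R * R) := `|cos (pi * t.1.2 * s)| * ft (t.2 * s).
  have g0 t : 0 <= g t by rewrite mulr_ge0// ft_ge0.
  have H : (\sum_(t <- L) t.1.1 * w t * (g t / w t)) ^+ P.+1 <=
      (\sum_(t <- L) t.1.1 * w t) ^+ P * \sum_(t <- L) t.1.1 * w t * (g t / w t) ^+ P.+1.
    apply: power_mean => [|t /L0[q0 _]|t _].
    - apply: (lt_le_trans ltr01); rewrite -L1 big_seq [leRHS]big_seq; apply: ler_sum.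
      by move=> t /L0[q0 _]; rewrite ler_peMr ?(ltW q0)// /w; case: ifP.
    - by rewrite mulr_ge0// ltW.
    - by rewrite divr_ge0// ltW.
  apply: (@le_trans _ _ ((\sum_(t <- L) t.1.1 * w t * (g t / w t)) ^+ P.+1)).
    rewrite lerXn2r ?nnegrE ?ft_ge0//.
      rewrite big_seq sumr_ge0// => t /L0[q0 _].
      exact: (mulr_ge0 (mulr_ge0 (ltW q0) (ltW (w0 t))) (divr_ge0 (g0 t) (ltW (w0 t)))).
    apply: (le_trans (LF s)); rewrite le_eqVlt; apply/orP; left; apply/eqP.
    apply: eq_bigr => t _; rewrite /g -mulrA; field; by rewrite gt_eqF.
  apply: (le_trans H); apply: ler_pM => //.
  + rewrite exprn_ge0// big_seq sumr_ge0// => t /L0[q0 _].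
    exact: (mulr_ge0 (ltW q0) (ltW (w0 t))).
  + rewrite big_seq sumr_ge0// => t /L0[q0 _].
    exact: (mulr_ge0 (mulr_ge0 (ltW q0) (ltW (w0 t))) (exprn_ge0 _ (divr_ge0 (g0 t) (ltW (w0 t))))).
  rewrite big_seq [leRHS]big_seq; apply: ler_sum => t tL.
  have [q0 t20] := L0 _ tL; rewrite -mulrA (ler_wpM2l (ltW q0))//.
  have /andP[ta1 ta2] := La _ tL.
  have ta0 : 0 < `|t.2| by rewrite normr_gt0.
  have fu : ft (t.2 * s) ^+ P.+1 <= u (j t k).
    apply: (le_trans (hv _)); rewrite normrM -mulrA /j /u.
    have sr0 : 0 <= `|s| / rho by rewrite divr_ge0// ltW.
    have [|->|->] := @truncn_scale `|t.2| (`|s| / rho) _ sr0; first by rewrite ta0.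
      by rewrite lerDl.
    by rewrite lerDr.
  have fu0 : 0 <= ft (t.2 * s) ^+ P.+1 by rewrite exprn_ge0// ft_ge0.
  have c1 : `|cos (pi * t.1.2 * s)| ^+ P.+1 <= 1.
    by rewrite exprn_ile1// cos_max.
  have gP : g t ^+ P.+1 = `|cos (pi * t.1.2 * s)| ^+ P.+1 * ft (t.2 * s) ^+ P.+1.
    by rewrite exprMn.
  rewrite expr_div_n; have [tz|tnz] := eqVneq t.1.2 0.
    rewrite /ka /w tz eqxx/=.
    have -> : z * (g t ^+ P.+1 / z ^+ P.+1) = (z ^+ P)^-1 * g t ^+ P.+1.
      by rewrite [z ^+ P.+1]exprS invfM mulrCA (mulrA z) divff ?gt_eqF// mul1r mulrC.
    apply: ler_pM; rewrite ?invr_ge0 ?exprn_ge0//; first exact: ltW.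
      by rewrite lef_pV2// posrE exprn_gt0.
    by rewrite gP; apply: le_trans fu; rewrite ler_piMl.
  rewrite /ka /w (negbTE tnz)/= expr1n divr1 mul1r gP.
  case: ifPn => [_|nnear].
    by apply: ler_pM.
  apply: ler_pM => //.
  have -> : `|cos (pi * t.1.2 * s)| = `|cos (pi * (`|t.1.2| * `|s|))|.
    by rewrite -[in LHS]cos_norm -mulrA 2!normrM (gtr0_norm (pi_gt0 R)).
  apply: (far _ tL tnz); first by rewrite mulr_ge0.
  move=> n; rewrite leNgt; apply/negP => H2; move/negP: nnear; apply; apply/asboolP.
  exists n.
  have sr0 : 0 <= `|s| / rho by rewrite divr_ge0// ltW.
  have /andP[k1 k2] := truncn_itv sr0; rewrite -/k in k1 k2.
  set e := `|t.1.2| * rho.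
  have e0 : 0 < e by rewrite mulr_gt0// normr_gt0.
  have -> : e * k%:R - n%:R = (`|t.1.2| * `|s| - n%:R) - e * (`|s| / rho - k%:R).
    by rewrite /e; field; rewrite gt_eqF.
  apply: (le_trans (ler_normB _ _)).
  rewrite [`|e * _|]ger0_norm; last by rewrite mulr_ge0 ?subr_ge0// ltW.
  have : e * (`|s| / rho - k%:R) <= e * 1.
    by rewrite ler_wpM2l ?(ltW e0)// lerBlDl ltW// natr1.
  move: H2; rewrite -/e; lra.
- move=> K K' hK.
  rewrite /v' -mulr_sumr -mulrA ler_wpM2l//.
  rewrite exchange_big/=.
  have u2 : \sum_(i <- iota 0 K') u i <= 2 * \sum_(i <- iota 0 K'.+1) v i.
    rewrite /u big_split/= mulr_natl mulr2n; apply: lerD.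
      by rewrite -[0%N :: _]/(iota 0 K'.+1) -[K'.+1]addn1 iotaD big_cat/= lerDl sumr_ge0.
    rewrite [leRHS](_ : _ = v 0%N + \sum_(i <- iota 0 K') v i.+1) ?lerDr//.
    by rewrite /= big_cons -[iota 1 _]/(iota (1 + 0) _) iotaDl big_map.
  have -> : 12 * \sum_(k <- iota 0 K'.+1) v k =
      \sum_(t <- L) t.1.1 * (6 * (2 * \sum_(k <- iota 0 K'.+1) v k)).
    by rewrite -mulr_suml L1; ring.
  rewrite big_seq [leRHS]big_seq; apply: ler_sum => t tL.
  have [q0 t20] := L0 _ tL; have /andP[ta1 ta2] := La _ tL.
  have ta0 : 0 < `|t.2| by rewrite normr_gt0.
  rewrite -mulr_sumr (ler_wpM2l (ltW q0))//.
  apply: (@le_trans _ _ (6 * \sum_(i <- iota 0 K') u i)); last by rewrite ler_wpM2l.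
  apply: sum_fiber_le => //; first exact: iota_uniq.
    by move=> k; rewrite !mem_iota/= !add0n => /(hK _ tL).
  move=> i _.
  pose P1 k := [&& j t k == i, t.1.2 != 0 & near (`|t.1.2| * rho) k].
  pose P2 k := j t k == i.
  (* A fibre of [j] has at most [m] cells, worth 1 in total at weight [m^-1], and at most 5 near
     cells of weight 1. This is 6 per fibre, doubled to 12 by the two summands of [u]. *)
  apply: (@le_trans _ _ ((count P1 (iota 0 K))%:R + m^-1 * (count P2 (iota 0 K))%:R)).
    rewrite -!sum1_count !natr_sum mulr_sumr.
    rewrite [leRHS](_ : _ = \sum_(k <- iota 0 K | j t k == i)
        ((if (t.1.2 != 0) && near (`|t.1.2| * rho) k then 1 else 0) + m^-1)); last first.
      rewrite big_split/= -big_mkcondr/=; congr (_ + _).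
      by apply: eq_bigr => k _; rewrite mulr1.
    apply: ler_sum => k _; rewrite /ka; case: ifP => _; rewrite ?add0r// lerDl invr_ge0 ltW//.
  have fib k k' : j t k = i -> j t k' = i -> (k <= k')%N ->
      (k' - k)%:R < al^-1.
    move=> ki k'i kk'; have := truncn_fiber ta0 kk'; rewrite -/(j t k) -/(j t k') ki k'i.
    move=> /(_ erefl) H; rewrite -[ltRHS]mul1r ltr_pdivlMr// mulrC.
    by apply: le_lt_trans H; rewrite ler_wpM2r.
  have c1 : (count P1 (iota 0 K) <= 5)%N.
    apply: count_close => k k' /and3P[/eqP ki tn /asboolP[n nk]].
    move=> /and3P[/eqP k'i _ /asboolP[n' nk']] kk'.
    have fk := fib _ _ ki k'i kk'.
    set e := `|t.1.2| * rho in nk nk'.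
    have e0 : 0 < e by rewrite mulr_gt0// normr_gt0.
    have ed := Lrho _ tL; rewrite -/e in ed.
    have eD : e * k'%:R - e * k%:R = e * (k' - k)%:R by rewrite natrB// mulrBr.
    have ef : e * (k' - k)%:R < e * al^-1 by rewrite ltr_pM2l.
    have ef0 : 0 <= e * (k' - k)%:R by rewrite mulr_ge0// ltW.
    (* Within a fibre [e * k] varies by less than [e / al]; adding [4 * e] for the two distances
       stays below 1 by the bound on [rho], so the two integers agree. *)
    have nn : n = n'.
      apply: (@natr_close R).
      move: nk nk'; rewrite !ler_norml ltr_norml => /andP[? ?] /andP[? ?].
      by apply/andP; split; lra.
    have : (k' - k)%:R <= 4 :> R.
      rewrite -(ler_pM2l e0) -eD; move: nk nk'; rewrite nn !ler_norml.
      by move=> /andP[? ?] /andP[? ?]; lra.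
    by rewrite ler_nat.
  have c2 : (count P2 (iota 0 K) <= (Num.truncn al^-1).+1)%N.
    apply: count_close => k k' /eqP ki /eqP k'i kk'.
    rewrite truncn_ge_nat ?invr_ge0 ?ltW//; exact: fib.
  have c2' : (count P2 (iota 0 K))%:R <= m.
    apply: le_trans alm; apply: (@le_trans _ _ (Num.truncn al^-1).+1%:R).
      by rewrite ler_nat.
    by rewrite -natr1 lerD2r truncn_le invr_ge0 ltW.
  have : m^-1 * (count P2 (iota 0 K))%:R <= 1.
    by rewrite mulrC ler_pdivrMr// mul1r.
  have : (count P1 (iota 0 K))%:R <= 5 :> R by rewrite ler_nat.
  lra.
Qed.

End damping_recursion.

Section line_decay.
Context {R : realType} (mu : probability R R).
Local Notation ft := (ft mu).

Lemma norm_cosDn (y : R) n : `|cos (pi * (y + n%:R))| = `|cos (pi * y)|.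
Proof.
elim: n => [|n IH]; first by rewrite addr0.
by rewrite -natr1 addrA mulrDr mulr1 cosDpi normrN.
Qed.

Lemma cos_pi_decreasing (y z : R) : 0 <= y -> y < z -> z <= 1 -> cos (pi * z) < cos (pi * y).
Proof.
move=> y0 yz z1; have p0 := pi_gt0 R.
have inpi (w : R) : 0 <= w -> w <= 1 -> pi * w \in `[0, pi].
  move=> w0 w1; rewrite in_itv/=; apply/andP; split.
    by rewrite mulr_ge0// ltW.
  by rewrite ler_piMr// ltW.
rewrite ltr_cos ?inpi//; first by rewrite ltr_pM2l.
all: apply: ltW; first [exact: le_lt_trans yz|exact: lt_le_trans z1].
Qed.

Lemma norm_cos_far (e x : R) : 0 < e <= 1 / 2 -> 0 <= x ->
  (forall n : nat, e <= `|x - n%:R|) -> `|cos (pi * x)| <= cos (pi * e).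
Proof.
move=> /andP[e0 e1] x0 far; have /andP[x1 x2] := truncn_itv x0.
set n := Num.truncn x in x1 x2; pose y := x - n%:R.
have -> : x = y + n%:R by rewrite /y subrK.
have p0 := pi_gt0 R.
have y1 : e <= y by have := far n; rewrite ger0_norm ?subr_ge0.
have y2 : e <= 1 - y.
  have := far n.+1; rewrite ler0_norm; last by rewrite subr_le0 ltW.
  by rewrite -natr1 /y; lra.
rewrite norm_cosDn ler_norml.
have cle z : e <= z -> z <= 1 -> cos (pi * z) <= cos (pi * e).
  move=> ez z1; have [<-//|ne] := eqVneq e z.
  by apply: ltW; apply: cos_pi_decreasing => //; [exact: ltW|rewrite lt_def eq_sym ne].
rewrite cle//; last by lra.
rewrite andbT lerNl -cosDpi -cosN (_ : - _ = pi * (1 - y) - pi *+ 2); last by ring.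
rewrite cosB cos2pi sin_mulr2n sinpi mulr0 mul0rn !mulr0 addr0 mulr1 cle//; lra.
Qed.

Lemma expR_half_le (u : R) : 0 <= u <= 1 -> expR (u / 2) <= 1 + u.
Proof.
move=> /andP[u0 u1]; have h := expR_ge1Dx (- (u / 2)).
have h1 : 0 < 1 - u / 2 by lra.
rewrite -[u / 2]opprK expRN -[leRHS]invrK lef_pV2 ?posrE ?expR_gt0 ?invr_gt0//; last by lra.
apply: le_trans h; rewrite -[leLHS]mul1r ler_pdivrMr; last by lra.
nra.
Qed.

Lemma seq_uniform_far (L : seq (R * R * R)) (rho : R) : 0 < rho ->
  (forall t, t \in L -> `|t.1.2| * rho <= 1 / 2) ->
  exists2 c : R, 0 <= c < 1 & forall t, t \in L -> t.1.2 != 0 ->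
    forall x : R, 0 <= x -> (forall n : nat, `|t.1.2| * rho <= `|x - n%:R|) ->
    `|cos (pi * x)| <= c.
Proof.
move=> rho0 hL.
have [e' e'0 he'] : exists2 m, 0 < m &
    forall t, t \in [seq t <- L | t.1.2 != 0] -> m <= `|t.1.2| * rho.
  by apply: seq_lbound_gt => t; rewrite mem_filter => /andP[t0 _]; rewrite mulr_gt0// normr_gt0.
pose e := Num.min e' (1 / 2).
have e0 : 0 < e <= 1 / 2 by rewrite /e lt_min e'0 ge_min lexx orbT andbT/=; lra.
have p0 := pi_gt0 R; have /andP[e1 e2] := e0.
exists (cos (pi * e)); first (apply/andP; split).
- apply: cos_ge0_pihalf; apply/andP; split.
    by apply: (@le_trans _ _ 0); rewrite ?oppr_le0 ?mulr_ge0 ?ltW//; lra.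
  by rewrite ler_wpM2l ?(ltW p0)// -[2^-1]mul1r.
- have := @cos_pi_decreasing 0 e (lexx _) e1; rewrite mulr0 cos0; apply; lra.
move=> t tL t0 x x0 far; apply: norm_cos_far => // n.
by apply: le_trans (far n); rewrite /e ge_min he' ?mem_filter ?t0.
Qed.

(** The logarithm of the cost grows at most linearly in [n], with a slope that the factor [th ^+ n]
    makes as small as desired; that of the right side is linear with fixed positive slope, and so
    also absorbs the 12. *)
Lemma exists_scale (th a1 a2 eps : R) : 0 <= th < 1 -> 0 < a1 < 1 -> 0 < a2 < 1 ->
  0 < eps -> exists n : nat, a2 ^+ n <= 1 / 2 /\
    expR (2 * th ^+ n * ln (2 / a1 ^+ n)) * 12 <= (a2 ^+ n)^-1 `^ eps.
Proof.
move=> /andP[th0 th1] /andP[a10 a11] /andP[a20 a21] eps0.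
pose l1 := - ln a1; pose l2 := - ln a2.
have l10 : 0 < l1 by rewrite /l1 oppr_gt0 ln_lt0// a10.
have l20 : 0 < l2 by rewrite /l2 oppr_gt0 ln_lt0// a20.
have l1p : 0 < 1 + l1 by rewrite addr_gt0.
pose del := eps * l2 / (8 * (1 + l1)).
have del0 : 0 < del by rewrite /del divr_gt0 ?mulr_gt0.
have [n0 hn0] : exists n, th ^+ n < del by apply: exprn_small => //; rewrite th0.
have [n1 hn1] : exists n, a2 ^+ n < 1 / 2.
  by apply: exprn_small; [rewrite ltW|rewrite divr_gt0].
pose n2 := (Num.truncn (8 / (eps * l2))).+1.
have el0 : 0 < eps * l2 by rewrite mulr_gt0.
have hn2 : 8 < eps * l2 * n2%:R.
  by rewrite mulrC -ltr_pdivrMr// truncnS_gt.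
pose n := (n0 + n1 + n2)%N.
have n2n : n2%:R <= n%:R :> R by rewrite ler_nat /n leq_addl.
have n1r : 1 <= n%:R :> R by apply: le_trans n2n; rewrite ler1n.
have thn : th ^+ n <= del.
  apply: le_trans (ltW hn0); rewrite /n -addnA exprD ler_piMr ?exprn_ge0//.
  by rewrite exprn_ile1// ltW.
have A12 : a2 ^+ n <= 1 / 2.
  apply: le_trans (ltW hn1); rewrite /n addnAC exprD ler_piMl ?exprn_ge0 ?(ltW a20)//.
  by rewrite exprn_ile1// ltW.
exists n; split => //.
set lm := ln _.
have al0 : 0 < a1 ^+ n by rewrite exprn_gt0.
have lm0 : 0 <= lm.
  rewrite ln_ge0// ler_pdivlMr// mul1r; apply: (@le_trans _ _ 1); last by rewrite ler1n.
  by rewrite exprn_ile1// ltW.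
have lmE : lm <= n%:R * (1 + l1).
  have lnal : ln (a1 ^+ n) = - (n%:R * l1) by rewrite lnXn// /l1 mulrN opprK mulr_natl.
  rewrite /lm ln_div ?posrE// lnal opprK mulrDr mulr1 lerD2r.
  apply: le_trans n1r; rewrite -[2]/(1 + 1 : R).
  by apply: le_ln1Dx; apply: (lt_trans _ ltr01); rewrite ltrN10.
clearbody lm; have -> : (a2 ^+ n)^-1 `^ eps = expR (eps * (n%:R * l2)).
  rewrite /powR gt_eqF ?invr_gt0 ?exprn_gt0// lnV ?posrE ?exprn_gt0// lnXn//.
  by congr (expR (_ * _)); rewrite /l2 mulrN mulr_natl.
apply: (@le_trans _ _ (expR (2 * th ^+ n * lm) * expR 4)).
  rewrite ler_wpM2l ?expR_ge0// -[4]mulr1 mulrC expRM_natr.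
  apply: (@le_trans _ _ (2 ^+ 4)); first by rewrite -natrX ler_nat.
  rewrite lerXn2r ?nnegrE ?expR_ge0//.
  exact: (expR_ge1Dx (1 : R)).
rewrite -expRD ler_expR.
have h1 : 2 * th ^+ n * lm <= eps * (n%:R * l2) / 4.
  apply: (@le_trans _ _ (2 * del * (n%:R * (1 + l1)))).
    by apply: ler_pM => //; rewrite ?mulr_ge0 ?exprn_ge0// ler_pM2l.
  rewrite le_eqVlt; apply/orP; left; apply/eqP; rewrite /del; field.
  by rewrite gt_eqF.
have h2 : 8 <= eps * (n%:R * l2).
  apply: ltW; apply: (lt_le_trans hn2); rewrite [n%:R * l2]mulrC mulrA.
  by rewrite (ler_wpM2l (ltW el0)).
move: h1 h2; move: (eps * (n%:R * l2)) (2 * th ^+ n * lm) => X Y; clear; lra.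
Qed.

(** With [z = 1 + 2 * ln m / P] and [P] large, [z ^+ P] reaches [m], because 1 + u is at least
    e^(u/2) on [0, 1], while charging it to weight [th] only costs about m^(2 th). *)
Lemma exists_power (m c th : R) : 1 <= m -> 0 <= c < 1 -> 0 <= th ->
  exists P z, [/\ 1 <= z, m <= z ^+ P, c ^+ P.+1 <= m^-1 &
    (1 + th * (z - 1)) ^+ P <= expR (2 * th * ln m)].
Proof.
move=> m1 /andP[c0 c1] th0.
have m0 : 0 < m by apply: lt_le_trans m1.
have lm0 : 0 <= ln m by rewrite ln_ge0.
have [P0 hP0] : exists k, c ^+ k < m^-1.
  by apply: exprn_small; rewrite ?c0// invr_gt0.
pose P1 := (Num.truncn (2 * ln m)).+1.
have hP1 : 2 * ln m < P1%:R by exact: truncnS_gt.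
pose P := (P0 + P1)%N.
have P1P : P1%:R <= P%:R :> R by rewrite ler_nat leq_addl.
have P00 : 0 < P%:R :> R by apply: lt_le_trans P1P; rewrite ltr0n.
pose u := 2 * ln m / P%:R.
have u0 : 0 <= u by rewrite /u divr_ge0 ?mulr_ge0// ltW.
have u1 : u <= 1 by rewrite /u ler_pdivrMr// mul1r (le_trans (ltW hP1)).
have uP : u / 2 * P%:R = ln m by rewrite /u; field; rewrite gt_eqF.
exists P, (1 + u); split.
- by rewrite lerDl.
- rewrite -[leLHS]lnK ?posrE// -uP expRM_natr lerXn2r ?nnegrE ?expR_ge0 ?addr_ge0//.
  by apply: expR_half_le; rewrite u0.
- apply: le_trans (ltW hP0).
  by rewrite /P -addnS exprD ler_piMr ?exprn_ge0// exprn_ile1// ltW.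
- rewrite [1 + u]addrC addrK; apply: (@le_trans _ _ (expR (th * u) ^+ P)).
    rewrite lerXn2r ?nnegrE ?expR_ge0 ?expR_ge1Dx//.
    by rewrite addr_ge0// mulr_ge0.
  rewrite -expRM_natr ler_expR -uP le_eqVlt; apply/orP; left; apply/eqP.
  by field.
Qed.

Lemma damping_scales B eps : represents mu B -> (forall t, t \in B -> `|t.1.2| < 1) ->
  non_atomic mu -> 0 < eps ->
  exists rho A Bn P, [/\ 0 < rho, 0 < A <= 1 / 2, 1 <= Bn <= A^-1 `^ eps &
  forall N, exists v : nat -> R, [/\ forall k, 0 <= v k,
    forall s, ft s ^+ P.+1 <= v (Num.truncn (`|s| / rho)) &
    forall K : nat, K%:R <= A^-1 ^+ N + 4 -> \sum_(k <- iota 0 K) v k <= 5 * Bn ^+ N]].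
Proof.
move=> rB aB na eps0.
have [th [a1 [a2 [th01 a101 a201 lists]]]] := iterated_damping rB aB na.
have [n [A12 BA]] := exists_scale th01 a101 a201 eps0.
have [L [dL uL La]] := lists n.
move: th01 a101 a201 => /andP[th0 th1] /andP[a10 a11] /andP[a20 a21].
set A := a2 ^+ n in A12 BA La; set al := a1 ^+ n in BA La.
have A0 : 0 < A by rewrite exprn_gt0.
have al0 : 0 < al by rewrite exprn_gt0.
have al1 : al <= 1 by rewrite exprn_ile1// ltW.
clearbody al A.
have ali : 1 <= al^-1 by rewrite invf_ge1.
pose m := 2 / al.
have alm : al^-1 + 1 <= m.
  by rewrite /m mulr_natl mulr2n lerD2l.
have m1 : 1 <= m by apply: le_trans alm; rewrite lerDr (le_trans ler01).
have [Dm hD] := seq_ubound L (fun t => `|t.1.2|).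
have al4 : 0 < 4 + al^-1 by rewrite addr_gt0// invr_gt0.
pose rho := ((`|Dm| + 1) * (4 + al^-1))^-1.
have Dm0 : 0 < `|Dm| + 1 by rewrite ltr_wpDl.
have rho0 : 0 < rho by rewrite /rho invr_gt0 mulr_gt0.
have hrho t : t \in L -> `|t.1.2| * rho * (4 + al^-1) < 1.
  move=> tL; rewrite /rho invfM -!mulrA mulVf ?gt_eqF// mulr1.
  rewrite ltr_pdivrMr// mul1r; apply: (@le_lt_trans _ _ `|Dm|); last by rewrite ltrDl.
  by apply: (le_trans (hD _ tL)); exact: ler_norm.
have [|c c01 hc] := @seq_uniform_far L rho rho0.
  move=> t /hrho; have X0 : 0 <= `|t.1.2| * rho by rewrite mulr_ge0// ltW.
  move: X0 ali; set X := _ * rho; clear => X0 ali H.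
  have : X * 5 <= X * (4 + al^-1) by rewrite ler_wpM2l//; lra.
  lra.
have th'0 : 0 <= th ^+ n by rewrite exprn_ge0.
have [P [z [z1 mz hcP ZP]]] := exists_power m1 c01 th'0.
move: c01 => /andP[c0 c1].
pose Zp := expR (2 * th ^+ n * ln m).
have ZZp : (\sum_(t <- L) t.1.1 * (if t.1.2 == 0 then z else 1)) ^+ P <= Zp.
  apply: le_trans ZP; rewrite le_eqVlt; apply/orP; left; apply/eqP; congr (_ ^+ _).
  rewrite -uL /undamped; case: dL => _ L1 _.
  rewrite -[X in _ = X + _]L1 [in X in _ + X]big_mkcond/= mulr_suml -big_split/=.
  apply: eq_bigr => t _.
  by case: ifP => _; rewrite ?mul0r ?addr0 ?mulr1// -[X in X + _]mulr1 -mulrDr addrC subrK.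
have far t : t \in L -> t.1.2 != 0 -> forall x : R, 0 <= x ->
    (forall k : nat, `|t.1.2| * rho <= `|x - k%:R|) ->
    `|cos (pi * x)| ^+ P.+1 <= m^-1.
  move=> tL t0 x x0 fx; apply: le_trans hcP.
  by rewrite lerXn2r ?nnegrE//; exact: hc fx.
have Zp1 : 1 <= Zp * 12.
  rewrite -[leLHS]mulr1; apply: ler_pM => //; last by rewrite ler1n.
  by rewrite /Zp -expR0 ler_expR !mulr_ge0// ln_ge0.
exists rho, A, (Zp * 12), P; split; rewrite ?A0 ?Zp1//.
(* The slack 4 reproduces itself: the next range has at most [A * K + 2] cells, and [4 * A + 2 <= 4]
   because [A <= 1 / 2]. For [N = 0] there are at most 5 cells of value 1. *)
elim=> [|N [v [v0 hv sv]]].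
  exists (fun=> 1); split => // [s|K].
    by rewrite exprn_ile1 ?ft_ge0 ?ft_le1.
  rewrite expr0 => K5; rewrite big_const_seq count_predT size_iota iter_addr_0 expr0.
  by rewrite mulr1; apply: (le_trans K5); clear; lra.
have La1 t : t \in L -> al <= `|t.2| <= 1.
  move=> /La/andP[h1 h2]; rewrite h1/=; apply: (le_trans h2); clear -A12; lra.
have [v' [v'0 hv' sv']] := damping_step dL rho0 al0 La1 hrho alm z1 mz ZZp far v0 hv.
exists v'; split=> // K hK.
have AK0 : 0 <= A * K%:R by rewrite mulr_ge0// ltW.
apply: (le_trans (sv' K (Num.truncn (A * K%:R)).+1 _)).
  move=> t /La/andP[h1 h2] k kK; rewrite ltnS; apply: le_truncn.
  by apply: ler_pM => //; rewrite ler_nat ltnW.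
rewrite exprS [5 * _]mulrCA; apply: ler_wpM2l; first exact: (le_trans ler01).
apply: sv; rewrite -!natr1.
have h1 : (Num.truncn (A * K%:R))%:R <= A * K%:R by rewrite truncn_le.
have h2 : A * K%:R <= A * (A^-1 ^+ N.+1 + 4) by rewrite ler_pM2l.
move: h2; rewrite mulrDr exprS mulrA divff ?gt_eqF// mul1r; clear -h1 A12; lra.
Qed.

Lemma line_decay B eps : represents mu B -> (forall t, t \in B -> `|t.1.2| < 1) ->
  non_atomic mu -> 0 < eps ->
  exists rho C P, [/\ 0 < rho, 0 < C & forall X : R, 1 <= X ->
  exists v : nat -> R, [/\ forall k, 0 <= v k,
    forall s, ft s ^+ P.+1 <= v (Num.truncn (`|s| / rho)) &
    forall K : nat, K%:R <= X + 1 -> \sum_(k <- iota 0 K) v k <= C * X `^ eps]].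
Proof.
move=> rB aB na eps0.
have [rho [A [Bn [P [rho0 /andP[A0 A1] /andP[B1 BA] H]]]]] := damping_scales rB aB na eps0.
have B0 : 0 < Bn by lra.
exists rho, (5 * Bn), P; split => //; first by rewrite mulr_gt0.
move=> X X1; have X0 : 0 < X by lra.
have A01 : 0 < A < 1 by rewrite A0/=; lra.
have X01 : 0 < X^-1 <= 1 by rewrite invr_gt0 X0 invf_le1.
have [k /andP[k1 k2]] := geometric_scale A01 X01.
have [v [v0 hv sv]] := H k.+1; exists v; split => // K hK.
have Ak : X < A^-1 ^+ k.+1.
  by rewrite -[ltLHS]invrK exprVn ltf_pV2// posrE ?invr_gt0// exprn_gt0.
have Ak2 : A^-1 ^+ k <= X.
  by rewrite -[leRHS]invrK exprVn lef_pV2// posrE ?invr_gt0// exprn_gt0.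
apply: (le_trans (sv K _)); first by lra.
rewrite exprS mulrA ler_wpM2l//; first by lra.
apply: (@le_trans _ _ ((A^-1 `^ eps) ^+ k)).
  by rewrite lerXn2r ?nnegrE ?powR_ge0// ltW.
rewrite -powR_mulrn ?powR_ge0// -powRrM mulrC powRrM powR_mulrn ?invr_ge0 ?(ltW A0)//.
apply: (ge0_ler_powR (ltW eps0)) => //; rewrite nnegrE ?(ltW X0)//.
by rewrite exprn_ge0// invr_ge0 ltW.
Qed.

(** Markov's inequality for the cell sums. The power [p] depends neither on [X] nor on [tau], so
    [tau] may later be a small negative power of the frequency. *)
Lemma large_cells B eps : represents mu B -> (forall t, t \in B -> `|t.1.2| < 1) ->
  non_atomic mu -> 0 < eps ->
  exists rho C p, [/\ 0 < rho, 0 < C & forall X tau : R, 1 <= X -> 0 < tau ->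
  exists s : seq nat, [/\ uniq s, (size s)%:R <= C * X `^ eps / tau ^+ p &
    forall t, `|t| <= rho * X -> tau <= ft t -> Num.truncn (`|t| / rho) \in s]].
Proof.
move=> rB aB na eps0.
have [rho [C [P [rho0 C0 H]]]] := line_decay rB aB na eps0.
exists rho, C, P.+1; split => // X tau X1 tau0.
have [v [v0 hv sv]] := H X X1.
have X0 : 0 <= X by lra.
pose K := (Num.truncn X).+1.
have hK : K%:R <= X + 1 by rewrite -natr1 lerD2r truncn_le.
exists [seq k <- iota 0 K | tau ^+ P.+1 <= v k]; split.
- by rewrite filter_uniq// iota_uniq.
- rewrite ler_pdivlMr ?exprn_gt0//; apply: le_trans (sv K hK).
  rewrite size_filter -sum1_count natr_sum mulr_suml big_mkcond/=.
  by apply: ler_sum => k _; rewrite mul1r; case: ifP.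
- move=> t tX tt; rewrite mem_filter mem_iota/= add0n ltnS.
  rewrite (le_trans _ (hv t))/=; last by rewrite lerXn2r// nnegrE ?ft_ge0// ltW.
  by apply: le_truncn; rewrite ler_pdivrMr// mulrC.
Qed.

End line_decay.

Lemma maximal_separated (T : eqType) (sep : rel T) (A : T -> Prop) (N : nat) :
  (forall s, pairwise sep s -> (forall x, x \in s -> A x) -> (size s <= N)%N) ->
  exists s, [/\ pairwise sep s, forall x, x \in s -> A x, (size s <= N)%N &
    forall x, A x -> exists2 y, y \in s & ~~ sep x y].
Proof.
move=> bd.
pose P n := `[< exists s, [/\ pairwise sep s, forall x, x \in s -> A x & size s = n] >].
have exP : exists n, P n by exists 0%N; apply/asboolP; exists [::].
have PN n : P n -> (n <= N)%N by move=> /asboolP[s [? ? <-]]; exact: bd.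
case: (ex_maxnP exP PN) => n /asboolP[s [ps As sn]] max.
exists s; split=> // [|x Ax]; first exact: bd.
apply: contrapT => H.
have : (n.+1 <= n)%N; last by rewrite ltnn.
apply: max; apply/asboolP; exists (x :: s); rewrite /= sn; split => //.
  rewrite ps andbT; apply/allP => y ys; apply: contrapT => /negP xy.
  by apply: H; exists y.
by move=> y; rewrite inE => /orP[/eqP->|/As].
Qed.

(** * Sublevel sets of functions with a large derivative *)

Section sublevel.
Context {R : realType}.

Definition separated (l : R) := fun x y : R => l <= `|x - y|.

Lemma separated_uniq l (s : seq R) : 0 < l -> pairwise (separated l) s -> uniq s.
Proof.
move=> l0; rewrite uniq_pairwise; apply: sub_pairwise => x y.
by apply: contraTneq => ->; rewrite /separated subrr normr0 -ltNge.
Qed.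

Lemma separated_sort l (s : seq R) : 0 < l -> pairwise (separated l) s ->
  pairwise (fun x y => x + l <= y) (sort <=%O s).
Proof.
move=> l0 ps; have us := separated_uniq l0 ps.
have := us; rewrite -sort_lt_sorted (sorted_pairwise lt_trans) => pl.
have sepP : {in s &, forall x y : R, x != y -> separated l x y}.
  move: ps; elim: s {us pl} => //= a s IH /andP[/allP Ha ps] x y.
  rewrite !inE => /orP[/eqP->|xs] /orP[/eqP->|ys].
  - by rewrite eqxx.
  - by move=> _; exact: Ha.
  - by move=> _; rewrite /separated distrC; exact: Ha.
  - exact: IH.
apply: (@sub_in_pairwise _ (mem s) <%O _ _ _ _ pl).
  move=> x y xs ys xy; have := sepP x y xs ys; rewrite (lt_eqF xy) => /(_ isT).
  by rewrite /separated ltr0_norm ?subr_lt0// opprB; lra.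
by apply/allP => x; rewrite mem_sort.
Qed.

(** The points are paired consecutively and the mean value theorem is used inside each pair. A whole
    gap lies between successive pairs, so the new points are again [l] apart and the step can be
    iterated on the derivative. *)
Lemma halved_mean_values (f g : R -> R) (p q sig l : R) (m : nat) (s : seq R) : 0 < l ->
  (forall x, p < x < q -> is_derive x 1 f (g x)) ->
  (forall x, x \in s -> p < x < q /\ `|f x| <= sig) ->
  pairwise (fun x y => x + l <= y) s -> (m.*2 <= size s)%N ->
  exists s', [/\ size s' = m, pairwise (fun x y => x + l <= y) s',
    forall x, x \in s' -> p < x < q /\ `|g x| <= (2 / l) * sig &
    forall x, x \in s' -> exists2 y, y \in s & y < x].
Proof.
move=> l0 df; elim: m s => [|m IH] [|a [|b s]] hs ps //= ss; try by exists [::].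
move: ps => /= /andP[/andP[ab _] /andP[/allP bs ps]].
have hs' x : x \in s -> p < x < q /\ `|f x| <= sig.
  by move=> xs; apply: hs; rewrite !inE xs !orbT.
have [s' [ss' ps' gs' ys']] := IH s hs' ps ss.
have [/andP[pa aq] fa] := hs a (mem_head _ _).
have [/andP[pb bq] fb] : p < b < q /\ `|f b| <= sig by apply: hs; rewrite !inE eqxx orbT.
have alb : a < b by apply: lt_le_trans ab; rewrite ltrDl.
have [||c] := @MVT R f g a b alb.
- by move=> x; rewrite in_itv/= => /andP[ax xb]; apply: df; rewrite (lt_trans pa)// (lt_trans xb).
- apply: derivable_within_continuous => x; rewrite in_itv/= => /andP[ax xb].
  have : p < x < q by rewrite (lt_le_trans pa)// (le_lt_trans xb).
  by move=> /df/@ex_derive.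
rewrite in_itv/= => /andP[ac cb] fE.
exists (c :: s'); split => /=.
- by rewrite ss'.
- rewrite ps' andbT; apply/allP => x /ys'[y ys yx].
  have := bs _ ys; lra.
- move=> x; rewrite inE => /orP[/eqP->|/gs'//]; split.
    by rewrite (lt_trans pa)// (lt_trans cb).
  have ba0 : 0 < b - a by rewrite subr_gt0.
  have : `|g c| * (b - a) <= 2 * sig.
    rewrite -[b - a]gtr0_norm// -normrM -fE.
    by apply: (le_trans (ler_normB _ _)); lra.
  have : `|g c| * l <= `|g c| * (b - a) by rewrite ler_wpM2l//; lra.
  move=> h1 h2; rewrite mulrAC ler_pdivlMr//; lra.
- move=> x; rewrite inE => /orP[/eqP->|/ys'[y ys yx]].
    by exists a => //; rewrite mem_head.
  by exists y => //; rewrite !inE ys !orbT.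
Qed.

Lemma many_small_values (f : nat -> R -> R) (p q sig l : R) (k : nat) (s : seq R) :
  0 < l ->
  (forall j x, (j < k)%N -> p < x < q -> is_derive x 1 (f j) (f j.+1 x)) ->
  (forall x, x \in s -> p < x < q /\ `|f 0%N x| <= sig) ->
  pairwise (fun x y => x + l <= y) s -> (2 ^ k <= size s)%N ->
  exists2 x, p < x < q & `|f k x| <= (2 / l) ^+ k * sig.
Proof.
move=> l0; elim: k f sig s => [|k IH] f sig s df hs ps ss.
  case: s hs ss {ps} => // a s /(_ a (mem_head _ _))[h1 h2] _.
  by exists a; rewrite ?expr0 ?mul1r.
rewrite expnS mul2n in ss.
have [s' [ss' ps' gs' _]] := halved_mean_values l0 (fun x => df 0%N x isT) hs ps ss.
have [x xpq hx] := IH (fun j => f j.+1) _ _ (fun j x jk => df j.+1 x jk) gs' ps' (eq_leq (esym ss')).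
by exists x => //; apply: (le_trans hx); rewrite mulrA -exprSr.
Qed.

(** More than [2 ^ k] separated points would, after [k] halvings, give a point violating the lower
    bound on the last derivative. A maximal separated subset is therefore small, and it is the
    cover. *)
Lemma sublevel_cover (f : nat -> R -> R) (p q sig l c : R) (k : nat) : 0 < l ->
  (forall j x, (j < k)%N -> p < x < q -> is_derive x 1 (f j) (f j.+1 x)) ->
  (forall x, p < x < q -> c <= `|f k x|) -> (2 / l) ^+ k * sig < c ->
  exists s : seq R, (size s <= 2 ^ k)%N /\
    forall x, p < x < q -> `|f 0%N x| <= sig -> exists2 y, y \in s & `|x - y| <= l.
Proof.
move=> l0 df fk small.
have [|s [_ _ sN cov]] := @maximal_separated R (separated l)
  (fun x => p < x < q /\ `|f 0%N x| <= sig) (2 ^ k)%N.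
  move=> s ps hs; rewrite leqNgt; apply/negP => ss.
  have [|||x xpq] := @many_small_values f p q sig l k (sort <=%O s) l0 df.
  - by move=> x; rewrite mem_sort => /hs.
  - exact: separated_sort.
  - by rewrite size_sort ltnW.
  by apply/negP; rewrite -ltNge; apply: lt_le_trans small _; exact: fk.
exists s; split => // x xpq fx; have [y ys xy] := cov x (conj xpq fx).
by exists y => //; rewrite ltW// ltNge.
Qed.

End sublevel.

Section dot_product.
Context {R : realType} {d : nat}.
Implicit Types (v w : 'rV[R]_d).

Lemma dotpDl v v' w : dotp (v + v') w = dotp v w + dotp v' w.
Proof. by rewrite -big_split; apply: eq_bigr => i _; rewrite mxE mulrDl. Qed.

Lemma dotpZl a v w : dotp (a *: v) w = a * dotp v w.
Proof. by rewrite /dotp mulr_sumr; apply: eq_bigr => i _; rewrite mxE mulrA. Qed.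

Lemma dotpBl v v' w : dotp (v - v') w = dotp v w - dotp v' w.
Proof. by rewrite dotpDl -[- v']scaleN1r dotpZl mulN1r. Qed.

Lemma coord_le_norm v i : `|v 0 i| <= `|v|.
Proof.
rewrite [leRHS]/Num.norm /= mx_normrE; apply/bigmax_geP; right => /=.
by exists (0, i).
Qed.

Lemma norm_dotp_le v w : `|dotp v w| <= d%:R * `|v| * `|w|.
Proof.
rewrite /dotp; apply: (le_trans (ler_norm_sum _ _ _)).
rewrite -mulrA mulr_natl -[X in _ *+ X]card_ord -sumr_const.
by apply: ler_sum => i _; rewrite normrM; apply: ler_pM => //; exact: coord_le_norm.
Qed.

Lemma is_derive_dotp v (f : R -> 'rV[R]_d) x : derivable f x 1 ->
  is_derive x 1 (fun y => dotp v (f y)) (dotp v (derive1 f x)).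
Proof.
move=> df; rewrite derive1E derive_mx//.
have -> : (fun y => dotp v (f y)) = \sum_(i < d) (v 0 i *: (fun y => f y 0 i)).
  by apply/funext => y; rewrite fct_sumE.
rewrite [dotp _ _](_ : _ = \sum_(i < d) v 0 i *: 'D_1 (fun y => f y 0 i) x); last first.
  by apply: eq_bigr => i _; rewrite mxE.
apply: is_derive_sum => i; apply: is_deriveZ; apply: DeriveDef => //.
exact: (iffLR (derivable_mxP _ _ _) df).
Qed.

Lemma cvg_dotp (T : Type) (F : set_system T) (FF : Filter F)
    (f g : T -> 'rV[R]_d) v w :
  f x @[x --> F] --> v -> g x @[x --> F] --> w ->
  dotp (f x) (g x) @[x --> F] --> dotp v w.
Proof.
move=> fv gw; rewrite /dotp.
elim: (index_enum _) => [|i s IH].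
  rewrite big_nil; under eq_fun do rewrite big_nil; exact: cvg_cst.
rewrite big_cons; under eq_fun do rewrite big_cons.
apply: cvgD => //; apply: cvgM.
  exact: (@cvg_comp _ _ _ f (fun M : 'rV[R]_d => M 0 i) F _ _ fv
    (@coord_continuous R 1 d 0 i v)).
exact: (@cvg_comp _ _ _ g (fun M : 'rV[R]_d => M 0 i) F _ _ gw
  (@coord_continuous R 1 d 0 i w)).
Qed.

End dot_product.

Lemma size_flatten_le (I T : Type) (f : I -> seq T) (s : seq I) (b : nat) :
  (forall i, (size (f i) <= b)%N) -> (size (flatten [seq f i | i <- s]) <= size s * b)%N.
Proof.
move=> fb; elim: s => //= i s IH.
by rewrite size_cat mulSn leq_add.
Qed.

(** * Uniform transversality by compactness *)

Section transversality.
Context {R : realType} {d : nat}.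
Implicit Types (Q : R -> 'rV[R]_d) (v : 'rV[R]_d).

Definition regular_at Q (k : nat) (x : R) :=
  (\forall y \near x, forall j, (j <= k)%N -> derivable (derive1n j Q) y 1) /\
  {for x, continuous (derive1n k.+1 Q)}.

(** The single [M] controls the order, the radius and the lower bound, so the covering form of
    compactness, with [M] tending to infinity, yields one value for the whole sphere and hull. *)
Definition transversal_at Q (M : nat) (vx : 'rV[R]_d * R) := exists2 k, (k <= M)%N &
  forall y, `|y - vx.2| < M.+1%:R^-1 ->
    (forall j, (j <= k)%N -> derivable (derive1n j Q) y 1) /\
    M.+1%:R^-1 <= `|dotp vx.1 (derive1n k.+1 Q y)|.

Lemma near_transversal Q k v0 x0 : regular_at Q k x0 ->
  dotp v0 (derive1n k.+1 Q x0) != 0 ->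
  \forall vx \near (v0, x0) & M \near \oo, transversal_at Q M vx.
Proof.
move=> [/nbhs_ballP[e1 /= e10 he1] cQ] nz.
pose c := `|dotp v0 (derive1n k.+1 Q x0)|.
have c0 : 0 < c by rewrite normr_gt0.
have lim : `|dotp p.1 (derive1n k.+1 Q p.2)| @[p --> (v0, x0)] --> c.
  apply: cvg_norm; apply: cvg_dotp; first exact: cvg_fst.
  by apply: (@cvg_comp _ _ _ snd (derive1n k.+1 Q) _ (nbhs x0)); [exact: cvg_snd|exact: cQ].
have c2 : c / 2 < c by rewrite ltr_pdivrMr// ltr_pMr// ltr1n.
have := cvgr_gt _ lim _ c2; move=> [[A B]/= [/nbhs_ballP[e2 /= e20 hA] /nbhs_ballP[e3 /= e30 hB]] AB].
pose e := Num.min e1 e3.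
have e0 : 0 < e by rewrite lt_min e10.
have ec0 : 0 < Num.min (e / 2) (c / 2) by rewrite lt_min !divr_gt0.
have [N1 _ HN1] := near_infty_natSinv_lt (PosNum ec0).
exists ([set p : 'rV[R]_d * R | ball v0 e2 p.1 /\ ball x0 (e / 2) p.2],
  [set M | (N1 <= M)%N /\ (k <= M)%N]) => /=.
  split; last first.
    by exists (maxn N1 k) => // M /=; rewrite geq_max => /andP[].
  exists (ball v0 e2, ball x0 (e / 2)) => //=; split; apply: nbhsx_ballx => //=.
  by rewrite divr_gt0.
move=> [[v x] M] /= [[bv bx] [NM kM]].
have /= := HN1 M NM; rewrite lt_min => /andP[M1 M2].
exists k; [exact: kM|move=> y; rewrite [(_, _).2]/= => yx].
have yx0 : `|x0 - y| < e.
  rewrite (_ : x0 - y = (x0 - x) - (y - x)); last by ring.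
  apply: (le_lt_trans (ler_normB _ _)); rewrite [e]splitr.
  by apply: ltrD => //; apply: lt_trans M1.
split; first by apply: he1; rewrite /ball/=; apply: lt_le_trans yx0 _; rewrite ge_min lexx.
apply: ltW; apply: (lt_trans M2); apply: (AB (v, y)); split=> /=; first exact: hA.
by apply: hB; rewrite /ball/=; apply: lt_le_trans yx0 _; rewrite ge_min lexx orbT.
Qed.

Lemma uniform_transversal Q al be :
  (forall x v, x \in `[al, be] -> v != 0 ->
    exists2 k, regular_at Q k x & dotp v (derive1n k.+1 Q x) != 0) ->
  exists M, forall v x, `|v| = 1 -> x \in `[al, be] -> transversal_at Q M (v, x).
Proof.
move=> H.
have cS : compact [set v : 'rV[R]_d | `|v| = 1].
  apply: bounded_closed_compact.
    exists 1; split; first by rewrite num_real.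
    by move=> x x1 v /= ->; exact: ltW.
  rewrite (_ : [set v | _] = (fun v : 'rV[R]_d => `|v|) @^-1` [set 1]).
    apply: preimage_closed; last exact: closed_eq.
    by move=> v _; exact: norm_continuous.
  by [].
have cSK := compact_setX cS (@segment_compact R al be).
have [|M _ HM] := (iffLR (compact_near_coveringP _) cSK) nat \oo (transversal_at Q).
  move=> [v x] [/= v1 xK].
  have v0 : v != 0 by rewrite -normr_gt0 v1.
  have [k rk nz] := H x v xK v0.
  exact: near_transversal rk nz.
by exists M => v x v1 xK; apply: (HM M (leqnn M)).
Qed.

Lemma powR_root (s : R) (k : nat) : 0 < s < 1 ->
  exists r, [/\ 0 < r < 1, r ^+ k.+1 = s & r = s `^ (k.+1%:R^-1)].
Proof.
move=> /andP[s0 s1]; exists (s `^ (k.+1%:R^-1)).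
have r0 : 0 < s `^ (k.+1%:R^-1) by exact: powR_gt0.
have rk : (s `^ (k.+1%:R^-1)) ^+ k.+1 = s.
  by rewrite -powR_mulrn ?powR_ge0// -powRrM mulVf ?pnatr_eq0// powRr1// ltW.
split=> //; rewrite r0/= ltNge; apply/negP => r1.
by move: s1; rewrite -rk ltNge exprn_ege1.
Qed.

Lemma local_cover Q M v x s : transversal_at Q M (v, x) -> 0 < s -> s * M.+1%:R < 1 ->
  exists pts : seq R, (size pts <= 2 ^ M)%N /\
    forall y, `|y - x| < M.+1%:R^-1 -> `|dotp v (derive1n 1 Q y)| <= s ->
    exists2 z, z \in pts & `|y - z| <= 3 * (s * M.+1%:R) `^ (M.+1%:R^-1).
Proof.
move=> [k kM /= H] s0 sm; set m := M.+1%:R in H sm *.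
have m0 : 0 < m by rewrite /m ltr0n.
have sm01 : 0 < s * m < 1 by rewrite sm mulr_gt0.
(* The root of order [k.+1] includes the case [k = 0] and gives strictness: with
   [s * m = r ^+ k.+1], the quantity (2 / (3 r))^k * s equals (2/3)^k * r / m, less than [m^-1]. *)
have [r [/andP[r0 r1] rk rE]] := powR_root k sm01.
pose f j y := dotp v (derive1n j.+1 Q y).
have l0 : 0 < 3 * r by rewrite mulr_gt0.
have ballE y : x - m^-1 < y < x + m^-1 -> `|y - x| < m^-1 by rewrite ltr_distl.
have [|||pts [spts cov]] := @sublevel_cover R f (x - m^-1) (x + m^-1) s (3 * r) m^-1 k l0.
- move=> j y jk /ballE/H[dQ _]; rewrite /f.
  by have := is_derive_dotp v (dQ j.+1 jk); rewrite -derive1nS.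
- by move=> y /ballE/H[].
- rewrite -[ltRHS]mul1r ltr_pdivlMr// -mulrA -rk exprS [r * _]mulrC mulrA -exprMn.
  rewrite invfM mulrA divfK ?gt_eqF//.
  apply: le_lt_trans r1; rewrite ler_piMl ?(ltW r0)// exprn_ile1// ?divr_ge0//.
  by rewrite ler_pdivrMr// mul1r ler_nat.
exists pts; split; first by apply: (leq_trans spts); rewrite leq_exp2l.
move=> y yx fy; have [||z zp yz] := cov y; rewrite ?/f//.
  by rewrite -ltr_distl.
exists z => //; apply: (le_trans yz); rewrite ler_pM2l// rE.
have /andP[sm0 sm1] := sm01.
apply: ger_powR; first by rewrite sm0 ltW.
by rewrite lef_pV2 ?posrE ?ltr0n// ler_nat.
Qed.

Lemma sublevel_transversal Q al be : al < be ->
  (forall x v, x \in `[al, be] -> v != 0 ->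
    exists2 k, regular_at Q k x & dotp v (derive1n k.+1 Q x) != 0) ->
  exists N C c, [/\ 0 < C, 0 < c & forall v s, v != 0 -> 0 < s ->
    exists pts : seq R, (size pts <= N)%N /\
      forall x, x \in `[al, be] -> `|dotp v (derive1n 1 Q x)| <= s * `|v| ->
      exists2 y, y \in pts & `|x - y| <= C * s `^ c].
Proof.
move=> albe H; have [M HM] := uniform_transversal H.
set m : R := M.+1%:R.
have m0 : 0 < m by rewrite /m ltr0n.
pose G := (Num.truncn ((be - al) * m)).+1.
(* The summand [be - al] lets the single point [al] cover the hull when [s * m >= 1]. *)
pose C := (3 + (be - al)) * m `^ m^-1.
have ba0 : 0 < be - al by rewrite subr_gt0.
exists (G * 2 ^ M + 1)%N, C, m^-1; split.
- by rewrite mulr_gt0 ?powR_gt0// addr_gt0.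
- by rewrite invr_gt0.
move=> v s v0 s0.
have CE : C * s `^ m^-1 = (3 + (be - al)) * (s * m) `^ m^-1.
  by rewrite /C powRM ?(ltW m0) ?(ltW s0)//; ring.
have [sm|ms] := ltP (s * m) 1; last first.
  exists [:: al]; split; first by rewrite addn1.
  move=> x; rewrite in_itv/= => /andP[x1 x2] _; exists al; first exact: mem_head.
  rewrite ger0_norm ?subr_ge0// CE; apply: (@le_trans _ _ ((3 + (be - al)) * 1)).
    by rewrite mulr1; lra.
  rewrite ler_wpM2l//; first by rewrite addr_ge0// ltW.
  by rewrite -(powRr0 (s * m)); apply: ler_powR => //; rewrite invr_ge0 ltW.
have nv0 : 0 < `|v| by rewrite normr_gt0.
pose u := `|v|^-1 *: v.
have u1 : `|u| = 1 by rewrite normrZ normfV normr_id mulVf// gt_eqF.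
pose xi (i : nat) := al + i%:R / m.
have loc i : exists pts : seq R, (size pts <= 2 ^ M)%N /\ (xi i \in `[al, be] ->
    forall y, `|y - xi i| < m^-1 -> `|dotp u (derive1n 1 Q y)| <= s ->
    exists2 z, z \in pts & `|y - z| <= 3 * (s * m) `^ m^-1).
  have [xK|nK] := boolP (xi i \in `[al, be]); last by exists [::].
  have [pts [sp cp]] := local_cover (HM u _ u1 xK) s0 sm.
  by exists pts.
have [f hf] := choice loc.
exists (flatten [seq f i | i <- iota 0 G]); split.
  rewrite -[X in (X * _ + _)%N](size_iota 0).
  by apply: (leq_trans (size_flatten_le _ (fun i => (hf i).1))); rewrite leq_addr.
move=> x xK hx; pose i := Num.truncn ((x - al) * m).
move: (xK); rewrite in_itv/= => /andP[x1 x2].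
have xa0 : 0 <= (x - al) * m by rewrite mulr_ge0 ?subr_ge0// ltW.
have /andP[i1 i2] := truncn_itv xa0; rewrite -/i in i1 i2.
have xi1 : xi i <= x by rewrite /xi -lerBrDl ler_pdivrMr.
have xi2 : x - xi i < m^-1.
  rewrite /xi; move: i2; rewrite -natr1 -ltr_pdivlMr// mulrDl mul1r.
  by move: (i%:R / m) (m^-1) => A B; clear; lra.
have xiK : xi i \in `[al, be].
  by rewrite in_itv/= (le_trans xi1)// andbT /xi lerDl divr_ge0// ltW.
have [_ /(_ xiK) hi] := hf i.
have [||z zf xz] := hi x.
- by rewrite ger0_norm// subr_ge0.
- by rewrite /u dotpZl normrM normfV normr_id mulrC ler_pdivrMr.
exists z.
  apply/(@flattenP _ [seq f i | i <- iota 0 G]); exists (f i) => //.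
  apply: map_f; rewrite mem_iota/= add0n /G ltnS.
  by apply: le_truncn; rewrite ler_wpM2r ?(ltW m0)// lerB.
apply: (le_trans xz); rewrite CE ler_wpM2r ?powR_ge0//; lra.
Qed.

End transversality.

(** * Taylor bounds along the curve *)

Section taylor.
Context {R : realType} {d : nat}.
Implicit Types (Q : R -> 'rV[R]_d) (v : 'rV[R]_d).

Definition C2_at Q (x : R) := [/\ derivable Q x 1, derivable (derive1n 1 Q) x 1 &
  {for x, continuous (derive1n 2 Q)}].

Lemma between_mean_value (f g : R -> R) (al be x y : R) :
  (forall z, z \in `[al, be] -> is_derive z 1 f (g z)) ->
  x \in `[al, be] -> y \in `[al, be] ->
  exists c, [/\ c \in `[al, be], `|c - x| <= `|y - x| & f y - f x = g c * (y - x)].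
Proof.
move=> df.
have mvt a b : a <= b -> a \in `[al, be] -> b \in `[al, be] ->
    exists2 c, a <= c <= b & f b - f a = g c * (b - a).
  rewrite !in_itv/= => ab /andP[a1 a2] /andP[b1 b2].
  have sub z : z \in `[a, b] -> z \in `[al, be].
    by rewrite !in_itv/= => /andP[z1 z2]; rewrite (le_trans a1)// (le_trans z2).
  have dab z : z \in `]a, b[ -> is_derive z 1 f (g z).
    by rewrite in_itv/= => /andP[az zb]; apply: df; apply: sub; rewrite in_itv/= !ltW.
  have cf : {within `[a, b], continuous f}.
    by apply: derivable_within_continuous => z /sub/df/@ex_derive.
  have [c cab fE] := MVT_segment ab dab cf.
  by exists c; first by move: cab; rewrite in_itv.
move=> xK yK; have [xy|/ltW yx] := leP x y.
  have [c /andP[xc cy] fE] := mvt _ _ xy xK yK; exists c; split=> //.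
    move: xK yK; rewrite !in_itv/= => /andP[x1 x2] /andP[y1 y2].
    by rewrite (le_trans x1)// (le_trans cy).
  by rewrite !ger0_norm ?subr_ge0// lerD2r.
have [c /andP[yc cx] fE] := mvt _ _ yx yK xK; exists c; split.
- move: xK yK; rewrite !in_itv/= => /andP[x1 x2] /andP[y1 y2].
  by rewrite (le_trans y1)// (le_trans cx).
- by rewrite !ler0_norm ?subr_le0// lerN2 lerD2r.
- by rewrite -opprB fE -mulrN opprB.
Qed.

Lemma C1_lipschitz (f g : R -> R) (al be M : R) :
  (forall z, z \in `[al, be] -> is_derive z 1 f (g z)) ->
  (forall z, z \in `[al, be] -> `|g z| <= M) ->
  forall x y, x \in `[al, be] -> y \in `[al, be] -> `|f y - f x| <= M * `|y - x|.
Proof.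
move=> df gM x y xK yK; have [c [cK _ ->]] := between_mean_value df xK yK.
by rewrite normrM ler_wpM2r// gM.
Qed.

Lemma taylor2 (f g h : R -> R) (al be M : R) :
  (forall z, z \in `[al, be] -> is_derive z 1 f (g z)) ->
  (forall z, z \in `[al, be] -> is_derive z 1 g (h z)) ->
  (forall z, z \in `[al, be] -> `|h z| <= M) ->
  forall x y, x \in `[al, be] -> y \in `[al, be] ->
    `|f y - f x - (y - x) * g x| <= M * `|y - x| ^+ 2.
Proof.
move=> df dg hM x y xK yK; have [c [cK cx ->]] := between_mean_value df xK yK.
rewrite mulrC -mulrBr normrM expr2 mulrCA ler_wpM2l//.
apply: (le_trans (C1_lipschitz dg hM xK cK)); rewrite ler_wpM2l//.
by apply: le_trans (hM x xK).
Qed.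

Lemma curve_taylor Q (al be : R) : al < be ->
  (forall x, x \in `[al, be] -> C2_at Q x) ->
  exists M, [/\ 0 <= M,
    forall v x y, x \in `[al, be] -> y \in `[al, be] ->
      `|dotp v (Q y) - dotp v (Q x) - (y - x) * dotp v (derive1n 1 Q x)| <=
        M * `|v| * `|y - x| ^+ 2,
    forall v x y, x \in `[al, be] -> y \in `[al, be] ->
      `|dotp v (derive1n 1 Q y) - dotp v (derive1n 1 Q x)| <= M * `|v| * `|y - x| &
    forall v x, x \in `[al, be] -> `|dotp v (derive1n 1 Q x)| <= M * `|v|].
Proof.
move=> albe C2.
have bounded (F : R -> 'rV[R]_d) : (forall x, x \in `[al, be] -> {for x, continuous F}) ->
    exists M, 0 <= M /\ forall v x, x \in `[al, be] -> `|dotp v (F x)| <= M * `|v|.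
  move=> cF.
  have [||c cK Hc] := @EVT_max R (fun x => `|F x|) al be.
  - exact: ltW.
  - apply: continuous_in_subspaceT => x /set_mem xK.
    exact: (cvg_norm (cF x xK)).
  exists (d%:R * `|F c|); split; first by rewrite mulr_ge0.
  move=> v x xK; apply: (le_trans (norm_dotp_le _ _)).
  by rewrite mulrAC ler_wpM2r// ler_wpM2l// Hc.
have [M2 [M20 hM2]] : exists M, 0 <= M /\ forall v x, x \in `[al, be] ->
    `|dotp v (derive1n 2 Q x)| <= M * `|v|.
  by apply: bounded => x /C2[].
have [M1 [M10 hM1]] : exists M, 0 <= M /\ forall v x, x \in `[al, be] ->
    `|dotp v (derive1n 1 Q x)| <= M * `|v|.
  apply: bounded => x /C2[_ dQ _].
  by apply: differentiable_continuous; apply/derivable1_diffP.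
have d1 v z : z \in `[al, be] ->
    is_derive z 1 (fun y => dotp v (Q y)) (dotp v (derive1n 1 Q z)).
  by move=> /C2[dQ _ _]; exact: is_derive_dotp.
have d2 v z : z \in `[al, be] ->
    is_derive z 1 (fun y => dotp v (derive1n 1 Q y)) (dotp v (derive1n 2 Q z)).
  by move=> /C2[_ dQ _]; exact: is_derive_dotp.
exists (M1 + M2); split.
- by rewrite addr_ge0.
- move=> v x y xK yK; apply: (le_trans (taylor2 (d1 v) (d2 v) (hM2 v) xK yK)).
  by rewrite ler_wpM2r ?exprn_ge0// ler_wpM2r// lerDr.
- move=> v x y xK yK; apply: (le_trans (C1_lipschitz (d2 v) (hM2 v) xK yK)).
  by rewrite ler_wpM2r// ler_wpM2r// lerDr.
- by move=> v x xK; apply: (le_trans (hM1 v x xK)); rewrite ler_wpM2r// lerDl.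
Qed.

End taylor.

(** * The transform of the curve measure as an oscillatory integral *)

Section curve_fourier.
Context {R : realType} {d : nat}.
Implicit Types (Q : R -> 'rV[R]_d) (v : 'rV[R]_d) (U : set R).

Lemma measurable_restrict_continuous U Q : open U ->
  (forall x, U x -> {for x, continuous Q}) -> measurable_fun setT (Q \_ U).
Proof.
move=> oU cQ; apply: (@measurability _ _ _ _ setT (Q \_ U) (@open 'rV[R]_d)) => //.
move=> _ [A oA <-]; rewrite setTI.
have oUA : open (U `&` Q @^-1` A).
  rewrite openE => x [Ux Ax]; apply: filterI; first exact: open_nbhs_nbhs.
  by apply: (cQ x Ux); exact: open_nbhs_nbhs.
have -> : (Q \_ U) @^-1` A = (U `&` Q @^-1` A) `|` (~` U `&` [set x | A point]).
  apply/seteqP; split => x /=; rewrite /patch.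
      case: ifPn => [/set_mem Ux ?|/negP nUx ?]; [by left|right; split=> //].
    by move=> Ux; apply: nUx; rewrite inE.
  move=> [[Ux Ax]|[nUx Ap]]; first by rewrite mem_set.
  by case: ifPn => // /set_mem.
apply: measurableU; first exact: open_measurable.
apply: measurableI; first by apply: measurableC; exact: open_measurable.
by have [Ap|nAp] := pselect (A point); [rewrite (_ : [set x | _] = setT)|
  rewrite (_ : [set x | _] = set0)]; rewrite //; apply/seteqP; split.
Qed.

Lemma measurable_dotp v : measurable_fun [set: 'rV[R]_d] (dotp v).
Proof.
apply: (measurability _ (RGenOpens.measurableE R)).
move=> _ [_ [a [b ->] <-]]; rewrite setTI; apply: sub_sigma_algebra.
apply: open_comp (interval_open _ _) => // w _.
by apply: (@cvg_dotp _ _ _ (nbhs w) _ (cst v) id); [exact: cvg_cst|exact: cvg_id].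
Qed.

Lemma normc_fourier (mu : probability R R) U Q v :
  measurable_fun setT (Q \_ U) ->
  Normc.normc (fourier (curve_measure mu U Q) v) =
  osc mu (fun x => 2 * pi * dotp v ((Q \_ U) x)).
Proof.
move=> mQ.
have mph : measurable_fun [set: R] (fun x => 2 * pi * dotp v ((Q \_ U) x)).
  apply: measurable_funM => //; apply: (@measurableT_comp _ _ _ _ _ _ (dotp v)) => //.
  exact: measurable_dotp.
have mlin : measurable_fun [set: 'rV[R]_d] (fun w => 2 * pi * dotp v w).
  by apply: measurable_funM => //; exact: measurable_dotp.
have int (f : R -> R) : measurable_fun setT f ->
    bmeas (fun x => f (2 * pi * dotp v ((Q \_ U) x))) ->
    fine (\int[curve_measure mu U Q]_x (f (2 * pi * dotp v x))%:E) =
    expect mu (fun x => f (2 * pi * dotp v ((Q \_ U) x))).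
  move=> mf bf; rewrite /curve_measure integral_pushforward//.
  - apply: measurableT_comp => //.
    by apply: (@measurableT_comp _ _ _ _ _ _ f).
  - by rewrite preimage_setT; exact: bmeas_integrable.
rewrite /fourier /Normc.normc /osc !int//.
- by apply: continuous_measurable_fun; exact: continuous_sin.
- exact: bmeas_sin.
- by apply: continuous_measurable_fun; exact: continuous_cos.
- exact: bmeas_cos.
Qed.

End curve_fourier.

(** * Pigeonhole in cells, and words of a given scale *)

Section pigeonhole.
Context {R : realType}.

Lemma same_cell (x y rho : R) : 0 < rho -> (0 <= x) = (0 <= y) ->
  Num.truncn (`|x| / rho) = Num.truncn (`|y| / rho) -> `|x - y| <= rho.
Proof.
move=> rho0 xy tE.
have x0 : 0 <= `|x| / rho by rewrite divr_ge0// ltW.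
have y0 : 0 <= `|y| / rho by rewrite divr_ge0// ltW.
have /andP[x1 x2] := truncn_itv x0; have /andP[y1 y2] := truncn_itv y0.
rewrite tE in x1 x2; move: x1 x2 y1 y2.
rewrite !ler_pdivlMr// !ltr_pdivrMr// -natr1 mulrDl mul1r.
move: xy; case: (ltP x 0) => [xn /esym/negbT|xp /esym].
  rewrite -ltNge => yn; rewrite (ltr0_norm xn) (ltr0_norm yn) ler_norml => *.
  by apply/andP; split; lra.
move=> yp; rewrite (ger0_norm xp) (ger0_norm yp) ler_norml => *.
by apply/andP; split; lra.
Qed.

Lemma sum_fiber (I J : eqType) (s : seq I) (r : seq J) (j : I -> J) (u : J -> R) :
  uniq r -> (forall v, v \in s -> j v \in r) ->
  \sum_(v <- s) u (j v) = \sum_(c <- r) (count (fun v => j v == c) s)%:R * u c.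
Proof.
move=> ur js.
have -> : \sum_(v <- s) u (j v) = \sum_(v <- s) \sum_(c <- r) (if j v == c then u c else 0).
  rewrite big_seq [RHS]big_seq; apply: eq_bigr => k ks.
  rewrite -big_mkcond/= (eq_bigl (fun i => i == j k)); last by move=> i; rewrite eq_sym.
  by rewrite -big_filter filter_pred1_uniq ?js// big_seq1.
rewrite exchange_big/=; apply: eq_bigr => c _.
rewrite -big_mkcond/= -sum1_count natr_sum mulr_suml.
by apply: eq_bigr => v _; rewrite mul1r.
Qed.

(** Cauchy-Schwarz for the occupation numbers of the cells: the double sum, counting the pairs that
    share a cell, is the sum of their squares. *)
Lemma pigeonhole_sqr (I J : eqType) (s : seq I) (r : seq J) (j : I -> J) :
  uniq r -> (forall v, v \in s -> j v \in r) ->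
  (size s)%:R ^+ 2 <=
  (size r)%:R * \sum_(v <- s) \sum_(w <- s) (j v == j w)%:R :> R.
Proof.
move=> ur js; pose n c : R := (count (fun v => j v == c) s)%:R.
have sE : (size s)%:R = \sum_(c <- r) 1 * n c :> R.
  have := sum_fiber (fun=> 1) ur js; rewrite big_const_seq count_predT iter_addr_0 => ->.
  by apply: eq_bigr => c _; rewrite mulr1 mul1r.
have pE : \sum_(v <- s) \sum_(w <- s) (j v == j w)%:R = \sum_(c <- r) 1 * n c ^+ 2.
  rewrite [RHS](_ : _ = \sum_(c <- r) n c * n c); last first.
    by apply: eq_bigr => c _; rewrite mul1r expr2.
  rewrite -(sum_fiber n ur js); apply: eq_bigr => v _.
  rewrite /n -sum1_count natr_sum [RHS]big_mkcond/=; apply: eq_bigr => w _.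
  by rewrite eq_sym; case: eqP.
rewrite sE pE; have [r0|r0] := eqVneq (size r) 0%N.
  by rewrite (size0nil r0) !big_nil mulr0 expr0n.
have -> : (size r)%:R = (\sum_(c <- r) 1) ^+ 1 :> R.
  by rewrite expr1 big_const_seq count_predT iter_addr_0.
apply: power_mean => //.
by rewrite big_const_seq count_predT iter_addr_0 ltr0n lt0n.
Qed.

End pigeonhole.

Section scales.
Context {R : realType} (mu : probability R R).
Implicit Types L B : seq (R * R * R).

Lemma words_at_scale B : represents mu B -> (forall t, t \in B -> `|t.1.2| < 1) ->
  exists2 a : R, 0 < a & forall r, 0 < r <= 1 -> exists L, represents mu L /\
    forall t, t \in L -> a * r <= `|t.1.2| <= r.
Proof.
move=> rB aB; case: (rB) => B0 B1 BE.
have [a2 /andP[a20 a21] Ha2] := seq_ubound_lt ltr01 aB.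
have [a' a'0 Ha'] : exists2 m, 0 < m & forall t, t \in B -> m <= `|t.1.2|.
  by apply: seq_lbound_gt => t /B0[_]; rewrite normr_gt0.
pose a := Num.min a' 1.
have a0 : 0 < a by rewrite lt_min a'0 ltr01.
exists a => // r /andP[r0 r1].
have [n hn] : exists n, a2 ^+ n < r by apply: exprn_small; rewrite // ltW.
(* Only words still longer than [r] are refined. After [k] rounds a word has either stopped or
   contracts by at most [a2 ^+ k], and [n] rounds bring this below [r]. *)
suff [L [rL HL]] : exists L, represents mu L /\ forall t, t \in L ->
    a * r <= `|t.1.2| /\ (`|t.1.2| <= r \/ `|t.1.2| <= a2 ^+ n).
  exists L; split=> // t /HL[-> [->//|h]]; by rewrite (le_trans h)// ltW.
elim: (n) => [|k [L [rL HL]]].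
  exists [:: (1, 1, 0)]; split; first exact: represents_id.
  move=> t; rewrite inE => /eqP->/=; rewrite normr1 expr0; split; last by right.
  by rewrite -[leRHS]mulr1 ler_pM ?(ltW a0) ?(ltW r0)// ge_min lexx orbT.
exists (refine (fun t => r < `|t.1.2|) B L); split; first exact: represents_refine.
move=> t /flattenP[s /mapP[u uL ->]]; have [u1 u2] := HL _ uL.
case: ltP => ur.
  move=> /mapP[v vB ->]/=; rewrite normrM; split.
    rewrite mulrC ler_pM ?(ltW a0) ?(ltW r0)//; first exact: ltW.
    by apply: le_trans (Ha' _ vB); rewrite ge_min lexx.
  right; rewrite exprSr; apply: ler_pM => //; last exact: Ha2.
  by case: u2 => // /(lt_le_trans ur); rewrite ltxx.
by rewrite inE => /eqP->; split => //; left.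
Qed.

Lemma osc_addr_cst (phi : R -> R) c : measurable_fun [set: R] phi ->
  osc mu (fun x => phi x + c) <= osc mu phi.
Proof.
move=> mphi; have [t <-] : exists t, expect mu (fun x => cos (phi x + c - t)) =
    osc mu (fun x => phi x + c).
  by apply: osc_attained; exact: measurable_funD.
rewrite (_ : (fun x => _) = fun x => cos (phi x - (t - c))).
  exact: expect_cos_le_osc.
by apply/funext => x; congr cos; ring.
Qed.

End scales.

(** The last hypothesis bounds the term quadratic in [N] on the right by half of the left side,
    where it is absorbed. *)
Lemma count_arith (R : realFieldType) (N n X tau : R) : 0 < N ->
  (N * (tau / 2)) ^+ 2 <= 2 * n * (N + N ^+ 2 * X) -> 16 * n * X <= tau ^+ 2 ->
  N * tau ^+ 2 <= 16 * n.
Proof.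
move=> Np h hX; rewrite -(ler_pM2l Np).
have h2 : N ^+ 2 * (16 * n * X) <= N ^+ 2 * tau ^+ 2 by rewrite ler_wpM2l// sqr_ge0.
have -> : N * (N * tau ^+ 2) = 4 * (N * (tau / 2)) ^+ 2 by field.
have : (N * (tau / 2)) ^+ 2 = N ^+ 2 * tau ^+ 2 / 4 by field.
move: h h2; rewrite mulrDr; move: ((N * (tau / 2)) ^+ 2) (N ^+ 2 * tau ^+ 2) => A B.
have -> : 2 * n * (N ^+ 2 * X) = N ^+ 2 * (16 * n * X) / 8 by field.
have -> : N * (16 * n) = 8 * (2 * n * N) by ring.
move: (N ^+ 2 * (16 * n * X)) (2 * n * N) => Y Z; lra.
Qed.

(** * Counting separated large frequencies *)

Section core.
Context {R : realType} {d : nat} (mu : probability R R) (al be : R) (hull : is_hull mu al be).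
Context (G G' : R -> 'rV[R]_d).
Context (mG : forall v, measurable_fun [set: R] (fun x => dotp v (G x))).
Context (M : R) (M0 : 0 <= M).
Context (taylorG : forall v x y, x \in `[al, be] -> y \in `[al, be] ->
      `|dotp v (G y) - dotp v (G x) - (y - x) * dotp v (G' x)| <=
        M * `|v| * `|y - x| ^+ 2).
Context (lipG' : forall v x y, x \in `[al, be] -> y \in `[al, be] ->
      `|dotp v (G' y) - dotp v (G' x)| <= M * `|v| * `|y - x|).
Context (bndG' : forall v x, x \in `[al, be] -> `|dotp v (G' x)| <= M * `|v|).

Definition curve_ft (v : 'rV[R]_d) : R := osc mu (fun x => 2 * pi * dotp v (G x)).

Let D := be - al.
(** The expansion point is the image of the endpoint [al]; it lies in the hull, the only place where
    [G] is controlled. *)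
Let base (t : R * R * R) := t.1.2 * al + t.2.
Let slope (t : R * R * R) v := t.1.2 * dotp v (G' (base t)).

Let alK : al \in `[al, be].
Proof. by case: hull => albe _ _; rewrite in_itv/= lexx ltW. Qed.

Let D0 : 0 < D.
Proof. by case: hull => albe _ _; rewrite subr_gt0. Qed.

Lemma measurable_phase v : measurable_fun [set: R] (fun x => 2 * pi * dotp v (G x)).
Proof. exact: measurable_funM. Qed.

Lemma curve_ft_approx L r v : represents mu L ->
  (forall t, t \in L -> `|t.1.2| <= r) ->
  curve_ft v <= \sum_(t <- L) t.1.1 * ft mu (slope t v) +
    2 * pi * (M * `|v| * (r * D) ^+ 2).
Proof.
move=> rL Lr; have hK := represents_hull rL hull; case: (rL) => L0 L1 LE.
apply: (le_trans (osc_le_represents rL (measurable_phase v))).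
set err := 2 * pi * (M * _ * _).
have -> : err = \sum_(t <- L) t.1.1 * err by rewrite -mulr_suml L1 mul1r.
rewrite -big_split/= big_seq [leRHS]big_seq; apply: ler_sum => t tL; rewrite -mulrDr.
have [q0 _] := L0 _ tL; rewrite (ler_wpM2l (ltW q0))//.
pose k := 2 * pi * (dotp v (G (base t)) - slope t v * al).
apply: (@le_trans _ _ (osc mu (fun x => 2 * pi * slope t v * x + k) +
    err)); last first.
  by rewrite lerD2r; apply: osc_addr_cst; exact: measurable_linear.
case: hull => albe K1 _.
apply: (osc_le_near (A := `[al, be]%classic) _ K1) => //.
- apply: (@measurableT_comp _ _ _ _ _ _ (fun x => 2 * pi * dotp v (G x))).
    exact: measurable_phase.
  exact: measurable_affine.
- by apply: measurable_funD => //; exact: measurable_linear.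
move=> x /= xK.
have bK : base t \in `[al, be] by exact: hK t tL al alK.
have fK := hK t tL x xK.
have fb : t.1.2 * x + t.2 - base t = t.1.2 * (x - al) by rewrite /base; ring.
rewrite (_ : _ - _ = 2 * pi * (dotp v (G (t.1.2 * x + t.2)) - dotp v (G (base t)) -
    (t.1.2 * x + t.2 - base t) * dotp v (G' (base t)))); last first.
  by rewrite fb /k /slope; ring.
rewrite normrM ger0_norm; last by rewrite mulr_ge0// ltW// pi_gt0.
rewrite ler_wpM2l//; first by rewrite mulr_ge0// ltW// pi_gt0.
apply: (le_trans (taylorG v bK fK)); rewrite fb.
rewrite ler_wpM2l ?mulr_ge0// lerXn2r ?nnegrE//.
  by rewrite mulr_ge0 ?(ltW D0)// (le_trans _ (Lr _ tL)).
rewrite normrM ler_pM// ?Lr//.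
move: xK; rewrite in_itv/= => /andP[x1 x2].
by rewrite ger0_norm ?subr_ge0// lerD2r.
Qed.

(** Of [tau], one quarter is lost to linearisation and at most one quarter to words with small
    transform; the rest is carried by the other words, whose transform is at most 1. *)
Lemma good_weight L r v tau : represents mu L ->
  (forall t, t \in L -> `|t.1.2| <= r) -> tau <= curve_ft v ->
  2 * pi * (M * `|v| * (r * D) ^+ 2) <= tau / 4 -> 0 <= tau ->
  tau / 2 <= \sum_(t <- L | tau / 4 <= ft mu (slope t v)) t.1.1.
Proof.
move=> rL Lr tv err tau0; have := le_trans tv (curve_ft_approx v rL Lr).
case: (rL) => L0 L1 LE.
have : \sum_(t <- L) t.1.1 * ft mu (slope t v) <=
    \sum_(t <- L | tau / 4 <= ft mu (slope t v)) t.1.1 + tau / 4.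
  rewrite [X in _ <= _ + X](_ : _ = \sum_(t <- L) t.1.1 * (tau / 4)); last first.
    by rewrite -mulr_suml L1 mul1r.
  rewrite [X in _ <= X + _]big_mkcond -big_split/= big_seq [leRHS]big_seq; apply: ler_sum => t tL; have [q0 _] := L0 _ tL.
  case: ifPn => [_|]; last first.
    by rewrite -ltNge => h; rewrite add0r (ler_wpM2l (ltW q0))// ltW.
  rewrite -[leLHS]addr0 lerD// ?mulr_ge0 ?(ltW q0)// ?divr_ge0//.
  by rewrite ler_piMr ?(ltW q0)// ft_le1.
move: err; set a := 2 * pi * _; set b := \sum_(t <- L) t.1.1 * ft mu (slope t v).
by set c := \sum_(t <- L | _) _; move: a b c => a b c; lra.
Qed.

(* For v a difference of two frequencies: they rarely share a cell of size rho. *)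
Lemma close_slopes_weight L r a rho v (s C c : R) : represents mu L ->
  (forall t, t \in L -> a * r <= `|t.1.2| <= r) -> 0 < a -> 0 < r ->
  rho / (a * r) + M * `|v| * (r * D) <= s * `|v| ->
  (exists2 A : set R, measurable A /\ expect mu (\1_A) <= C * s `^ c &
    forall x, x \in `[al, be] -> `|dotp v (G' x)| <= s * `|v| -> A x) ->
  \sum_(t <- L | `|slope t v| <= rho) t.1.1 <= C * s `^ c.
Proof.
move=> rL Lr a0 r0 hs [A [mA EA] hA]; apply: le_trans EA.
have hK := represents_hull rL hull; case: (rL) => L0 L1 LE.
case: hull => albe K1 _.
rewrite LE; last exact: bmeas_indic.
rewrite big_mkcond big_seq [leRHS]big_seq; apply: ler_sum => t tL.
have [q0 _] := L0 _ tL.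
case: ifP => [small|_]; last first.
  by rewrite mulr_ge0 ?(ltW q0)// expect_ge0.
(* A small slope at the base point makes the derivative small on the whole image of the hull, so the
   word maps the hull into [A]. By self-similarity the weight of such words is at most the mass of
   [A]. *)
rewrite -[leLHS]mulr1 (ler_wpM2l (ltW q0))// -[leLHS](expect_cst mu).
apply: (expect_le_on (A := `[al, be]%classic) _ K1) => //.
- exact: bmeas_cst.
- apply: (@bmeas_affine R (\1_A) t.1.2 t.2); exact: bmeas_indic.
move=> x /= xK; rewrite indicE mem_set//; apply: hA; first exact: hK.
apply: le_trans hs.
have bK : base t \in `[al, be] by exact: hK.
have fK := hK t tL x xK.
have /andP[t1 t2] := Lr _ tL.
have ar0 : 0 < a * r by rewrite mulr_gt0.
have h1 : `|dotp v (G' (base t))| <= rho / (a * r).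
  rewrite ler_pdivlMr//; apply: le_trans small; rewrite /slope normrM mulrC.
  by rewrite ler_wpM2r.
have h2 := lipG' v bK fK.
have h3 : `|t.1.2 * x + t.2 - base t| <= r * D.
  rewrite (_ : _ - _ = t.1.2 * (x - al)); last by rewrite /base; ring.
  rewrite normrM ler_pM//.
  move: xK; rewrite in_itv/= => /andP[x1 x2].
  by rewrite ger0_norm ?subr_ge0// lerD2r.
rewrite -[dotp v _](subrK (dotp v (G' (base t)))).
apply: (le_trans (ler_normD _ _)); rewrite addrC lerD//.
by apply: (le_trans h2); rewrite ler_wpM2l// mulr_ge0.
Qed.

Lemma core_count L r a rho tau Rad (cells : seq nat) (s l C c : R) (S : seq 'rV[R]_d) :
  represents mu L -> (forall t, t \in L -> a * r <= `|t.1.2| <= r) ->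
  0 < a -> 0 < r -> 0 < tau -> 0 < l -> 0 < rho ->
  uniq cells ->
  (forall t, `|t| <= r * (M * Rad) -> tau / 4 <= ft mu t ->
     Num.truncn (`|t| / rho) \in cells) ->
  2 * pi * (M * Rad * (r * D) ^+ 2) <= tau / 4 ->
  rho / (a * r) / l + M * (r * D) <= s ->
  0 <= C -> (forall v, v != 0 -> exists2 A : set R, measurable A /\ expect mu (\1_A) <= C * s `^ c &
    forall x, x \in `[al, be] -> `|dotp v (G' x)| <= s * `|v| -> A x) ->
  16 * (size cells)%:R * (C * s `^ c) <= tau ^+ 2 ->
  uniq S -> (forall v w, v \in S -> w \in S -> v != w -> l <= `|v - w|) ->
  (forall v, v \in S -> `|v| <= Rad /\ tau <= curve_ft v) ->
  (size S)%:R * tau ^+ 2 <= 16 * (size cells)%:R.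
Proof.
move=> rL Lr a0 r0 tau0 l0 rho0 uc hc err hs C0 hA hsmall uS sepS hS.
have hK := represents_hull rL hull; case: (rL) => L0 L1 LE.
set N : R := (size S)%:R.
have N0 : 0 <= N by rewrite /N.
set n : R := (size cells)%:R.
have n0 : 0 <= n by rewrite /n.
have Lr2 t : t \in L -> `|t.1.2| <= r by move=> /Lr/andP[].
have bK t : t \in L -> base t \in `[al, be] by move=> tL; exact: hK.
pose good t v := tau / 4 <= ft mu (slope t v).
pose St t := [seq v <- S | good t v].
pose cell t v := (0 <= slope t v, Num.truncn (`|slope t v| / rho)).
(* Cells index absolute values, so the sign of the slope is recorded too; this doubles their
   number. *)
pose r2 := [seq (b, k) | b <- [:: true; false], k <- cells].
have ur2 : uniq r2 by rewrite allpairs_uniq// => -[? ?] [? ?] _ _.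
have sr2 : (size r2)%:R = 2 * n :> R by rewrite size_allpairs natrM.
have cellP t v : t \in L -> v \in St t -> cell t v \in r2.
  move=> tL; rewrite mem_filter => /andP[g vS].
  apply/allpairsP; exists (cell t v); split => //=.
    by rewrite !inE; case: (_ <= _).
  have [vR _] := hS _ vS.
  apply: hc => //; rewrite /slope normrM; apply: ler_pM => //; first exact: Lr2.
  by apply: (le_trans (bndG' _ (bK _ tL))); rewrite ler_wpM2l.
pose P t : R := \sum_(v <- St t) \sum_(w <- St t) (cell t v == cell t w)%:R.
have hP t : t \in L -> (size (St t))%:R ^+ 2 <= 2 * n * P t.
  by move=> tL; rewrite -sr2; apply: pigeonhole_sqr => // v; exact: cellP.
have low : N * (tau / 2) <= \sum_(t <- L) t.1.1 * (size (St t))%:R.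
  have -> : \sum_(t <- L) t.1.1 * (size (St t))%:R =
      \sum_(v <- S) \sum_(t <- L | good t v) t.1.1.
    rewrite (exchange_big_dep predT)//=; apply: eq_bigr => t _.
    by rewrite size_filter -sum1_count natr_sum mulr_sumr; apply: eq_bigr => v _; rewrite mulr1.
  rewrite /N -sum1_size natr_sum mulr_suml big_seq [leRHS]big_seq; apply: ler_sum => v vS.
  have [vR tv] := hS _ vS.
  rewrite mul1r; apply: (good_weight rL Lr2 tv _ (ltW tau0)).
  apply: le_trans err; rewrite ler_wpM2l//; first by rewrite mulr_ge0// ltW// pi_gt0.
  by rewrite ler_wpM2r ?sqr_ge0// ler_wpM2l.
have sq : (N * (tau / 2)) ^+ 2 <= 2 * n * \sum_(t <- L) t.1.1 * P t.
  apply: (@le_trans _ _ ((\sum_(t <- L) t.1.1 * (size (St t))%:R) ^+ 2)).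
    rewrite lerXn2r ?nnegrE//; first by rewrite mulr_ge0 ?divr_ge0 ?(ltW tau0).
    by apply: le_trans low; rewrite mulr_ge0 ?divr_ge0 ?(ltW tau0).
  apply: (@le_trans _ _ (\sum_(t <- L) t.1.1 * (size (St t))%:R ^+ 2)).
    have := @power_mean R _ L (fun t => t.1.1) (fun t => (size (St t))%:R) 1.
    rewrite L1 expr1 mul1r; apply=> //.
    by move=> t /L0[/ltW].
  rewrite mulr_sumr big_seq [leRHS]big_seq; apply: ler_sum => t tL.
  by have [q0 _] := L0 _ tL; rewrite [leRHS]mulrCA (ler_wpM2l (ltW q0))// hP.
have up : \sum_(t <- L) t.1.1 * P t <= N + N ^+ 2 * (C * s `^ c).
  (* With the word summed innermost, a diagonal pair weighs at most 1, which gives [N], and an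
     off-diagonal pair at most the weight of the words with a small slope at [v - w]. *)
  apply: (@le_trans _ _ (\sum_(v <- S) \sum_(w <- S)
      \sum_(t <- L | `|slope t (v - w)| <= rho) t.1.1)).
    under [leRHS]eq_bigr => v _ do rewrite (exchange_big_dep predT)//=.
    rewrite exchange_big/= big_seq [leRHS]big_seq; apply: ler_sum => t tL.
    have [q0 _] := L0 _ tL.
    rewrite mulr_sumr big_filter big_mkcond/=; apply: ler_sum => v _.
    case: ifPn => _; last first.
      by rewrite sumr_ge0// => w _; exact: ltW.
    rewrite mulr_sumr big_filter big_mkcond/= [leRHS]big_mkcond/=; apply: ler_sum => w _.
    case: (boolP (_ <= rho)) => [_|far].
      by case: ifPn => _; rewrite ?(ltW q0)// ler_piMr ?(ltW q0)// lern1 leq_b1.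
    have -> : (cell t v == cell t w) = false.
      apply/negbTE; apply: contraNN far => /eqP[h1 h2].
      rewrite [slope t (v - w)](_ : _ = slope t v - slope t w).
        exact: same_cell.
      by rewrite /slope dotpBl mulrBr.
    by rewrite mulr0; case: ifP.
  rewrite expr2 -mulrA -[X in _ <= X + _]mulr1 -mulrDr /N -sum1_size natr_sum mulr_suml.
  rewrite big_seq [leRHS]big_seq; apply: ler_sum => v vS; rewrite mul1r mulr_suml.
  have {1}-> : 1 = \sum_(w <- S) (w == v)%:R :> R.
    rewrite (big_rem v)//= eqxx big_seq big1 ?addr0// => w.
    by rewrite mem_rem_uniq// inE => /andP[/negbTE->].
  rewrite -big_split/= big_seq [leRHS]big_seq; apply: ler_sum => w wS; rewrite mul1r.
  have Cs0 : 0 <= C * s `^ c by rewrite mulr_ge0// powR_ge0.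
  have [->|wv] := eqVneq w v.
    apply: (@le_trans _ _ 1); last by rewrite lerDl.
    rewrite -L1 big_mkcond big_seq [leRHS]big_seq; apply: ler_sum => t /L0[q0 _].
    by case: ifP => // _; exact: ltW.
  rewrite add0r; have vw : l <= `|v - w| by apply: sepS; rewrite // eq_sym.
  have nz : v - w != 0 by rewrite subr_eq0 eq_sym.
  apply: (close_slopes_weight rL Lr a0 r0 _ (hA _ nz)).
  apply: (@le_trans _ _ ((rho / (a * r) / l + M * (r * D)) * `|v - w|)); last first.
    by rewrite ler_wpM2r.
  rewrite mulrDl; apply: lerD; last by rewrite mulrAC.
  rewrite -mulrA ler_peMr ?divr_ge0 ?mulr_ge0 ?(ltW a0) ?(ltW r0) ?(ltW rho0)//.
  by rewrite mulrC ler_pdivlMr// mul1r.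
move: hsmall; set X := C * s `^ c => hX.
have [->|Nz] := eqVneq N 0; first by rewrite mul0r mulr_ge0.
have Np : 0 < N by rewrite lt_def Nz.
have h : (N * (tau / 2)) ^+ 2 <= 2 * n * (N + N ^+ 2 * X).
  by apply: (le_trans sq); rewrite ler_wpM2l// mulr_ge0.
exact: count_arith Np h hX.
Qed.

End core.

Section real_powers.
Context {R : realType}.
Implicit Types x : R.

Lemma powRDp x a b : 0 < x -> x `^ (a + b) = x `^ a * x `^ b.
Proof. by move=> x0; apply: powRD; rewrite (gt_eqF x0) /= implybT. Qed.

Lemma powRXn x a n : (x `^ a) ^+ n = x `^ (a * n%:R).
Proof. by rewrite powRrM powR_mulrn ?powR_ge0. Qed.

Lemma powR_ge1 x a : 1 <= x -> 0 <= a -> 1 <= x `^ a.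
Proof. by move=> x1 a0; rewrite -(powRr0 x) ler_powR. Qed.

Lemma powR_large (K a : R) : 0 < a -> exists2 x0, 1 <= x0 & forall x, x0 <= x -> K <= x `^ a.
Proof.
move=> a0; exists (Num.max 1 (Num.max K 1 `^ a^-1)); first by rewrite le_max lexx.
move=> x; rewrite ge_max => /andP[x1 xK]; apply: (@le_trans _ _ (Num.max K 1)).
  by rewrite le_max lexx.
have m0 : 0 <= Num.max K 1 by rewrite le_max ler01 orbT.
rewrite [leLHS](_ : _ = (Num.max K 1 `^ a^-1) `^ a); last first.
  by rewrite -powRrM mulVf ?gt_eqF// powRr1.
by apply: (ge0_ler_powR (ltW a0)); rewrite ?nnegrE ?powR_ge0// (le_trans ler01).
Qed.

End real_powers.

Lemma exponent_arith1 (R : realFieldType) (eta del p : R) :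
  del * p + del * 2 <= eta / 4 -> 2 * (eta / 8) + del * p + 2 * del <= eta / 2.
Proof. lra. Qed.

Lemma exponent_arith2 (R : realFieldType) (c e eta del : R) :
  e + 2 * del <= eta / 2 -> eta <= c -> c / 2 + (e + - c) <= - del * 2.
Proof. lra. Qed.

Lemma exponent_arith3 (R : realFieldType) (k e eta del : R) :
  e + 2 * del <= eta / 2 -> eta <= k -> k / 2 + (e + - (- del * 2)) <= k.
Proof. lra. Qed.

Section thin.
Context {R : realType} (mu : probability R R).

Lemma cover_mass (C c : R) (pts : seq R) (l : R) : 0 < l ->
  (forall x s, 0 < s -> expect mu (\1_(`[x - s, x + s])) <= C * s `^ c) ->
  exists A : set R, [/\ measurable A, expect mu (\1_A) <= (size pts)%:R * (C * l `^ c) &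
    forall x y, y \in pts -> `|x - y| <= l -> A x].
Proof.
move=> l0 fr; elim: pts => [|y pts [A [mA EA HA]]].
  exists set0; split=> //; rewrite mul0r (_ : \1_set0 = cst 0) ?expect_cst//.
  by apply/funext => x; rewrite indicE in_set0.
have mI : measurable `[y - l, y + l]%classic by exact: measurable_itv.
exists (`[y - l, y + l]%classic `|` A); split.
- exact: measurableU.
- rewrite /= -natr1 mulrDl mul1r [leRHS]addrC; apply: (@le_trans _ _
    (expect mu (fun x => \1_(`[y - l, y + l]%classic) x + \1_A x))).
    apply: expect_le => [||x].
    + by apply: bmeas_indic; exact: measurableU.
    + by apply: bmeasD; exact: bmeas_indic.
    + rewrite !indicE in_setU; have A0 : 0 <= (x \in A)%:R :> R by [].
      by case: (x \in `[_, _]%classic) => /=; rewrite ?mulr1n ?mulr0n; lra.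
  by rewrite expectD; [apply: lerD => //; exact: fr|exact: bmeas_indic|exact: bmeas_indic].
- move=> x z; rewrite inE => /orP[/eqP->|zp] xz; last by right; exact: HA xz.
  by left => /=; rewrite in_itv/= -ler_distl.
Qed.

Lemma thin_sublevels d (Q : R -> 'rV[R]_d) B al be : is_hull mu al be -> represents mu B ->
  (forall t, t \in B -> `|t.1.2| < 1) -> non_atomic mu ->
  (forall x v, x \in `[al, be] -> v != 0 ->
    exists2 k, regular_at Q k x & dotp v (derive1n k.+1 Q x) != 0) ->
  exists C c, [/\ 0 < C, 0 < c & forall v s, v != 0 -> 0 < s ->
    exists2 A : set R, measurable A /\ expect mu (\1_A) <= C * s `^ c &
    forall x, x \in `[al, be] -> `|dotp v (derive1n 1 Q x)| <= s * `|v| -> A x].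
Proof.
move=> hull rB aB na H; have [Cf [cf [Cf0 cf0 fr]]] := frostman hull rB aB na.
have albe : al < be by case: hull.
have [N [C [c [C0 c0 sub]]]] := sublevel_transversal albe H.
exists (N.+1%:R * (Cf * C `^ cf)), (c * cf); split.
- by rewrite !mulr_gt0// powR_gt0.
- by rewrite mulr_gt0.
move=> v s v0 s0; have [pts [sp cov]] := sub v s v0 s0.
have l0 : 0 < C * s `^ c by rewrite mulr_gt0// powR_gt0.
have [A [mA EA HA]] := cover_mass pts l0 fr.
exists A.
  split=> //; apply: (le_trans EA); rewrite powRM ?(ltW C0) ?powR_ge0//.
  rewrite -powRrM -!mulrA; apply: ler_pM => //.
    by rewrite !mulr_ge0 ?powR_ge0 ?(ltW Cf0).
  by rewrite ler_nat; apply: leq_trans sp _.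
move=> x xK hx; have [y yp xy] := cov x xK hx; exact: HA yp xy.
Qed.

End thin.

Section core_power.
Context {R : realType} {d : nat} (mu : probability R R) (al be : R) (hull : is_hull mu al be).
Context (B : seq (R * R * R)) (rB : represents mu B).
Context (aB : forall t, t \in B -> `|t.1.2| < 1) (na : non_atomic mu).
Context (G G' : R -> 'rV[R]_d).
Context (mG : forall v, measurable_fun [set: R] (fun x => dotp v (G x))).
Context (M : R) (M0 : 0 <= M).
Context (taylorG : forall v x y, x \in `[al, be] -> y \in `[al, be] ->
      `|dotp v (G y) - dotp v (G x) - (y - x) * dotp v (G' x)| <=
        M * `|v| * `|y - x| ^+ 2).
Context (lipG' : forall v x y, x \in `[al, be] -> y \in `[al, be] ->
      `|dotp v (G' y) - dotp v (G' x)| <= M * `|v| * `|y - x|).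
Context (bndG' : forall v x, x \in `[al, be] -> `|dotp v (G' x)| <= M * `|v|).
Context (C3 c3 : R) (C30 : 0 < C3) (c30 : 0 < c3).
Context (thinG' : forall v s, v != 0 -> 0 < s ->
    exists2 A : set R, measurable A /\ expect mu (\1_A) <= C3 * s `^ c3 &
    forall x, x \in `[al, be] -> `|dotp v (G' x)| <= s * `|v| -> A x).

(* x is the sixth root of the radius. *)
Lemma core_power kap : 0 < kap -> exists del x0, [/\ 0 < del, 1 <= x0 &
  forall x, x0 <= x -> forall S : seq 'rV[R]_d, uniq S ->
    (forall v w, v \in S -> w \in S -> v != w -> x ^+ 5 <= `|v - w|) ->
    (forall v, v \in S -> `|v| <= x ^+ 6 /\ x `^ (- del) <= curve_ft mu G v) ->
    (size S)%:R <= x `^ kap].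
Proof.
move=> kap0; have albe : al < be by case: hull.
have D0 : 0 < be - al by rewrite subr_gt0.
have [a a0 words] := words_at_scale rB aB.
pose eta := Num.min c3 kap.
have eta0 : 0 < eta by rewrite lt_min c30.
pose eps := eta / 8.
have eps0 : 0 < eps by rewrite divr_gt0.
have [rho [Cc [p [rho0 Cc0 cells]]]] := large_cells rB aB na eps0.
have p2 : 0 < 4 * (p.+2)%:R :> R by rewrite mulr_gt0.
pose del := Num.min 1 (eta / (4 * p.+2%:R)).
have del0 : 0 < del by rewrite lt_min ltr01 divr_gt0.
have del1 : del <= 1 by rewrite ge_min lexx.
have delp : del * p.+2%:R <= eta / 4.
  have : del <= eta / (4 * p.+2%:R) by rewrite ge_min lexx orbT.
  by rewrite ler_pdivlMr// mulrCA [4 * _]mulrC ler_pdivlMr// [_ * 4]mulrC.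
(* The exponent of the number of cells: slopes range over about x^2, whence [2 * eps], and the
   threshold adds [del * p]. Since [e1 + 2 * del] is at most half of [eta], half a power of x
   remains to absorb the constants. *)
pose e1 := 2 * eps + del * p%:R.
have e1e : e1 + 2 * del <= eta / 2.
  move: delp; rewrite /e1 /eps -[p.+2]addn2 natrD mulrDr.
  exact: exponent_arith1.
pose K1 := (M / rho + 1) `^ eps.
pose K2 := Cc * K1 * 4 ^+ p.
have K20 : 0 < K2.
  rewrite /K2 !mulr_gt0 ?exprn_gt0// /K1 powR_gt0//.
  by rewrite ltr_wpDl// divr_ge0// ltW.
pose K3 := 8 * pi * (M * (be - al) ^+ 2).
pose K4 := rho / a + M * (be - al).
have K40 : 0 < K4 by rewrite /K4 ltr_wpDr ?divr_gt0// mulr_ge0// ltW.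
pose K5 := 16 * K2 * (C3 * K4 `^ c3).
have [x1 x11 hx1] := powR_large K3 ltr01.
have c32 : 0 < c3 / 2 by rewrite divr_gt0.
have [x2 x21 hx2] := powR_large K5 c32.
have kap2 : 0 < kap / 2 by rewrite divr_gt0.
have [x3 x31 hx3] := powR_large (16 * K2) kap2.
exists del, (Num.max x1 (Num.max x2 x3)); split=> //; first by rewrite le_max x11.
move=> x; rewrite !ge_max => /and3P[x1x x2x x3x] S uS sepS hS.
have xg1 : 1 <= x by apply: le_trans x1x.
have x0 : 0 < x by apply: lt_le_trans xg1.
(* Strictly between x^-3, below which x^6 * r^2 decays, and x^-5, above which 1 / (r * x^5)
   decays. *)
pose r := x ^- 4.
have r01 : 0 < r <= 1.
  by rewrite /r invr_gt0 exprn_gt0//= invf_le1 ?exprn_gt0// exprn_ege1.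
have /andP[r0 r1] := r01.
have [L [rL hL]] := words r r01.
pose tau := x `^ (- del).
have tau0 : 0 < tau by exact: powR_gt0.
pose X := M * x ^+ 2 / rho + 1.
have X1 : 1 <= X.
  by rewrite /X lerDr divr_ge0 ?mulr_ge0 ?exprn_ge0 ?(ltW x0)// ltW.
have tau4 : 0 < tau / 4 by rewrite divr_gt0.
have [cs [ucs scs hcs]] := cells X (tau / 4) X1 tau4.
have size_cs : (size cs)%:R <= K2 * x `^ e1.
  apply: (le_trans scs); rewrite expr_div_n invfM invrK powRXn -powRN mulNr opprK.
  rewrite /K2 /e1 (powRDp _ _ x0) -!mulrA ler_wpM2l ?(ltW Cc0)//.
  have -> : K1 * (4 ^+ p * (x `^ (2 * eps) * x `^ (del * p%:R))) =
    (K1 * x `^ (2 * eps)) * (x `^ (del * p%:R) * 4 ^+ p) by ring.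
  rewrite ler_wpM2r//; first by rewrite mulr_ge0 ?powR_ge0// exprn_ge0.
  rewrite /K1 (powRrM x) -powRM ?powR_ge0//; last first.
    by rewrite addr_ge0// divr_ge0// ltW.
  apply: (ge0_ler_powR (ltW eps0)); rewrite ?nnegrE.
  - exact: (le_trans ler01 X1).
  - by rewrite mulr_ge0 ?powR_ge0// addr_ge0// divr_ge0// ltW.
  rewrite /X powR_mulrn ?(ltW x0)// mulrDl mul1r [M / rho * _]mulrAC lerD2l.
  by rewrite exprn_ege1.
have hcs' t : `|t| <= r * (M * x ^+ 6) -> tau / 4 <= ft mu t -> Num.truncn (`|t| / rho) \in cs.
  move=> tr; apply: hcs; apply: (le_trans tr); rewrite /X /r mulrDr mulr1.
  have -> : x ^- 4 * (M * x ^+ 6) = rho * (M * x ^+ 2 / rho).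
    by field; rewrite !gt_eqF.
  by rewrite lerDl ltW.
have err : 2 * pi * (M * x ^+ 6 * (r * (be - al)) ^+ 2) <= tau / 4.
  have -> : 2 * pi * (M * x ^+ 6 * (r * (be - al)) ^+ 2) = K3 * x^-1 * x^-1 / 4.
    by rewrite /r /K3; field; rewrite gt_eqF.
  rewrite ler_pM2r ?invr_gt0//; apply: (@le_trans _ _ x^-1).
    rewrite ler_piMl ?invr_ge0 ?(ltW x0)// ler_pdivrMr// mul1r.
    by have := hx1 _ x1x; rewrite powRr1// ltW.
  rewrite -powR_inv1 ?(ltW x0)// /tau; apply: ler_powR => //.
  by rewrite lerN2.
pose s := K4 * x^-1.
have s0 : 0 < s by rewrite /s mulr_gt0// invr_gt0.
have hs : rho / (a * r) / x ^+ 5 + M * (r * (be - al)) <= s.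
  rewrite /s /K4 mulrDl; apply: lerD.
    rewrite le_eqVlt; apply/orP; left; apply/eqP.
    by rewrite /r; field; rewrite !gt_eqF.
  rewrite [r * _]mulrC mulrA; apply: ler_wpM2l; first exact: mulr_ge0 M0 (ltW D0).
  by rewrite /r lef_pV2 ?posrE ?exprn_gt0// ler_eXnr.
have small : 16 * (size cs)%:R * (C3 * s `^ c3) <= tau ^+ 2.
  have sE : s `^ c3 = K4 `^ c3 * x `^ (- c3).
    by rewrite /s powRM ?(ltW K40) ?invr_ge0 ?(ltW x0)// -(powR_inv1 (ltW x0)) -powRrM mulN1r.
  apply: (@le_trans _ _ (16 * (K2 * x `^ e1) * (C3 * s `^ c3))).
    by rewrite ler_wpM2r ?ler_pM2l// mulr_ge0 ?powR_ge0// ltW.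
  rewrite sE; have -> : 16 * (K2 * x `^ e1) * (C3 * (K4 `^ c3 * x `^ (- c3))) =
    K5 * (x `^ e1 * x `^ (- c3)) by rewrite /K5; ring.
  apply: (@le_trans _ _ (x `^ (c3 / 2) * (x `^ e1 * x `^ (- c3)))).
    by rewrite ler_wpM2r ?mulr_ge0 ?powR_ge0// hx2.
  rewrite -!(powRDp _ _ x0) /tau powRXn; apply: ler_powR => //.
  have ec : eta <= c3 by rewrite ge_min lexx.
  exact: exponent_arith2 e1e ec.
have C30' := ltW C30.
have l0 : 0 < x ^+ 5 by rewrite exprn_gt0.
have := core_count hull mG M0 taylorG lipG' bndG' rL hL a0 r0 tau0 l0 rho0 ucs hcs' err hs C30'
  (fun v v0 => thinG' v0 s0) small uS sepS hS.
rewrite /tau powRXn -ler_pdivlMr ?powR_gt0// => H.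
apply: (le_trans H); rewrite -powRN.
apply: (@le_trans _ _ (16 * (K2 * x `^ e1) * x `^ (- (- del * 2)))).
  by rewrite ler_wpM2r ?powR_ge0// ler_pM2l.
have -> : 16 * (K2 * x `^ e1) * x `^ (- (- del * 2)) = 16 * K2 * (x `^ e1 * x `^ (- (- del * 2))).
  by ring.
apply: (@le_trans _ _ (x `^ (kap / 2) * (x `^ e1 * x `^ (- (- del * 2))))).
  by rewrite ler_wpM2r ?mulr_ge0 ?powR_ge0// hx3.
rewrite -!(powRDp _ _ x0); apply: ler_powR => //.
have ek : eta <= kap by rewrite ge_min lexx orbT.
exact: exponent_arith3 e1e ek.
Qed.

End core_power.

(** * Packing and descent of the exponent *)

Section packing.
Context {R : realType} {d : nat}.
Implicit Types (S : seq 'rV[R]_d).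

(** In the sup norm, points whose shifted coordinates have equal integer parts are less than 1
    apart, so the integer parts encode [S] injectively. *)
Lemma packing_bound S (r : R) : 1 <= r -> uniq S ->
  (forall v w, v \in S -> w \in S -> v != w -> 1 <= `|v - w|) ->
  (forall v, v \in S -> `|v| <= r) -> (size S)%:R <= (3 * r) ^+ d.
Proof.
move=> r1 uS sep bd.
pose n := (Num.truncn (2 * r)).+1.
pose f (v : 'rV[R]_d) : {ffun 'I_d -> 'I_n} := [ffun i => inord (Num.truncn (v 0 i + r))].
have vr v i : v \in S -> 0 <= v 0 i + r <= 2 * r.
  move=> /bd vr; have := le_trans (coord_le_norm v i) vr.
  by rewrite ler_norml => /andP[]; lra.
have finj : {in S &, injective f}.
  move=> v w vS wS fvw; apply/eqP; apply: contrapT => /negP vw.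
  have := sep _ _ vS wS vw; apply/negP; rewrite -ltNge.
  have lt1 i : `|(v - w) 0 i| < 1.
    have /ffunP/(_ i) := fvw; rewrite !ffunE => /(congr1 val).
    have /andP[v0 v1] := vr v i vS; have /andP[w0 w1] := vr w i wS.
    rewrite /= !inordK; try by rewrite /n ltnS le_truncn.
    have /andP[v2 v3] := truncn_itv v0; have /andP[w2 w3] := truncn_itv w0.
    move=> tE; rewrite !mxE ltr_norml; move: v2 v3 w2 w3; rewrite tE -natr1 => *.
    by apply/andP; split; lra.
  rewrite [ltLHS]/Num.norm /= mx_normrE; apply: (big_ind (fun x => x < 1)) => //.
    by move=> x y x1 y1; rewrite gt_max x1.
  by move=> [i j] _ /=; rewrite (ord1 i); exact: lt1.
have sz : (size S <= n ^ d)%N.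
  rewrite -(size_map f) -[X in (_ <= X ^ _)%N]card_ord -[X in (_ <= _ ^ X)%N]card_ord -card_ffun.
  by rewrite cardE; apply: uniq_leq_size; [rewrite map_inj_in_uniq|move=> g _; rewrite mem_enum].
apply: (@le_trans _ _ (n ^ d)%:R); first by rewrite ler_nat.
rewrite natrX; apply: lerXn2r; rewrite ?nnegrE//.
  by rewrite mulr_ge0// (le_trans ler01).
have : (Num.truncn (2 * r))%:R <= 2 * r by rewrite truncn_le; lra.
by rewrite /n -natr1; lra.
Qed.

End packing.

Section descent.
Context {R : realType} {d : nat} (mu : probability R R).
Context (G : R -> 'rV[R]_d).
Context (mG : forall v, measurable_fun [set: R] (fun x => dotp v (G x))).
Local Notation cf := (curve_ft mu G).
Implicit Types (S : seq 'rV[R]_d).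

Definition apart (l : R) S :=
  uniq S /\ forall v w, v \in S -> w \in S -> v != w -> l <= `|v - w|.

Definition large_spectrum (r tau : R) S := forall v, v \in S -> `|v| <= r /\ tau <= cf v.

(** The threshold exponent [del] is existential: it may shrink at each descent, and only its
    positivity matters for the final power. *)
Definition spectrum_bound (th : R) := exists del C, [/\ 0 < del, 0 < C &
  forall r, 1 <= r -> forall S, apart 1 S -> large_spectrum r (r `^ (- del)) S ->
    (size S)%:R <= C * r `^ th].

Lemma curve_ft_posdef S :
  (\sum_(v <- S) cf v) ^+ 2 <= \sum_(v <- S) \sum_(w <- S) cf (v - w).
Proof.
have := @sum_osc_sqr_le R mu 'I_(size S) (fun i x => 2 * pi * dotp (nth 0 S i) (G x))
  (fun i => measurable_phase mG _).
move=> H; have E1 : \sum_(v <- S) cf v = \sum_(i < size S) cf (nth 0 S i).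
  by rewrite (big_nth 0) big_mkord.
rewrite E1; apply: (le_trans H); rewrite le_eqVlt; apply/orP; left; apply/eqP.
rewrite [RHS](big_nth 0) big_mkord; apply: eq_bigr => i _.
rewrite [RHS](big_nth 0) big_mkord; apply: eq_bigr => j _.
by congr osc; apply/funext => x; rewrite -mulrBr dotpBl.
Qed.

(** By positive-definiteness the transform averages at least [tau ^+ 2] over all differences. Values
    below half of this account for at most half of the average, so some [v] has many large
    differences. *)
Lemma cluster_bound S (tau V : R) : 0 < tau -> 0 <= V ->
  (forall v, v \in S -> tau <= cf v) ->
  (forall v, v \in S ->
    (size [seq w <- S | (tau ^+ 2 / 2 <= cf (v - w))%R])%:R <= V) ->
  (size S)%:R * tau ^+ 2 <= 2 * V.
Proof.
move=> tau0 V0 St SV; set n : R := (size S)%:R.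
have n0 : 0 <= n by rewrite /n.
have low : (n * tau) ^+ 2 <= (\sum_(v <- S) cf v) ^+ 2.
  have h : n * tau <= \sum_(v <- S) cf v.
    rewrite /n -sum1_size natr_sum mulr_suml big_seq [leRHS]big_seq.
    by apply: ler_sum => v vS; rewrite mul1r St.
  have nt : 0 <= n * tau by rewrite mulr_ge0// ltW.
  by rewrite lerXn2r ?nnegrE// (le_trans nt).
have := le_trans low (curve_ft_posdef S).
have : \sum_(v <- S) \sum_(w <- S) cf (v - w) <= n * (V + n * (tau ^+ 2 / 2)).
  rewrite {1}/n -sum1_size natr_sum mulr_suml big_seq [leRHS]big_seq.
  apply: ler_sum => v vS; rewrite mul1r.
  apply: (@le_trans _ _ ((size [seq w <- S | (tau ^+ 2 / 2 <= cf (v - w))%R])%:R +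
      n * (tau ^+ 2 / 2))); last by rewrite lerD2r SV.
  rewrite size_filter -sum1_count natr_sum [X in _ <= X + _]big_mkcond /n -sum1_size natr_sum mulr_suml.
  rewrite -big_split/=; apply: ler_sum => w _; rewrite mul1r.
  case: ifPn => [_|]; last by rewrite -ltNge add0r => /ltW.
  apply: (@le_trans _ _ 1); last by rewrite lerDl divr_ge0// exprn_ge0// ltW.
  by apply: osc_le1; exact: measurable_phase.
move=> h1 h2; have := le_trans h2 h1.
have [->|nz] := eqVneq n 0; first by move=> _; rewrite mul0r mulr_ge0.
have np : 0 < n by rewrite lt_def nz.
rewrite exprMn expr2 -mulrA ler_pM2l// mulrA; move: (n * tau ^+ 2) => X; lra.
Qed.

Lemma spectrum_bound_packing : spectrum_bound d%:R.
Proof.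
exists 1, (3 ^+ d); split=> // r r1 S [uS sep] bd.
rewrite powR_mulrn ?(le_trans ler01)// -exprMn.
by apply: packing_bound => // v /bd[].
Qed.

Context (core : forall kap, 0 < kap -> exists del x0, [/\ 0 < del, 1 <= x0 &
  forall x, x0 <= x -> forall S : seq 'rV[R]_d, uniq S ->
    (forall v w, v \in S -> w \in S -> v != w -> x ^+ 5 <= `|v - w|) ->
    (forall v, v \in S -> `|v| <= x ^+ 6 /\ x `^ (- del) <= cf v) ->
    (size S)%:R <= x `^ kap]).

Lemma spectrum_descent th : 0 < th -> spectrum_bound th -> spectrum_bound (9 / 10 * th).
Proof.
move=> th0 [del [C [del0 C0 H]]].
(* The budget in powers of x, the sixth root of the radius: [th / 10] for the number of clusters,
   [5 * th] for each cluster, [2 * del' <= th / 10] for the threshold and [2 / 10 * th] for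
   constants, in total 5.4 th = 6 * (9/10) * th. *)
pose kap := th / 10; have kap0 : 0 < kap by rewrite divr_gt0.
have [dc [xc [dc0 xc1 Hc]]] := core kap0.
pose del' := Num.min dc (Num.min del (th / 20)).
have del'0 : 0 < del' by rewrite !lt_min dc0 del0 divr_gt0.
have dl1 : del' <= dc by rewrite ge_min lexx.
have dl2 : del' <= del by rewrite !ge_min lexx orbT.
have dl3 : del' <= th / 20 by rewrite !ge_min lexx !orbT.
have d30 : 0 < 3 * del by rewrite mulr_gt0.
have [y1 y11 hy1] := powR_large 2 d30.
have t20 : 0 < 2 / 10 * th by rewrite mulr_gt0.
have [y2 y21 hy2] := powR_large (2 * (C * 2 `^ th)) t20.
pose x0 := Num.max xc (Num.max y1 y2).
have x01 : 1 <= x0 by rewrite le_max xc1.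
have large x S : x0 <= x -> apart 1 S -> large_spectrum (x ^+ 6) (x `^ (- del')) S ->
    (size S)%:R <= x `^ (6 * (9 / 10 * th)).
  rewrite !ge_max => /and3P[xxc xy1 xy2] [uS sS] bS.
  have xg1 : 1 <= x by apply: le_trans xxc.
  have xp : 0 < x by apply: lt_le_trans xg1.
  pose tau := x `^ (- del').
  have tau0 : 0 < tau by exact: powR_gt0.
  pose l := x ^+ 5.
  have l0 : 0 < l by rewrite exprn_gt0.
  have l1 : 1 <= l by rewrite exprn_ege1.
  have lE e : l `^ e = x `^ (5%:R * e) by rewrite /l -powR_mulrn ?(ltW xp)// -powRrM.
  pose sep (v w : 'rV[R]_d) := l <= `|v - w|.
  have sepu s : pairwise sep s -> uniq s.
    rewrite uniq_pairwise; apply: sub_pairwise => v w.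
    by apply: contraTneq => ->; rewrite /sep subrr normr0 -ltNge.
  have [|s [ps sS' _ cov]] := @maximal_separated _ sep (fun v => v \in S) (size S).
    by move=> s ps sS'; apply: uniq_leq_size => //; exact: sepu.
  have sepP : forall v w, v \in s -> w \in s -> v != w -> l <= `|v - w|.
    move: ps; clear; elim: s => //= a s IH /andP[/allP Ha ps] v w.
    rewrite !inE => /orP[/eqP->|vs] /orP[/eqP->|ws].
    - by rewrite eqxx.
    - by move=> _; exact: Ha.
    - by move=> _; rewrite distrC; exact: Ha.
    - exact: IH.
  have ss : (size s)%:R <= x `^ kap.
    apply: (Hc x xxc s (sepu _ ps) sepP) => v /sS'/bS[h1 h2]; split=> //.
    by apply: le_trans h2; apply: ler_powR => //; rewrite lerN2.
  pose V := C * (2 * l) `^ th.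
  have clus y : y \in s -> (size [seq v <- S | ~~ sep v y])%:R * tau ^+ 2 <= 2 * V.
    move=> ys; apply: cluster_bound => // [|v|v].
      by rewrite /V mulr_ge0 ?powR_ge0// ltW.
      by rewrite mem_filter => /andP[_ /bS[]].
    rewrite mem_filter => /andP[vy vS].
    (* The differences are as separated as the [w] themselves but lie in the ball of radius [2 * l],
       where the assumed exponent is applied. *)
    rewrite -(size_map (fun w => v - w)); apply: H.
    + by lra.
    + split.
        by rewrite map_inj_uniq ?filter_uniq// => w w' /addrI/oppr_inj.
      move=> _ _ /mapP[w + ->] /mapP[w' + ->].
      rewrite !mem_filter => /andP[_ /andP[_ wS]] /andP[_ /andP[_ w'S]] ne.
      rewrite (_ : v - w - (v - w') = w' - w); last by rewrite opprB addrC addrA subrK.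
      by apply: sS => //; apply: contraNneq ne => ->.
    + move=> _ /mapP[w + ->]; rewrite !mem_filter => /andP[tw /andP[wy wS]]; split.
        rewrite (_ : v - w = (v - y) - (w - y)); last by rewrite opprB addrA subrK.
        apply: (le_trans (ler_normB _ _)); move: vy wy; rewrite /sep -!ltNge; lra.
      apply: le_trans tw.
      (* The threshold at radius [2 * l] is at most x^(-5 del), which lies below [tau ^+ 2 / 2] as
         soon as x^(3 del) is at least 2. *)
      rewrite powRM ?(ltW l0)//; apply: (@le_trans _ _ (l `^ (- del))).
        have h2 : 2 `^ (- del) <= 1.
          rewrite -[leRHS](powRr0 2); apply: ler_powR; first by rewrite ler1n.
          by rewrite oppr_le0 ltW.
        by rewrite ler_piMl ?powR_ge0.
      rewrite lE /tau powRXn ler_pdivlMr//.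
      apply: (@le_trans _ _ (x `^ (5%:R * - del) * x `^ (3 * del))).
        by rewrite ler_wpM2l ?powR_ge0// hy1.
      by rewrite -(powRDp _ _ xp); apply: ler_powR => //; lra.
  have tot : (size S)%:R * tau ^+ 2 <= (size s)%:R * (2 * V).
    apply: (@le_trans _ _ (\sum_(y <- s) (size [seq v <- S | ~~ sep v y])%:R * tau ^+ 2)).
      rewrite -mulr_suml ler_wpM2r ?exprn_ge0 ?(ltW tau0)//.
      under eq_bigr do rewrite size_filter -sum1_count natr_sum.
      rewrite (exchange_big_dep predT)//= -sum1_size natr_sum big_seq [leRHS]big_seq.
      apply: ler_sum => v vS; have [y ys vy] := cov v vS.
      by rewrite (big_rem y)//= vy lerDl sumr_ge0.
    rewrite -[in leRHS](sum1_size s) natr_sum mulr_suml big_seq [leRHS]big_seq.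
    by apply: ler_sum => y ys; rewrite mul1r clus.
  have t2 : tau ^+ 2 = x `^ (- (2 * del')) by rewrite /tau powRXn; congr (_ `^ _); ring.
  move: tot; rewrite t2 powRN ler_pdivrMr ?powR_gt0// => tot.
  apply: (le_trans tot).
  have VE : 2 * V = 2 * (C * 2 `^ th) * x `^ (5 * th).
    by rewrite /V powRM ?(ltW l0)// lE; ring.
  rewrite VE; apply: (@le_trans _ _ (x `^ kap * (x `^ (2 / 10 * th) * x `^ (5 * th)) * x `^ (2 * del'))).
    rewrite ler_wpM2r ?powR_ge0//; apply: ler_pM => //.
      by rewrite mulr_ge0 ?powR_ge0// mulr_ge0// mulr_ge0 ?powR_ge0// ltW.
    by rewrite ler_wpM2r ?powR_ge0// hy2.
  rewrite -!(powRDp _ _ xp); apply: ler_powR => //; rewrite /kap; lra.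
have x06 : 1 <= x0 ^+ 6 by rewrite exprn_ege1.
pose C1 := (3 * x0 ^+ 6) ^+ d.
have C10 : 0 < C1 by rewrite exprn_gt0// mulr_gt0// (lt_le_trans ltr01).
exists (del' / 6), (1 + C1); split.
- by rewrite divr_gt0.
- by rewrite addr_gt0.
move=> r r1 S aS bS; have r0 : 0 < r by apply: lt_le_trans r1.
pose x := r `^ (6%:R^-1).
have x6 : x ^+ 6 = r by rewrite /x powRXn mulVf ?pnatr_eq0// powRr1// ltW.
have rth : 1 <= r `^ (9 / 10 * th) by rewrite powR_ge1// mulr_ge0// ltW.
have [xx|xx] := leP x0 x.
  apply: (@le_trans _ _ (r `^ (9 / 10 * th))).
    have -> : r `^ (9 / 10 * th) = x `^ (6 * (9 / 10 * th)).
      by rewrite /x -powRrM; congr (_ `^ _); field.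
    apply: large => // v /bS[h1 h2]; split; first by rewrite x6.
    apply: le_trans h2; rewrite /x -powRrM le_eqVlt; apply/orP; left; apply/eqP.
    by congr (_ `^ _); field.
  by rewrite ler_peMl ?powR_ge0// lerDl ltW.
(* For bounded radii the packing bound alone gives a constant. *)
case: aS => uS sS; apply: (@le_trans _ _ C1).
  apply: (le_trans (packing_bound r1 uS sS (fun v vS => (bS v vS).1))).
  have rx : r <= x0 ^+ 6.
    by rewrite -x6 lerXn2r ?nnegrE ?powR_ge0 ?(le_trans ler01)// ltW.
  rewrite lerXn2r ?nnegrE ?mulr_ge0 ?exprn_ge0 ?(ltW r0) ?(le_trans ler01 x01)//.
  by rewrite ler_pM2l.
rewrite -[leLHS]mulr1; apply: ler_pM => //; first exact: ltW.
by rewrite lerDr.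
Qed.

Lemma spectrum_bound_small eps : (0 < d)%N -> 0 < eps -> spectrum_bound eps.
Proof.
move=> d0 eps0; have dr0 : 0 < d%:R :> R by rewrite ltr0n.
have it n : spectrum_bound ((9 / 10) ^+ n * d%:R).
  elim: n => [|n IH]; first by rewrite expr0 mul1r; exact: spectrum_bound_packing.
  rewrite exprS -mulrA; apply: spectrum_descent => //.
  by rewrite mulr_gt0// exprn_gt0.
have [n hn] : exists n, (9 / 10 : R) ^+ n < eps / d%:R.
  by apply: exprn_small; rewrite ?divr_gt0//; apply/andP; split; lra.
have [del [C [del0 C0 H]]] := it n; exists del, C; split => // r r1 S aS bS.
apply: (le_trans (H r r1 S aS bS)); rewrite ler_wpM2l ?(ltW C0)//.
by apply: ler_powR => //; rewrite -ler_pdivlMr// ltW.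
Qed.

End descent.

(** * From counting to the integral *)

Section cubes.
Context {R : realType} {d : nat}.
Implicit Types (c v : 'rV[R]_d).

Definition cube c (l : R) : set 'rV[R]_d :=
  [set v | forall i, `[c 0 i - l, c 0 i + l]%classic (v 0 i)].

Lemma in_cube c l v : `|v - c| <= l -> cube c l v.
Proof.
move=> vl i /=; rewrite in_itv/= -ler_distl.
by apply: le_trans vl; have := coord_le_norm (v - c) i; rewrite !mxE.
Qed.

Lemma measurable_coord (i : 'I_d) : measurable_fun [set: 'rV[R]_d] (fun v => v 0 i).
Proof.
apply: (measurability _ (RGenOpens.measurableE R)).
move=> _ [_ [a [b ->] <-]]; rewrite setTI; apply: sub_sigma_algebra.
by apply: open_comp (interval_open _ _) => // v _; exact: coord_continuous.
Qed.

Lemma measurable_cube c l : measurable (cube c l).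
Proof.
rewrite (_ : cube c l = \bigcap_(i in [set: 'I_d])
    (fun v : 'rV[R]_d => v 0 i) @^-1` `[c 0 i - l, c 0 i + l]%classic).
  apply: fin_bigcap_measurable => // i _.
  by rewrite -[X in measurable X]setTI; apply: measurable_coord.
by apply/seteqP; split => v /= H i; [move=> _|]; exact: H.
Qed.

Lemma cube_volume c l : 0 < l -> lebesgue_rV d (cube c l) = ((2 * l) ^+ d)%:E.
Proof.
move=> l0; have := @lebesgue_rV_box R d (fun i => `[c 0 i - l, c 0 i + l]%classic)
  (fun i => measurable_itv _).
rewrite /cube => ->.
rewrite (eq_bigr (fun=> (2 * l)%:E)) => [|i _].
  by rewrite prodEFin prodr_const card_ord.
rewrite lebesgue_measure_itv/= lte_fin ifT; last by lra.
by rewrite -EFinB; congr EFin; ring.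
Qed.

(** The integral of a nonnegative function is a supremum over simple functions below it, so
    comparison with a sum of indicators asks for no measurability of [f] or [D]. *)
Lemma le_nnintegral_sum_cubes (D : set 'rV[R]_d) (f : 'rV[R]_d -> R)
    (ks : seq ('rV[R]_d * R * R)) :
  (forall k, k \in ks -> 0 < k.1.2 /\ 0 <= k.2) ->
  (forall v, 0 <= f v) ->
  (forall v, D v -> f v <= \sum_(k <- ks) k.2 * \1_(cube k.1.1 k.1.2) v) ->
  (\int[lebesgue_rV d]_(v in D) (f v)%:E <= (\sum_(k <- ks) k.2 * (2 * k.1.2) ^+ d)%:E)%E.
Proof.
move=> hk f0 fD.
(* Clipping makes the summands nonnegative for every triple, as the exchange of sum and integral
   demands, not only for those in [ks]. *)
pose w (k : 'rV[R]_d * R * R) := Num.max 0 k.2.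
pose g v := (\sum_(k <- ks) (w k * \1_(cube k.1.1 k.1.2) v)%:E)%E.
have wE k : k \in ks -> w k = k.2.
  by move=> /hk[_ k0]; rewrite /w; apply/max_idPr.
have w0 k : 0 <= w k by rewrite le_max lexx.
have g0 v : (0 <= g v)%E.
  by rewrite sume_ge0// => k _; rewrite lee_fin mulr_ge0// indicE.
have fg v : ((fun v => (f v)%:E) \_ D v <= g v)%E.
  rewrite /patch; case: ifPn => [/set_mem Dv|_]; last exact: g0.
  rewrite /g sumEFin lee_fin; apply: (le_trans (fD _ Dv)).
  by rewrite big_seq [leRHS]big_seq; apply: ler_sum => k kks; rewrite wE.
rewrite integral_mkcond ge0_integralTE; last first.
  by move=> v; rewrite /patch; case: ifP => // _; rewrite lee_fin.
apply: (@le_trans _ _ (\int[lebesgue_rV d]_v g v)%E).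
  rewrite ge0_integralTE//; apply: le_ereal_sup => _ [h /= hf <-].
  by exists h => //= v; apply: (le_trans (hf v)); exact: fg.
rewrite /g ge0_integral_sum//; last 2 first.
- move=> k; apply/measurable_EFinP; apply: measurable_funM => //.
  by apply: measurable_indic; exact: measurable_cube.
- by move=> k v _; rewrite lee_fin mulr_ge0// indicE.
rewrite -sumEFin big_seq [X in (_ <= X)%E]big_seq.
apply: lee_sum => k kks; have [l0 _] := hk _ kks.
under eq_integral do rewrite EFinM.
rewrite ge0_integralZl_EFin//.
- rewrite integral_indic ?setIT; last exact: measurable_cube.
  rewrite -[X in (_ * X <= _)%E]/(lebesgue_rV d (cube k.1.1 k.1.2)).
  by rewrite cube_volume// -EFinM wE.
- exact: measurableT.
- by apply/measurable_EFinP; apply: measurable_indic; exact: measurable_cube.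
Qed.

End cubes.

Section integral_bound.
Context {R : realType} {d : nat} (mu : probability R R).
Context (G : R -> 'rV[R]_d).
Context (mG : forall v, measurable_fun [set: R] (fun x => dotp v (G x))).
Local Notation cf := (curve_ft mu G).

Lemma norm_le_euclidean (r : R) (v : 'rV[R]_d) : 0 < r -> euclidean_ball r v -> `|v| <= r.
Proof.
rewrite /euclidean_ball/= => r0 vr.
have v2 : dotp v v <= r ^+ 2.
  have v0 : 0 <= dotp v v by rewrite sumr_ge0// => i _; rewrite -expr2 sqr_ge0.
  by rewrite -(sqr_sqrtr v0) lerXn2r ?nnegrE ?sqrtr_ge0 ?ltW.
rewrite [leLHS]/Num.norm /= mx_normrE; apply: (big_ind (fun x => x <= r)).
- exact: ltW.
- by move=> x y x1 y1; rewrite ge_max x1.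
move=> [i j] _ /=; rewrite (ord1 i).
rewrite -(@ler_pXn2r _ 2) ?nnegrE ?(ltW r0)//; apply: le_trans v2.
rewrite real_normK ?num_real// /dotp (bigD1 j)//= -expr2 lerDl.
by rewrite sumr_ge0// => k _; rewrite -expr2 sqr_ge0.
Qed.

Lemma spectrum_bound_integral eps : 0 < eps -> spectrum_bound mu G eps ->
  exists2 p : R, 1 < p & exists C : R, forall r : R, 1 < r ->
  (\int[lebesgue_rV d]_(v in euclidean_ball r) (cf v `^ p)%:E <= (C * r `^ eps)%:E)%E.
Proof.
move=> eps0 [del [C [del0 C0 H]]].
(* Chosen so that [tau] to the power [p] is r^(-d - 2 del), at most the inverse of the order of the
   volume of the ball; the 2 ensures [p > 1]. *)
pose p := d%:R / del + 2.
have p1 : 1 < p.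
  have h : 0 <= d%:R / del by rewrite divr_ge0// ltW.
  by rewrite /p; lra.
have p0 : 0 <= p by lra.
exists p => //; exists ((C + 1) * 2 ^+ d) => r r1.
have r0 : 0 < r by lra.
have cf0 v : 0 <= cf v by exact: osc_ge0.
have cf1 v : cf v <= 1 by apply: osc_le1; exact: measurable_phase.
pose tau := r `^ (- del).
pose A v := `|v| <= r /\ tau <= cf v.
pose sep (v w : 'rV[R]_d) := (1 : R) <= `|v - w|.
have sepP s : pairwise sep s -> apart 1 s.
  move=> ps; split.
    move: ps; rewrite uniq_pairwise; apply: sub_pairwise => v w.
    by apply: contraTneq => ->; rewrite /sep subrr normr0 -ltNge.
  move: ps; elim: s => //= a s IH /andP[/allP Ha ps] v w.
  rewrite !inE => /orP[/eqP->|vs] /orP[/eqP->|ws].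
  - by rewrite eqxx.
  - by move=> _; exact: Ha.
  - by move=> _; rewrite distrC; exact: Ha.
  - exact: IH.
have [|S [pS AS _ cov]] := @maximal_separated _ sep A (Num.truncn ((3 * r) ^+ d)).
  move=> s ps As; have [us ss] := sepP s ps.
  rewrite truncn_ge_nat; last by rewrite exprn_ge0// mulr_ge0// ltW.
  by apply: packing_bound => //; [exact: ltW|move=> v /As[]].
have sS : (size S)%:R <= C * r `^ eps.
  by apply: H => //; [exact: ltW|exact: sepP].
(* Triples of centre, half side and height: one big low cube for frequencies below the threshold,
   and a cube of height 1 about each point of the maximal separated set. *)
pose ks := (0 : 'rV[R]_d, r, r ^- d) :: [seq (y, 1, 1) | y <- S].
have hks k : k \in ks -> 0 < k.1.2 /\ 0 <= k.2.
  rewrite inE => /orP[/eqP->|/mapP[y _ ->]] //=; split=> //.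
  by rewrite invr_ge0 exprn_ge0// ltW.
apply: (le_trans (le_nnintegral_sum_cubes hks _ _)).
- by move=> v; exact: powR_ge0.
- move=> v vr; have vr' := norm_le_euclidean r0 vr.
  have pos : 0 <= \sum_(y <- S) 1 * \1_(cube y 1) v :> R.
    by rewrite sumr_ge0// => y _; rewrite mul1r indicE.
  rewrite /ks big_cons big_map/=.
  have [Av|nAv] := pselect (A v).
    have [y yS vy] := cov v Av.
    apply: (@le_trans _ _ 1).
      by have := ge0_ler_powR p0 (cf0 v) ler01 (cf1 v); rewrite powR1.
    have rest : 0 <= \sum_(z <- rem y S) 1 * \1_(cube z 1) v :> R.
      by rewrite sumr_ge0// => z _; rewrite mul1r indicE.
    have lead : 0 <= r ^- d * \1_(cube 0 r) v :> R.
      by rewrite mulr_ge0 ?invr_ge0 ?exprn_ge0 ?(ltW r0)// indicE.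
    have y1 : \1_(cube y 1) v = 1 :> R.
      rewrite indicE mem_set//; apply: in_cube.
      by move: vy; rewrite /sep -ltNge => /ltW.
    by rewrite (big_rem y)//= y1 mul1r; lra.
  have small : cf v <= tau.
    by rewrite leNgt; apply/negP => /ltW tv; apply: nAv.
  have -> : \1_(cube 0 r) v = 1 :> R.
    by rewrite indicE mem_set//; apply: in_cube; rewrite subr0.
  rewrite mulr1; apply: (@le_trans _ _ (r ^- d)); last by rewrite lerDl.
  apply: (le_trans (ge0_ler_powR p0 (cf0 v) (powR_ge0 _ _) small)).
  rewrite /tau -powRrM -powR_invn ?(ltW r0)//; apply: ler_powR; first exact: ltW.
  by rewrite mulNr lerN2 /p mulrDr mulrCA divff ?gt_eqF// mulr1 lerDl mulr_ge0// ltW.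
rewrite lee_fin /ks big_cons big_map/=.
rewrite exprMn mulrCA mulVf ?expf_neq0 ?gt_eqF// mulr1.
rewrite big_const_seq count_predT iter_addr_0 mul1r !mulr1 -[_ *+ size S]mulr_natl.
have d2 : 0 <= 2 ^+ d :> R by rewrite exprn_ge0.
have re : 1 <= r `^ eps by apply: powR_ge1; exact: ltW.
have -> : (C + 1) * 2 ^+ d * r `^ eps = 2 ^+ d * r `^ eps + C * r `^ eps * 2 ^+ d by ring.
by apply: lerD; [rewrite ler_peMr|rewrite ler_wpM2r].
Qed.

End integral_bound.

(** * Analytic and non-degenerate curves *)

Section power_series.
Context {R : realType}.
Implicit Types (c : nat -> R) (x e : R).

Definition converges_on e c := forall x, `|x| < e -> cvgn (pseries c x).

(** Each of the [n.+1] first terms of the geometric series is at least [t ^+ n]. *)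
Lemma natr_geometric_le (t : R) n : 0 <= t < 1 -> n.+1%:R * t ^+ n <= (1 - t)^-1.
Proof.
move=> /andP[t0 t1]; have h : 0 < 1 - t by rewrite subr_gt0.
rewrite -[leRHS]mul1r ler_pdivlMr//.
apply: (@le_trans _ _ ((\sum_(i < n.+1) t ^+ i) * (1 - t))).
  rewrite ler_wpM2r ?(ltW h)// mulr_natl -[X in _ *+ X](card_ord n.+1) -sumr_const.
  apply: ler_sum => i _; have ni : (i <= n)%N by rewrite -ltnS.
  move: (nat_of_ord i) ni => k kn.
  by rewrite -(subnK kn) exprD ler_piMl ?exprn_ge0// exprn_ile1// ltW.
rewrite mulrC -[1 - t]opprB mulNr -subrX1 opprB gerBl exprn_ge0//.
Qed.

Lemma converges_on_diffs e c : converges_on e c -> converges_on e (pseries_diffs c).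
Proof.
move=> H x xe; pose K := (`|x| + e) / 2.
have xK : `|x| < K by rewrite /K; lra.
have Ke : K < e by rewrite /K; lra.
have K0 : 0 < K by apply: le_lt_trans xK.
have [|M0 [_ hM0]] := @cvg_series_bounded R (fun i => c i * K ^+ i).
  by apply: H; rewrite ger0_norm// ltW.
pose M := `|M0| + 1.
have hM n : `|c n * K ^+ n| <= M.
  by apply: hM0 => //; rewrite /M (le_lt_trans (ler_norm _))// ltrDl.
have Mge0 : 0 <= M by rewrite addr_ge0.
pose q := `|x| / K; have q0 : 0 <= q by rewrite divr_ge0// ltW.
have q1 : q < 1 by rewrite /q ltr_pdivrMr// mul1r.
(* The ratio [s] lies strictly between [q] and 1: [(q / s) ^+ n] absorbs the factor [n.+1], and a
   geometric series of ratio [s] is left for comparison. *)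
pose s := (1 + q) / 2.
have qs : q < s by rewrite /s; lra.
have s1 : s < 1 by rewrite /s; lra.
have s0 : 0 < s by lra.
have t01 : 0 <= q / s < 1 by rewrite divr_ge0 ?(ltW s0)//= ltr_pdivrMr// mul1r.
pose A := (1 - q / s)^-1.
have hA n : n.+1%:R * (q / s) ^+ n <= A by exact: natr_geometric_le.
have A0 : 0 <= A by apply: le_trans (hA 0%N); rewrite expr0 mulr1.
apply: normed_cvg.
apply: (@series_le_cvg _ _ (geometric (M / K * A) s)) => [n|n|n|].
- by rewrite normr_ge0.
- exact: mulr_ge0 (mulr_ge0 (divr_ge0 Mge0 (ltW K0)) A0) (exprn_ge0 _ (ltW s0)).
- rewrite /pseries_diffs /geometric/= !normrM normrX ger0_norm//.
  have : `|c n.+1| * K ^+ n.+1 <= M.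
    by have := hM n.+1; rewrite normrM [`|K ^+ _|]ger0_norm// exprn_ge0// ltW.
  rewrite -ler_pdivlMr ?exprn_gt0// => cM.
  have h2 := hA n.
  apply: (@le_trans _ _ (n.+1%:R * (M / K ^+ n.+1) * `|x| ^+ n)).
    by rewrite ler_wpM2r ?exprn_ge0// ler_wpM2l.
  have -> : n.+1%:R * (M / K ^+ n.+1) * `|x| ^+ n =
      M / K * (n.+1%:R * (q / s) ^+ n) * s ^+ n.
    have ring_eq (a b k u y : R) : k != 0 -> u != 0 ->
        a * (b / k ^+ n.+1) * y ^+ n = b / k * (a * (y / k / u) ^+ n) * u ^+ n.
      move=> k0 u0; rewrite !expr_div_n exprS invfM.
      move: (expf_neq0 n k0) (expf_neq0 n u0).
      by move: (y ^+ n) (u ^+ n) (k ^+ n) => Y V W W0 V0; field; rewrite V0 W0 k0.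
    by apply: ring_eq; rewrite gt_eqF.
  by rewrite ler_wpM2r ?exprn_ge0 ?(ltW s0)// ler_wpM2l// divr_ge0// ltW.
- by apply: is_cvg_geometric_series; rewrite ger0_norm// ltW.
Qed.

Lemma is_derive_pseries e c x : converges_on e c -> `|x| < e ->
  is_derive x 1 (fun y => limn (pseries c y)) (limn (pseries (pseries_diffs c) x)).
Proof.
move=> H xe; pose K := (`|x| + e) / 2.
have xK : `|x| < K by rewrite /K; lra.
have Ke : `|K| < e by rewrite ger0_norm ?(le_trans _ (ltW xK))// /K; lra.
apply: (@pseries_snd_diffs _ _ K).
- exact: H.
- exact: converges_on_diffs Ke.
- by apply: converges_on_diffs Ke; exact: converges_on_diffs.
- by apply: lt_le_trans xK _; exact: ler_norm.
Qed.

(** The factor is (n + 1) ... (n + j). What matters is that it is nonzero and independent of [c],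
    hence the same for all coordinates of a curve. *)
Lemma iter_diffsE j n : exists2 a : R, a != 0 &
  forall c, iter j (@pseries_diffs R) c n = a * c (n + j)%N.
Proof.
elim: j n => [|j IH] n; first by exists 1; rewrite ?oner_eq0// => c; rewrite addn0 mul1r.
have [a a0 aE] := IH n.+1; exists (n.+1%:R * a); first by rewrite mulf_neq0// pnatr_eq0.
by move=> c; rewrite /= /pseries_diffs aE mulrA addSnnS.
Qed.

Lemma limn_pseries0 c : limn (pseries c 0) = c 0%N.
Proof.
apply/cvg_lim => //; apply: cvg_near_cst; exists 1%N => // -[//|n] _.
rewrite /pseries /series/= big_nat_recl//= expr0 mulr1 big1 ?addr0// => i _.
by rewrite expr0n mulr0.
Qed.

Lemma cvg_sum_seq (I : Type) (s : seq I) (f : I -> nat -> R) (l : I -> R) :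
  (forall i, f i n @[n --> \oo] --> l i) ->
  \sum_(i <- s) f i n @[n --> \oo] --> \sum_(i <- s) l i.
Proof.
move=> H; elim: s => [|i s IH].
  by rewrite big_nil; under eq_fun do rewrite big_nil; exact: cvg_cst.
by rewrite big_cons; under eq_fun do rewrite big_cons; exact: cvgD.
Qed.

End power_series.

Section analytic_curves.
Context {R : realType} {d : nat}.
Implicit Types (Q : R -> 'rV[R]_d) (v : 'rV[R]_d) (c : nat -> 'rV[R]_d).

Definition coefs c (i : 'I_d) : nat -> R := fun n => c n 0 i.

Lemma analytic_coordinates U Q a : real_analytic U Q -> U a ->
  exists e c, [/\ 0 < e, forall i, converges_on e (coefs c i) &
    forall y, `|y - a| < e -> forall i, Q y 0 i = limn (pseries (coefs c i) (y - a))].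
Proof.
move=> anQ Ua; have [c /nbhs_ballP[e /= e0 H]] := anQ a Ua.
have key y i : `|y - a| < e -> pseries (coefs c i) (y - a) @ \oo --> Q y 0 i.
  move=> ye; have ya : ball a e y by rewrite /ball/= distrC.
  have := @cvg_comp _ _ _ _ (fun M : 'rV[R]_d => M 0 i) _ _ _ (H y ya)
    (@coord_continuous R 1 d 0 i (Q y)).
  rewrite (_ : _ \o _ = pseries (coefs c i) (y - a))//.
  apply/funext => n; rewrite /pseries /series /= summxE; apply: eq_bigr => k _.
  by rewrite mxE mulrC.
exists e, c; split=> //.
- move=> i x xe; have := key (x + a) i; rewrite addrK => /(_ xe) h.
  by apply/cvg_ex; exists (Q (x + a) 0 i).
- by move=> y ye i; apply/esym/cvg_lim => //; exact: key.
Qed.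

Lemma analytic_derivatives Q a e c : 0 < e -> (forall i, converges_on e (coefs c i)) ->
  (forall y, `|y - a| < e -> forall i, Q y 0 i = limn (pseries (coefs c i) (y - a))) ->
  forall j y, `|y - a| < e -> derivable (derive1n j Q) y 1 /\
    forall i, derive1n j Q y 0 i = limn (pseries (iter j (@pseries_diffs R) (coefs c i)) (y - a)).
Proof.
move=> e0 conv QE.
have convj j i : converges_on e (iter j (@pseries_diffs R) (coefs c i)).
  by elim: j => [|j IH] /=; [exact: conv|exact: converges_on_diffs].
have dj j (P : R -> 'rV[R]_d) : (forall y, `|y - a| < e -> forall i,
      P y 0 i = limn (pseries (iter j (@pseries_diffs R) (coefs c i)) (y - a))) ->
    forall y, `|y - a| < e -> forall i, is_derive y 1 (fun z => P z 0 i)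
      (limn (pseries (iter j.+1 (@pseries_diffs R) (coefs c i)) (y - a))).
  move=> PE y ye i.
  apply: (@near_eq_is_derive _ _ _
    (fun z => limn (pseries (iter j (@pseries_diffs R) (coefs c i)) (z - a)))).
    have ey : 0 < e - `|y - a| by rewrite subr_gt0.
    apply/nbhs_ballP; exists (e - `|y - a|) => //= z; rewrite /ball/= => zy.
    rewrite PE// (_ : z - a = (y - a) - (y - z)); last by ring.
    by apply: (le_lt_trans (ler_normB _ _)); lra.
  rewrite -[X in is_derive _ _ _ X]mulr1.
  apply: (@is_derive1_comp R
    (fun x => limn (pseries (iter j (@pseries_diffs R) (coefs c i)) x)) (fun z => z - a)).
    exact: is_derive_pseries.
  rewrite -[X in is_derive _ _ _ X]subr0.
  by apply: is_deriveB.
elim=> [|j IH] y ye; last first.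
  have H : forall z, `|z - a| < e -> forall i, derive1n j.+1 Q z 0 i =
      limn (pseries (iter j.+1 (@pseries_diffs R) (coefs c i)) (z - a)).
    move=> z ze i; have [dz _] := IH z ze.
    have := dj j (derive1n j Q) (fun w we => (IH w we).2) z ze i => /@derive_val <-.
    by rewrite derive1nS derive1E derive_mx// mxE.
  split; last exact: H.
  apply/derivable_mxP => i0 i; rewrite (ord1 i0).
  exact: (@ex_derive _ _ _ _ _ _ _ (dj j.+1 (derive1n j.+1 Q) H y ye i)).
split; last exact: QE.
apply/derivable_mxP => i0 i; rewrite (ord1 i0).
exact: (@ex_derive _ _ _ _ _ _ _ (dj 0%N Q QE y ye i)).
Qed.

Lemma curve_det_eq0 Q v y : v != 0 ->
  (forall j, (j < d)%N -> dotp v (derive1n j.+1 Q y) = 0) -> curve_det Q y = 0.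
Proof.
move=> v0 H; apply/eqP/det0P; exists v => //.
apply/rowP => j; rewrite !mxE -[RHS](H j (ltn_ord j)).
by apply: eq_bigr => i _; rewrite mxE.
Qed.

(** The derivatives at [a] are nonzero multiples of the coefficients, so [v] is orthogonal to every
    non-constant coefficient and the function <v, Q> is constant near [a]. *)
Lemma analytic_dotp Q a e c v : 0 < e -> (forall i, converges_on e (coefs c i)) ->
  (forall y, `|y - a| < e -> forall i, Q y 0 i = limn (pseries (coefs c i) (y - a))) ->
  (forall k, dotp v (derive1n k.+1 Q a) = 0) ->
  forall j y, `|y - a| < e -> dotp v (derive1n j.+1 Q y) = 0.
Proof.
move=> e0 conv QE H0.
have D := analytic_derivatives e0 conv QE.
have convj j i : converges_on e (iter j (@pseries_diffs R) (coefs c i)).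
  by elim: j => [|j IH] /=; [exact: conv|exact: converges_on_diffs].
have c0 k : dotp v (c k.+1) = 0.
  have aa : `|a - a| < e by rewrite subrr normr0.
  have := H0 k; rewrite /dotp.
  have [b b0 bE] := @iter_diffsE R k.+1 0.
  rewrite (eq_bigr (fun i => b * (v 0 i * c k.+1 0 i))) => [|i _].
    by rewrite -mulr_sumr => /eqP; rewrite mulf_eq0 (negbTE b0) => /eqP.
  by rewrite (D k.+1 a aa).2 subrr limn_pseries0 bE mulrCA.
move=> j y ye; rewrite /dotp.
under eq_bigr do rewrite (D j.+1 y ye).2.
have lim : \sum_(i < d) v 0 i * pseries (iter j.+1 (@pseries_diffs R) (coefs c i)) (y - a) n
    @[n --> \oo] --> \sum_(i < d) v 0 i * limn (pseries (iter j.+1 (@pseries_diffs R) (coefs c i)) (y - a)).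
  apply: cvg_sum_seq => i; apply: cvgM; first exact: cvg_cst.
  exact: (convj j.+1 i).
apply: (cvg_unique _ lim) => //.
rewrite (_ : (fun n => _) = cst 0); first exact: cvg_cst.
apply/funext => n; rewrite /pseries /series/=.
under eq_bigr do rewrite mulr_sumr.
rewrite exchange_big/= big1 // => k _.
have [b b0 bE] := @iter_diffsE R j.+1 k.
rewrite (eq_bigr (fun i => b * (y - a) ^+ k * (v 0 i * c (k + j).+1 0 i))).
  by rewrite -mulr_sumr [\sum_(_ < _) _](c0 (k + j)%N) mulr0.
move=> i _; rewrite -[pseries_diffs _ _]/(iter j.+1 (@pseries_diffs R) (coefs c i) k).
by rewrite bE addnS /coefs; ring.
Qed.

Lemma itv_infinite (a b : R) : a < b -> ~ finite_set `[a, b]%classic.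
Proof.
move=> ab /finite_set_countable/countable_lebesgue_measure0.
rewrite lebesgue_measure_itv/= lte_fin ab => /eqP; rewrite -EFinB eqe subr_eq0.
by rewrite gt_eqF.
Qed.

(** The property shared by the two classes of curves. Where the determinant of an analytic curve
    vanishes, the order [k] may exceed those entering the determinant. *)
Definition spanning_at Q x := forall v, v != 0 ->
  exists2 k, regular_at Q k x & dotp v (derive1n k.+1 Q x) != 0.

(** A direction orthogonal to all derivatives at [x] stays orthogonal to them nearby, so the
    determinant would vanish on a whole compact interval, which is infinite. *)
Lemma analytic_regular U Q : open U -> real_analytic U Q -> non_trapped_curve U Q ->
  forall x, U x -> [/\ {for x, continuous Q}, C2_at Q x & spanning_at Q x].
Proof.
move=> oU anQ ntQ x Ux.
have [e [c [e0 conv QE]]] := analytic_coordinates anQ Ux.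
have D := analytic_derivatives e0 conv QE.
have xx : `|x - x| < e by rewrite subrr normr0.
have cont j : {for x, continuous (derive1n j Q)}.
  by apply: differentiable_continuous; apply/derivable1_diffP; exact: (D j x xx).1.
split.
- exact: (cont 0%N).
- by split; [exact: (D 0%N x xx).1|exact: (D 1%N x xx).1|exact: (cont 2%N)].
move=> v v0.
have [[k kn]|H] := pselect (exists k, dotp v (derive1n k.+1 Q x) != 0).
  exists k => //; split; last exact: cont.
  apply/nbhs_ballP; exists e => //= y; rewrite /ball/= => xy j _.
  by apply: (D j y _).1; rewrite distrC.
have H0 k : dotp v (derive1n k.+1 Q x) = 0.
  by apply/eqP; apply: contrapT => /negP kn; apply: H; exists k.
have Z := analytic_dotp e0 conv QE H0.
have /nbhs_ballP[e1 /= e10 hU] := open_nbhs_nbhs (conj oU Ux).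
pose e2 := Num.min e e1 / 2.
have e20 : 0 < e2 by rewrite divr_gt0// lt_min e0.
have e2e : e2 < e.
  have : Num.min e e1 <= e by rewrite ge_min lexx.
  by rewrite /e2; lra.
have e2e1 : e2 < e1.
  have : Num.min e e1 <= e1 by rewrite ge_min lexx orbT.
  by rewrite /e2; lra.
exfalso; apply: (@itv_infinite (x - e2) (x + e2)); first by lra.
apply: sub_finite_set (ntQ (x - e2) (x + e2) _).
- move=> y /= yI; split=> //; apply: (curve_det_eq0 v0) => j _; apply: Z.
  by move: yI; rewrite in_itv/= -ler_distl => h; apply: le_lt_trans e2e.
- move=> y /=; rewrite in_itv/= -ler_distl => h; apply: hU.
  by rewrite /ball/= distrC; apply: le_lt_trans e2e1.
Qed.

Lemma nondegenerate_regular U Q : (2 <= d)%N -> open U -> class_C d.+1 U Q ->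
  nondegenerate_curve U Q ->
  forall x, U x -> [/\ {for x, continuous Q}, C2_at Q x & spanning_at Q x].
Proof.
move=> d2 oU [dQ _] ndQ x Ux.
have cont j : (j < d.+1)%N -> {for x, continuous (derive1n j Q)}.
  move=> jd; apply: differentiable_continuous; apply/derivable1_diffP.
  exact: dQ.
split.
- exact: (cont 0%N).
- by split; [exact: (dQ 0%N)|apply: (dQ 1%N); rewrite // ltnS ltnW|exact: (cont 2%N)].
move=> v v0.
have [j jn] : exists j : 'I_d, dotp v (derive1n j.+1 Q x) != 0.
  (* A direction orthogonal to the first [d] derivatives would be a left null vector of the
     matrix. *)
  apply: contrapT => H; move/eqP: (ndQ x Ux); apply; apply: (curve_det_eq0 v0) => j jd.
  by apply/eqP; apply: contrapT => /negP nz; apply: H; exists (Ordinal jd).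
exists j => //; split; last by apply: cont; rewrite ltnS.
have /nbhs_ballP[e1 /= e10 hU] := open_nbhs_nbhs (conj oU Ux).
apply/nbhs_ballP; exists e1 => //= y /hU Uy k kj; apply: dQ => //.
by apply: (leq_ltn_trans kj); rewrite ltnS ltnW.
Qed.

End analytic_curves.

Theorem theorem1p1 (R : realType) (mu : probability R R)
    (mu_self_similar : self_similar mu) (mu_non_atomic : non_atomic mu)
    (d : nat) (d_ge2 : (2 <= d)%N)
    (U : set R) (U_open : open U) (U_interval : is_interval U)
    (U_support : measure_support mu `<=` U)
    (Q : R -> 'rV[R]_d)
    (Q_curve : (real_analytic U Q /\ non_trapped_curve U Q) \/
               (class_C d.+1 U Q /\ nondegenerate_curve U Q)) :
  forall eps : R, 0 < eps ->
  exists p : R, 1 < p /\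
  exists C : R, forall r : R, 1 < r ->
    (\int[lebesgue_rV d]_(xi in euclidean_ball r)
       ((Normc.normc (fourier (curve_measure mu U Q) xi)) `^ p)%:E
     <= (C * r `^ eps)%:E)%E.
Proof.
move=> eps eps0.
have regQ x : U x -> [/\ {for x, continuous Q}, C2_at Q x & spanning_at Q x].
  case: Q_curve => -[h1 h2]; first exact: (analytic_regular U_open h1 h2).
  exact: (nondegenerate_regular d_ge2 U_open h1 h2).
have [B [rB aB]] := represents_self_similar mu_self_similar.
have [M0 M00 HM0] := bounded_mass rB aB.
have [al [be [hull sal sbe]]] := exists_hull mu_non_atomic M00 HM0.
have albe : al < be by case: hull.
(* The endpoints of the hull belong to the support, hence to [U], and [U] is an interval. *)
have KU x : x \in `[al, be] -> U x.
  by rewrite in_itv/=; apply: U_interval; exact: U_support.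
have [M [Mge0 taylorQ lipQ bndQ]] := curve_taylor albe (fun x xK =>
  let: And3 _ C2Q _ := regQ x (KU x xK) in C2Q).
have [|Ct [ct [Ct0 ct0 thinQ]]] := @thin_sublevels R mu d Q B al be hull rB aB mu_non_atomic.
  by move=> x v xK v0; have [_ _ h] := regQ x (KU x xK); exact: h.
have mQ : measurable_fun setT (Q \_ U).
  by apply: measurable_restrict_continuous => // x /regQ[].
have mG v : measurable_fun [set: R] (fun x => dotp v ((Q \_ U) x)).
  by apply: (@measurableT_comp _ _ _ _ _ _ (dotp v)) => //; exact: measurable_dotp.
have QU x : x \in `[al, be] -> (Q \_ U) x = Q x by move=> /KU Ux; rewrite patchE mem_set.
have taylorG v x y : x \in `[al, be] -> y \in `[al, be] ->
    `|dotp v ((Q \_ U) y) - dotp v ((Q \_ U) x) - (y - x) * dotp v (derive1n 1 Q x)| <=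
    M * `|v| * `|y - x| ^+ 2.
  by move=> xK yK; rewrite !QU//; exact: taylorQ.
(* The patched curve is measurable on the whole line; its linearisation uses the derivative of [Q]
   itself, with which it is consistent on the hull. *)
have core kap := @core_power R d mu al be hull B rB aB mu_non_atomic (Q \_ U) (derive1n 1 Q)
  mG M Mge0 taylorG lipQ bndQ Ct ct Ct0 ct0 thinQ kap.
have sb := spectrum_bound_small mG core (ltnW d_ge2) eps0.
have [p p1 [C H]] := spectrum_bound_integral mG eps0 sb.
exists p; split=> //; exists C => r r1.
by under eq_integral do rewrite normc_fourier//; exact: H.
Qed.
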